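(* Let $f$ be a transcendental meromorphic function in $\mathbb{C}$, let $\varphi(z)\not\equiv 0,\infty$ be a small function of $f$, and let $k\ge 1$, $q_0\ge 1$, $q_i\ge 0$ $(i=1,2,\ldots,k-1)$, $q_k\ge 1$ be integers. Let $a(z)\not\equiv 0,\infty$ be a small function of $f$, and put $M[f]=a(z)(f)^{q_0}(f')^{q_1}\cdots(f^{(k)})^{q_k}$, $\mu=q_0+q_1+\cdots+q_k$ and $\mu_*=q_1+2q_2+\cdots+kq_k$. Then $$\mu T(r,f)\le \overline{N}(r,\infty;f)+(\mu-q_0)N(r,0;f)+(1+\mu_* )\overline{N}(r,0;f)+\overline{N}(r,\varphi(z);M[f])+S(r,f).$$
   Context: Standard notation of Nevanlinna theory is used: $T(r,f)$ is the Nevanlinna characteristic. $N(r,a;f)$ is the integrated counting function of $a$-points of $f$ counted with multiplicity ($a=\infty$ meaning poles), and $\overline{N}(r,a;f)$ is the corresponding reduced counting function (each point counted once). For a meromorphic function $\varphi$, $\overline{N}(r,\varphi(z);M[f])=\overline{N}\left(r,\frac{1}{M[f]-\varphi(z)}\right)$ counts the distinct zeros of $M[f]-\varphi$. $S(r,f)$ denotes any quantity satisfying $S(r,f)=o(T(r,f))$ as $r\to\infty$, $r\notin E$, where $E$ is a set of positive real numbers of finite linear (Lebesgue) measure, not necessarily the same at each occurrence. A meromorphic function $b(z)\not\equiv 0,\infty$ is a small function of (with respect to) $f$ if $T(r,b)=S(r,f)$. *)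

(* Defs.v *)
From HB Require Import structures.
From mathcomp Require Import all_boot all_order all_algebra.
From mathcomp Require Import complex.
From mathcomp Require Import all_classical all_reals all_analysis.

Set Implicit Arguments.
Unset Strict Implicit.
Unset Printing Implicit Defensive.

Import Order.TTheory GRing.Theory Num.Theory.
Import numFieldNormedType.Exports.

Local Open Scope classical_set_scope.
Local Open Scope ring_scope.

(* The norm of R[i] takes its values in R[i]; [cmod] is the same modulus, as an
   element of R.  The topology of the complex plane is carried by R[i]^o. *)
Definition cmod (R : realType) (z : R[i]) : R := complex.Re `|z|.

Definition holomorphic_at (R : realType) (f : R[i] -> R[i]) (z : R[i]) : Prop :=
  \forall w \near (z : R[i]^o), derivable (f : R[i]^o -> R[i]^o) w 1.

Definition pole_at (R : realType) (f : R[i] -> R[i]) (z : R[i]) : Prop :=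
  (\forall w \near (z : R[i]^o)^', derivable (f : R[i]^o -> R[i]^o) w 1) /\
  cmod (f w) @[w --> (z : R[i]^o)^'] --> +oo.

(* A meromorphic function is given by a total function whose values at the poles
   are irrelevant.  Removable singularities are not allowed, so that for such
   functions "not identically zero" is the same as "nonzero at some point". *)
Definition meromorphic (R : realType) (f : R[i] -> R[i]) : Prop :=
  forall z, holomorphic_at f z \/ pole_at f z.

(* Equality with a quotient of polynomials is required off the zeros of the
   denominator only, because of the irrelevant values at the poles. *)
Definition rational_fun (R : realType) (f : R[i] -> R[i]) : Prop :=
  exists p d : {poly R[i]},
    d != 0 /\ forall z, d.[z] != 0 -> f z = p.[z] / d.[z].

Definition transcendental_meromorphic (R : realType) (f : R[i] -> R[i]) : Prop :=
  meromorphic f /\ ~ rational_fun f.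

(* Orders depend on f near z only through a punctured neighbourhood of z.  Hence
   they make sense for pointwise sums, products and derivatives of meromorphic
   functions, whose values on a discrete set may be meaningless. *)
Definition has_order (R : realType) (f : R[i] -> R[i]) (z : R[i]) (n : int) :
    Prop :=
  exists g : R[i] -> R[i], [/\ holomorphic_at g z, g z != 0 &
    \forall w \near (z : R[i]^o)^', f w = (w - z) ^ n * g w].

(* The order is unique when it exists; the default 0 is used when f vanishes
   identically near z. *)
Definition order_at (R : realType) (f : R[i] -> R[i]) (z : R[i]) : int :=
  xget 0 [set n | has_order f z n].

Definition pole_mult (R : realType) (f : R[i] -> R[i]) (z : R[i]) : nat :=
  if order_at f z is Negz n then n.+1 else 0%N.

(* Multiplicity of z as a zero of f - b, where b is a function. *)
Definition point_mult (R : realType) (b f : R[i] -> R[i]) (z : R[i]) : nat :=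
  if order_at (fun w => f w - b w) z is Posz n then n else 0%N.

Definition reduced_mult (R : realType) (mult : R[i] -> nat) (z : R[i]) : nat :=
  (0 < mult z)%N.

Definition counting_fun (R : realType) (mult : R[i] -> nat) (t : R) : R :=
  \sum_(z \in [set z : R[i] | cmod z <= t]) ((mult z)%:R : R).

Definition int_counting (R : realType) (mult : R[i] -> nat) (r : R) : R :=
  \int[lebesgue_measure]_(t in `[0, r]) ((counting_fun mult t - counting_fun mult 0) / t)
  + counting_fun mult 0 * ln r.

Definition N_pole (R : realType) (r : R) (f : R[i] -> R[i]) : R :=
  int_counting (pole_mult f) r.

Definition Nbar_pole (R : realType) (r : R) (f : R[i] -> R[i]) : R :=
  int_counting (reduced_mult (pole_mult f)) r.

Definition N_point (R : realType) (r : R) (b f : R[i] -> R[i]) : R :=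
  int_counting (point_mult b f) r.

Definition Nbar_point (R : realType) (r : R) (b f : R[i] -> R[i]) : R :=
  int_counting (reduced_mult (point_mult b f)) r.

(* Since ln is 0 on nonpositive numbers, this gives log^+ 0 = 0. *)
Definition log_plus (R : realType) (x : R) : R := Num.max 0 (ln x).

Definition circle_pt (R : realType) (r t : R) : R[i] :=
  Complex (r * cos t) (r * sin t).

Definition proximity (R : realType) (r : R) (f : R[i] -> R[i]) : R :=
  (2 * pi)^-1 *
  \int[lebesgue_measure]_(t in `[0, 2 * pi]) log_plus (cmod (f (circle_pt r t))).

Definition nevanlinna_T (R : realType) (r : R) (f : R[i] -> R[i]) : R :=
  proximity r f + N_pole r f.

(* [is_S f S] : S(r) = o(T(r,f)) as r tends to infinity outside a set of positive
   numbers of finite linear measure. *)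
Definition is_S (R : realType) (f : R[i] -> R[i]) (S : R -> R) : Prop :=
  exists E : set R, [/\ measurable E, E `<=` [set r | 0 < r],
    (lebesgue_measure E < +oo)%E &
    forall eps : R, 0 < eps ->
      \forall r \near +oo, ~ E r -> `|S r| <= eps * nevanlinna_T r f].

Definition small_function (R : realType) (f b : R[i] -> R[i]) : Prop :=
  [/\ meromorphic b, (exists z, b z != 0) &
      is_S f (fun r => nevanlinna_T r b)].

Definition diff_monomial (R : realType) (a : R[i] -> R[i]) (k : nat)
    (q : nat -> nat) (f : R[i] -> R[i]) : R[i] -> R[i] :=
  fun z => a z * \prod_(i < k.+1) (derive1n i (f : R[i]^o -> R[i]^o) z) ^+ q i.

(* Main.v *)
Require Import Defs.
From HB Require Import structures.
From mathcomp Require Import all_boot all_order all_algebra.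
From mathcomp Require Import complex.
From mathcomp Require Import all_classical all_reals all_analysis.
From mathcomp Require Import zify ring lra.
Set Implicit Arguments.
Unset Strict Implicit.
Unset Printing Implicit Defensive.
Import Order.TTheory GRing.Theory Num.Theory.
Import numFieldNormedType.Exports.
Local Open Scope classical_set_scope.
Local Open Scope ring_scope.

(* Put M = M[f], G = M/phi and h = G'/(G - 1).  From
     1/f^mu = G/f^mu - (G'/G) (G/f^mu) (G - 1)/G'
   and the lemma on the logarithmic derivative, mu m(r,1/f) <= m(r,1/h) + S(r,f), while Jensen's
   formula turns m(r,1/h) into N(r,h) - N(r,1/h) + S(r,f).  A comparison of orders at each point
   gives
     N(r,h) - N(r,1/h) + mu N(r,1/f) <= Nbar(r,f) + (mu - q_0) N(r,1/f) + Nbar(r,1/f)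
                                        + Nbar(r,1/(M - phi)) + S(r,f):
   h has at most simple poles, which lie at poles of f, zeros of M - phi or zeros and poles of a
   and phi; and at a zero of f of order p at which G has order n >= 1, n is at least q_0 p up to
   the orders of a and phi, and h has a zero of order n - 1.  If G is constant, the first identity
   is replaced by 1/f^mu = (G/f^mu)/G.

   For the lemma on the logarithmic derivative, g'/g is bounded on |z| = r by applying the
   Schwarz formula to the logarithm of g divided by a Blaschke product, on a slightly larger disc;
   the radii are chosen by Borel's growth lemma (the characteristic is monotone on circles avoiding
   zeros and poles), and r stays away from the moduli of zeros and poles. *)

(** All estimates hold only for large r off an exceptional set, whereas the inequality is claimed
    for every r > 0. Hence S is taken to be the positive part of the excess of the left side over
    the other terms, and only its smallness has to be proved. The lemma on the logarithmic
    derivative leaves errors ln r and ln T, so T(r, f)/ln r must tend to infinity. This is where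
    transcendence enters: slower growth leaves finitely many zeros and poles, and a Liouville
    argument then makes f rational. Transcendence also prevents every derivative of f from vanishing
    identically, so that M and G have an order at each point. Functions are total, with arbitrary
    values at poles, and products and derivatives inherit such values. Orders are therefore read off
    punctured neighbourhoods, circles are chosen to avoid the bad points, and identities cross an
    isolated point only by continuity. The function theory starts from Goursat's theorem and is
    phrased with means over circles centred at 0, the only contours that occur in the
    characteristic; translation covers other centres. *)

Import ComplexField.
Notation cRe := complex.Re.
Notation cIm := complex.Im.

(** * Complex calculus *)

Section Modulus.
Context {R : realType}.
Notation C := R[i].
Implicit Types z w : C.

Lemma normc_cmod z : `|z| = (cmod z)%:C%C.
Proof. by rewrite /cmod normc_def. Qed.

Lemma cmodE z : cmod z = Num.sqrt (cRe z ^+ 2 + cIm z ^+ 2).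
Proof. by rewrite /cmod normc_def. Qed.

Lemma cmod_ge0 z : 0 <= cmod z.
Proof. by rewrite cmodE sqrtr_ge0. Qed.

Lemma cmodM z w : cmod (z * w) = cmod z * cmod w.
Proof.
by apply: complexI; rewrite rmorphM /= -!normc_cmod normrM.
Qed.

Lemma cmodD z w : cmod (z + w) <= cmod z + cmod w.
Proof. by rewrite -lecR rmorphD /= -!normc_cmod ler_normD. Qed.

Lemma cmodN z : cmod (- z) = cmod z.
Proof. by rewrite /cmod normrN. Qed.

Lemma cmodC z w : cmod (z - w) = cmod (w - z).
Proof. by rewrite -cmodN opprB. Qed.

Lemma cmod0 : cmod (0 : C) = 0.
Proof. by rewrite /cmod normr0. Qed.

Lemma cmod1 : cmod (1 : C) = 1.
Proof. by rewrite /cmod normr1. Qed.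

Lemma cmod_eq0 z : (cmod z == 0) = (z == 0).
Proof.
by apply/eqP/eqP => [|->]; [move=> h; apply: normr0_eq0; rewrite normc_cmod h|exact: cmod0].
Qed.

Lemma cmod_gt0 z : (0 < cmod z) = (z != 0).
Proof. by rewrite lt_neqAle cmod_ge0 andbT eq_sym cmod_eq0. Qed.

Lemma cmodV z : cmod z^-1 = (cmod z)^-1.
Proof.
have [->|z0] := eqVneq z 0; first by rewrite invr0 cmod0 invr0.
have cz : cmod z != 0 by rewrite cmod_eq0.
by apply: (mulfI cz); rewrite -cmodM !divff // cmod1.
Qed.

Lemma cmodf z w : cmod (z / w) = cmod z / cmod w.
Proof. by rewrite cmodM cmodV. Qed.

Lemma cmodX z n : cmod (z ^+ n) = cmod z ^+ n.
Proof. by elim: n => [|n ih]; rewrite ?expr0 ?cmod1 // !exprS cmodM ih. Qed.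

Lemma cmodXz z (n : int) : cmod (z ^ n) = cmod z ^ n.
Proof. by case: n => n /=; rewrite ?NegzE -?invr_expz ?cmodV -?exprnP cmodX. Qed.

Lemma cmod_prod (I : Type) (s : seq I) (F : I -> C) :
  cmod (\prod_(i <- s) F i) = \prod_(i <- s) cmod (F i).
Proof. by elim/big_rec2: _ => [|i x y _ <-]; rewrite ?cmod1 ?cmodM. Qed.

Lemma cmodB_le z w : cmod (z - w) <= cmod z + cmod w.
Proof. by rewrite -[cmod w]cmodN cmodD. Qed.

Lemma cmod_leB z w : cmod z - cmod w <= cmod (z - w).
Proof. by rewrite lerBlDr -{1}[z](subrK w) cmodD. Qed.

Lemma cmod_tri z w v : cmod (z - w) <= cmod (z - v) + cmod (v - w).
Proof. by rewrite -{1}[z](subrK v) -addrA cmodD. Qed.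

Lemma cmod_real (x : R) : cmod x%:C%C = `|x|.
Proof. by rewrite cmodE /= expr0n addr0 sqrtr_sqr. Qed.

Lemma cmod_nat n : cmod (n%:R : C) = n%:R.
Proof. by rewrite -(rmorph_nat (real_complex R)) cmod_real ger0_norm. Qed.

Lemma cRe_le z : `|cRe z| <= cmod z.
Proof. by rewrite cmodE -sqrtr_sqr ler_wsqrtr // lerDl sqr_ge0. Qed.

Lemma cIm_le z : `|cIm z| <= cmod z.
Proof. by rewrite cmodE -sqrtr_sqr ler_wsqrtr // lerDr sqr_ge0. Qed.

Lemma cmod_i : cmod ('i%C : C) = 1.
Proof. by rewrite cmodE /= expr0n expr1n add0r sqrtr1. Qed.

Lemma cmod_le_ReIm z : cmod z <= `|cRe z| + `|cIm z|.
Proof.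
rewrite {1}[z]complexE; apply: (le_trans (cmodD _ _)).
by rewrite cmodM cmod_i mul1r !cmod_real.
Qed.

Lemma cmod_conj z : cmod (z^*)%C = cmod z.
Proof. by rewrite /cmod normcJ. Qed.

Lemma mul_conj z : z * (z^*)%C = (cmod z ^+ 2)%:C%C.
Proof. by rewrite -sqr_normc normc_cmod rmorphXn. Qed.

Lemma cReD z w : cRe (z + w) = cRe z + cRe w. Proof. by case: z; case: w. Qed.
Lemma cImD z w : cIm (z + w) = cIm z + cIm w. Proof. by case: z; case: w. Qed.
Lemma cReN z : cRe (- z) = - cRe z. Proof. by case: z. Qed.
Lemma cImN z : cIm (- z) = - cIm z. Proof. by case: z. Qed.
Lemma cReM z w : cRe (z * w) = cRe z * cRe w - cIm z * cIm w.
Proof. by case: z; case: w. Qed.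
Lemma cImM z w : cIm (z * w) = cRe z * cIm w + cIm z * cRe w.
Proof. by case: z => a b; case: w => c d /=; rewrite [RHS]addrC; ring. Qed.
Lemma ceq z w : cRe z = cRe w -> cIm z = cIm w -> z = w.
Proof. by case: z; case: w => a b c d /= -> ->. Qed.

End Modulus.

(** * Neighbourhoods with real radii *)

Section Neighbourhoods.
Context {R : realType}.
Notation C := R[i].

(** The library balls of [R[i]^o] have radii in [R[i]]. Real radii keep all estimates in the ordered
    field [R]; [nbhs_cnear] and [dnbhs_cnear] give the translation. *)
Definition cnear (z : C) : set_system C :=
  fun P => exists2 d : R, 0 < d & forall w, cmod (w - z) < d -> P w.

Global Instance cnear_filter z : ProperFilter (cnear z).
Proof.
apply: Build_ProperFilter.
- by case=> d d0 /(_ z); rewrite subrr cmod0; apply.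
- split.
  + by exists 1.
  + move=> P Q [d d0 h] [e e0 k]; exists (Num.min d e); first by rewrite lt_min d0.
    by move=> w; rewrite lt_min => /andP[/h ? /k].
  + by move=> P Q PQ [d d0 h]; exists d => // w /h /PQ.
Qed.

Lemma cnearI z (P Q : set C) : cnear z P -> cnear z Q -> cnear z (P `&` Q).
Proof. exact: filterI. Qed.

Lemma cnearS z (P Q : set C) : (forall w, P w -> Q w) -> cnear z P -> cnear z Q.
Proof. by move=> PQ; apply: filterS. Qed.

Lemma cnearW z (P : set C) : (forall w, P w) -> cnear z P.
Proof. by exists 1. Qed.

Lemma cnear_self z (P : set C) : cnear z P -> P z.
Proof. by case=> d d0; apply; rewrite subrr cmod0. Qed.

Lemma cnear_near z (P : set C) : cnear z P -> cnear z (fun w => cnear w P).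
Proof.
case=> d d0 h; exists (d / 2); first by rewrite divr_gt0.
move=> w wz; exists (d / 2); first by rewrite divr_gt0.
move=> v vw; apply: h; apply: (le_lt_trans (cmod_tri _ _ w)).
by rewrite [d]splitr ltrD.
Qed.

Lemma cnear_neq z w : w != z -> cnear w (fun v => v != z).
Proof.
move=> wz; exists (cmod (w - z)); first by rewrite cmod_gt0 subr_eq0.
by move=> v; apply: contraTneq => ->; rewrite cmodC ltxx.
Qed.

Lemma cnear_lt r z : cmod z < r -> cnear z (fun w => cmod w < r).
Proof.
move=> zr; exists (r - cmod z); first by rewrite subr_gt0.
move=> w h; rewrite -[w](subrK z); apply: (le_lt_trans (cmodD _ _)).
by rewrite -ltrBrDr.
Qed.

Lemma cnear_ball z (d : R) : 0 < d -> cnear z (fun w => cmod (w - z) < d).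
Proof. by exists d. Qed.

Lemma nbhs_cnear (z : C) (P : set C) : nbhs (z : R[i]^o) P <-> cnear z P.
Proof.
rewrite -filter_from_ballE; split => [[e /= e0 h]|[d d0 h]].
  have er : e = (cRe e)%:C%C by rewrite RRe_real // gtr0_real.
  exists (cRe e); first by move: e0; rewrite {1}er ltcR.
  move=> w wz; apply: h; rewrite /ball /= er -opprB normrN normc_cmod ltcR.
  exact: wz.
exists (d%:C%C); first by rewrite /= ltcR.
move=> w; rewrite /ball /= normc_cmod ltcR => hw; apply: h.
by rewrite cmodC.
Qed.

Lemma dnbhs_cnear (z : C) (P : set C) :
  (z : R[i]^o)^' P <-> cnear z (fun w => w != z -> P w).
Proof. by rewrite /dnbhs /within /=; exact: nbhs_cnear. Qed.

Lemma cnear_ex z (P : set C) : cnear z (fun w => w != z -> P w) ->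
  exists2 w, w != z & P w.
Proof.
case=> d d0 h; have e : z + (d / 2)%:C%C != z.
  rewrite -subr_eq0 addrC addKr -cmod_eq0 cmod_real normr_eq0.
  by rewrite gt_eqF // divr_gt0.
exists (z + (d / 2)%:C%C) => //; apply: h => //.
rewrite addrC addKr cmod_real ger0_norm ?divr_ge0 ?(ltW d0) //.
by rewrite ltr_pdivrMr // ltr_pMr // ltr1n.
Qed.

End Neighbourhoods.

(** * Continuity and complex derivatives by explicit estimates *)

Section Calculus.
Context {R : realType}.
Notation C := R[i].
Implicit Types (f g : C -> C) (z w d : C).

Definition ccont f z := forall e : R, 0 < e -> cnear z (fun w => cmod (f w - f z) < e).

(** First-order expansion rather than a limit of quotients: the point w = z needs no exclusion, and
    sums, products and compositions become inequalities. *)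
Definition cder f z d := forall e : R, 0 < e ->
  cnear z (fun w => cmod (f w - f z - d * (w - z)) <= e * cmod (w - z)).

Definition cdif f z := exists d, cder f z d.

Definition holo f z := cnear z (cdif f).

Lemma ccont_eq f g z : cnear z (fun w => f w = g w) -> ccont f z -> ccont g z.
Proof.
move=> fg cf e /cf h; have fgz := cnear_self fg.
by near=> w; rewrite -fgz -(near fg w) //; near: w.
Unshelve. all: end_near. Qed.

Lemma cder_eq f g z d : cnear z (fun w => f w = g w) -> cder f z d -> cder g z d.
Proof.
move=> fg cf e /cf h; have fgz := cnear_self fg.
by near=> w; rewrite -fgz -(near fg w) //; near: w.
Unshelve. all: end_near. Qed.

Lemma cdif_eq f g z : cnear z (fun w => f w = g w) -> cdif f z -> cdif g z.
Proof. by move=> fg [d h]; exists d; apply: cder_eq h. Qed.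

Lemma holo_eq f g z : cnear z (fun w => f w = g w) -> holo f z -> holo g z.
Proof.
move=> /cnear_near fg h; near=> w; apply: (cdif_eq (f := f)); first by near: w.
by near: w.
Unshelve. all: end_near. Qed.

Lemma holo_cdif f z : holo f z -> cdif f z. Proof. exact: cnear_self. Qed.

Lemma cder_lip f z d : cder f z d ->
  cnear z (fun w => cmod (f w - f z) <= (cmod d + 1) * cmod (w - z)).
Proof.
move=> /(_ 1 ltr01) h; apply: filterS h => w hw.
rewrite -[f w - f z](subrK (d * (w - z))); apply: (le_trans (cmodD _ _)).
by rewrite cmodM mulrDl addrC lerD2l.
Qed.

Lemma cder_cont f z d : cder f z d -> ccont f z.
Proof.
move=> /cder_lip h e e0; have c0 : 0 < cmod d + 1 by rewrite ltr_wpDl ?cmod_ge0.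
have h2 := cnear_ball z (divr_gt0 e0 c0).
apply: filterS2 h h2 => w hw; rewrite ltr_pdivlMr // mulrC => ?.
exact: le_lt_trans hw _.
Qed.

Lemma cdif_cont f z : cdif f z -> ccont f z.
Proof. by case=> d /cder_cont. Qed.

Lemma holo_cont f z : holo f z -> ccont f z.
Proof. by move/holo_cdif/cdif_cont. Qed.

Lemma cder_cst (a : C) z : cder (fun _ => a) z 0.
Proof.
by move=> e e0; apply: cnearW => w; rewrite subrr mul0r subr0 cmod0 mulr_ge0 ?cmod_ge0 // ltW.
Qed.

Lemma cder_id z : cder id z 1.
Proof.
by move=> e e0; apply: cnearW => w; rewrite mul1r subrr cmod0 mulr_ge0 ?cmod_ge0 // ltW.
Qed.

Lemma cderD f g z a b : cder f z a -> cder g z b ->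
  cder (fun w => f w + g w) z (a + b).
Proof.
move=> hf hg e e0; have e2 : 0 < e / 2 by rewrite divr_gt0.
apply: filterS2 (hf _ e2) (hg _ e2) => w h1 h2.
have -> : f w + g w - (f z + g z) - (a + b) * (w - z) =
  (f w - f z - a * (w - z)) + (g w - g z - b * (w - z)) by ring.
apply: (le_trans (cmodD _ _)); rewrite [e in leRHS]splitr mulrDl.
exact: lerD.
Qed.

Lemma cderM f g z a b : cder f z a -> cder g z b ->
  cder (fun w => f w * g w) z (a * g z + f z * b).
Proof.
(* [K] shares the error [e] between the two linear remainders; [L] is the product of the two
   Lipschitz constants and bounds the product of the increments, which is quadratic in w - z. *)
move=> hf hg e e0; pose K := (cmod (g z) + cmod (f z) + 1) * 2.
have K1 : 1 < K.
  rewrite /K; have := cmod_ge0 (g z); have := cmod_ge0 (f z); lra.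
have K0 : 0 < K by rewrite (lt_trans _ K1).
pose L := (cmod a + 1) * (cmod b + 1).
have L0 : 0 < L by rewrite mulr_gt0 // ltr_wpDl ?cmod_ge0.
have eK : 0 < e / K by rewrite divr_gt0.
have eL : 0 < e / 2 / L by rewrite divr_gt0 // divr_gt0.
have := cnearI (cnearI (hf _ eK) (hg _ eK)) (cnearI (cnearI (cder_lip hf) (cder_lip hg)) (cnear_ball z eL)).
apply: cnearS => w [[h1 h2] [[h3 h4] h5]].
have -> : f w * g w - f z * g z - (a * g z + f z * b) * (w - z) =
  (f w - f z - a * (w - z)) * g z + f z * (g w - g z - b * (w - z)) +
  (f w - f z) * (g w - g z) by ring.
apply: (le_trans (cmodD _ _)); apply: (le_trans (lerD (cmodD _ _) (lexx _))).
rewrite !cmodM; set x := cmod (w - z) in h1 h2 h3 h4 h5 *.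
have x0 : 0 <= x := cmod_ge0 _.
have p1 : cmod (f w - f z - a * (w - z)) * cmod (g z) <= e / K * x * cmod (g z).
  by rewrite ler_wpM2r ?cmod_ge0.
have p2 : cmod (f z) * cmod (g w - g z - b * (w - z)) <= cmod (f z) * (e / K * x).
  by rewrite ler_wpM2l ?cmod_ge0.
have p3 : cmod (f w - f z) * cmod (g w - g z) <= L * x * x.
  rewrite /L [leRHS](_ : _ = ((cmod a + 1) * x) * ((cmod b + 1) * x)); last by ring.
  by rewrite ler_pM ?cmod_ge0.
have p4 : L * x * x <= e / 2 * x.
  rewrite ler_wpM2r //; move: h5; rewrite ltr_pdivlMr // mulrC => /ltW; exact.
have p5 : e / K * x * cmod (g z) + cmod (f z) * (e / K * x) <= e / 2 * x.
  have -> : e / K * x * cmod (g z) + cmod (f z) * (e / K * x) =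
    e * x * ((cmod (g z) + cmod (f z)) / K) by ring.
  rewrite mulrAC ler_wpM2r // ler_pM2l // ler_pdivrMr // /K.
  have := cmod_ge0 (g z); have := cmod_ge0 (f z); lra.
lra.
Qed.

Lemma cderV f z a : f z != 0 -> cder f z a ->
  cder (fun w => (f w)^-1) z (- a / f z ^+ 2).
Proof.
move=> fz hf e e0; pose m := cmod (f z).
have m0 : 0 < m by rewrite cmod_gt0.
pose e1 := e * m ^+ 2 / 4.
have e10 : 0 < e1 by rewrite /e1 divr_gt0 ?mulr_gt0 ?exprn_gt0.
pose L := (cmod a + 1) * cmod a + 1.
have L0 : 0 < L by rewrite ltr_wpDl // mulr_ge0 ?cmod_ge0 // addr_ge0 ?cmod_ge0.
have e2 : 0 < e * m ^+ 3 / 4 / L by rewrite divr_gt0 // divr_gt0 // mulr_gt0 // exprn_gt0.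
have := cnearI (cnearI (hf _ e10) (cder_lip hf)) (cnearI (cder_cont hf (divr_gt0 m0 (ltr0Sn _ 1))) (cnear_ball z e2)).
apply: cnearS => w [[h1 h2] [h3 h4]].
have fw : m / 2 < cmod (f w).
  have := cmod_leB (f z) (f w); rewrite cmodC; move: h3; rewrite /m /=; lra.
have fw0 : f w != 0 by rewrite -cmod_gt0; apply: lt_trans fw; rewrite divr_gt0.
have -> : (f w)^-1 - (f z)^-1 - - a / f z ^+ 2 * (w - z) =
  - (f w - f z - a * (w - z)) / (f w * f z) + a * (w - z) * (f w - f z) / (f w * f z ^+ 2).
  by field; rewrite fz fw0.
apply: (le_trans (cmodD _ _)); rewrite !cmodf !cmodM cmodN -/m -?expr2.
set x := cmod (w - z) in h1 h2 h4 *; have x0 : 0 <= x := cmod_ge0 _.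
have q1 : 0 < cmod (f w) * m by rewrite mulr_gt0 // cmod_gt0.
have q2 : 0 < cmod (f w) * m ^+ 2 by rewrite mulr_gt0 ?cmod_gt0 ?exprn_gt0.
rewrite [e in leRHS]splitr mulrDl; apply: lerD.
  rewrite ler_pdivrMr //; apply: (le_trans h1).
  have -> : e1 * x = e / 2 * x * (m / 2 * m) by rewrite /e1; field.
  by rewrite ler_wpM2l ?mulr_ge0 ?divr_ge0 ?(ltW e0) // ler_wpM2r ?(ltW m0) ?(ltW fw).
rewrite ler_pdivrMr //.
apply: (@le_trans _ _ (e * m ^+ 3 / 4 * x)).
  have : cmod a * x * cmod (f w - f z) <= cmod a * x * ((cmod a + 1) * x).
    by rewrite ler_wpM2l ?mulr_ge0 ?cmod_ge0.
  move=> /le_trans; apply.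
  have -> : cmod a * x * ((cmod a + 1) * x) = ((cmod a + 1) * cmod a * x) * x by ring.
  rewrite ler_wpM2r //; move: h4; rewrite ltr_pdivlMr // /L => h4.
  by move: (h4); lra.
have -> : e * m ^+ 3 / 4 * x = e / 2 * x * (m / 2 * m ^+ 2) by field.
by rewrite ler_wpM2l ?mulr_ge0 ?divr_ge0 ?(ltW e0) // ler_wpM2r ?exprn_ge0 ?(ltW m0) ?(ltW fw).
Qed.

Lemma cder_comp f g z a b : cder f z a -> cder g (f z) b ->
  cder (fun w => g (f w)) z (b * a).
Proof.
move=> hf hg e e0.
pose K := cmod a + 1; have K0 : 0 < K by rewrite ltr_wpDl ?cmod_ge0.
pose L := cmod b + 1; have L0 : 0 < L by rewrite ltr_wpDl ?cmod_ge0.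
have e1 : 0 < e / 2 / K by rewrite divr_gt0 // divr_gt0.
have e2 : 0 < e / 2 / L by rewrite divr_gt0 // divr_gt0.
have [dl dl0 hd] := hg _ e1.
have := cnearI (cnearI (hf _ e2) (cder_lip hf)) (cder_cont hf dl0).
apply: cnearS => w [[h1 h2] h3]; have h4 := hd _ h3.
have -> : g (f w) - g (f z) - b * a * (w - z) =
  (g (f w) - g (f z) - b * (f w - f z)) + b * (f w - f z - a * (w - z)) by ring.
apply: (le_trans (cmodD _ _)); rewrite [e in leRHS]splitr mulrDl; apply: lerD.
  apply: (le_trans h4); apply: le_trans (ler_wpM2l (ltW e1) h2) _.
  by rewrite mulrA -/K divfK // gt_eqF.
rewrite cmodM; apply: (@le_trans _ _ (L * (e / 2 / L * cmod (w - z)))).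
  by rewrite ler_pM ?cmod_ge0 // /L lerDl.
suff -> : L * (e / 2 / L * cmod (w - z)) = e / 2 * cmod (w - z) by [].
by field; rewrite gt_eqF.
Qed.

Lemma ccont_comp f g z : ccont f z -> ccont g (f z) -> ccont (fun w => g (f w)) z.
Proof.
move=> cf cg e /cg [d d0 h]; apply: filterS (cf _ d0) => w; exact: h.
Qed.

Lemma ccontD f g z : ccont f z -> ccont g z -> ccont (fun w => f w + g w) z.
Proof.
move=> cf cg e e0; have e2 : 0 < e / 2 by rewrite divr_gt0.
apply: filterS2 (cf _ e2) (cg _ e2) => w h1 h2.
rewrite opprD addrACA; apply: (le_lt_trans (cmodD _ _)).
by rewrite [e]splitr ltrD.
Qed.

Lemma ccontN f z : ccont f z -> ccont (fun w => - f w) z.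
Proof. by move=> cf e e0; apply: filterS (cf _ e0) => w; rewrite -opprD cmodN. Qed.

Lemma ccontM f g z : ccont f z -> ccont g z -> ccont (fun w => f w * g w) z.
Proof.
move=> cf cg e e0.
pose K := cmod (f z) + cmod (g z) + 1.
have K0 : 0 < K by rewrite ltr_wpDl ?addr_ge0 ?cmod_ge0.
have e1 : 0 < Num.min 1 (e / K) by rewrite lt_min ltr01 divr_gt0.
apply: filterS2 (cf _ e1) (cg _ e1) => w; rewrite !lt_min => /andP[h1 h2] /andP[h3 h4].
have -> : f w * g w - f z * g z = (f w - f z) * (g w - g z) + (f w - f z) * g z + f z * (g w - g z) by ring.
apply: (le_lt_trans (cmodD _ _)); apply: (le_lt_trans (lerD (cmodD _ _) (lexx _))).
rewrite !cmodM; rewrite !ltr_pdivlMr // in h2 h4.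
have h5 : cmod (f w - f z) * cmod (g w - g z) <= cmod (f w - f z) * 1.
  by rewrite ler_wpM2l ?cmod_ge0 // ltW.
set x := cmod (f w - f z) in h1 h2 h5 *; set y := cmod (g w - g z) in h3 h4 h5 *.
have x0 : 0 <= x := cmod_ge0 _; have y0 : 0 <= y := cmod_ge0 _.
have [xy|/ltW xy] := lerP x y.
  have : x * cmod (g z) <= y * cmod (g z) by rewrite ler_wpM2r ?cmod_ge0.
  rewrite /K in h4; lra.
have : y * cmod (f z) <= x * cmod (f z) by rewrite ler_wpM2r ?cmod_ge0.
rewrite /K in h2; lra.
Qed.

Lemma ccont_cst (a : C) z : ccont (fun _ => a) z.
Proof. by move=> e e0; apply: cnearW => w; rewrite subrr cmod0. Qed.

Lemma ccont_id z : ccont id z.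
Proof. by move=> e e0; exact: cnear_ball. Qed.

Lemma ccontV f z : f z != 0 -> ccont f z -> ccont (fun w => (f w)^-1) z.
Proof.
move=> fz cf; apply: (@ccont_comp f (fun x => x^-1)) => //.
exact: (cder_cont (@cderV id (f z) 1 fz (cder_id _))).
Qed.

Lemma ccont_neq0 f z : ccont f z -> f z != 0 -> cnear z (fun w => f w != 0).
Proof.
move=> cf fz; have m0 : 0 < cmod (f z) by rewrite cmod_gt0.
apply: filterS (cf _ m0) => w; apply: contraTneq => ->.
by rewrite sub0r cmodN ltxx.
Qed.

(** The device against junk values: an identity known on a punctured neighbourhood passes to the
    centre as soon as both sides are continuous there. *)
Lemma ccont_lim_eq f g z : ccont f z -> ccont g z ->
  cnear z (fun w => w != z -> f w = g w) -> f z = g z.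
Proof.
move=> cf cg fg; apply/eqP; rewrite -subr_eq0 -cmod_eq0 eq_le cmod_ge0 andbT.
apply/ler_addgt0Pr => e e0; rewrite add0r.
have e2 : 0 < e / 2 by rewrite divr_gt0.
have [w wz [[h1 h2] h3]] : exists2 w, w != z & (cmod (f w - f z) < e / 2 /\ cmod (g w - g z) < e / 2) /\ f w = g w.
  apply: cnear_ex; apply: filterS2 (filterI (cf _ e2) (cg _ e2)) fg => w [h1 h2] h3 wz.
  by split; [split|exact: h3].
have -> : f z - g z = - (f w - f z) + (g w - g z) by rewrite h3; ring.
apply: (le_trans (cmodD _ _)); rewrite cmodN; lra.
Qed.

End Calculus.

(** * Agreement with the derivatives of the library *)

Section Bridge.
Context {R : realType}.
Notation C := R[i].
Implicit Types (f : C -> C) (z d : C).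

Lemma cder_is_derive f z d : cder f z d <->
  is_derive (z : R[i]^o) 1 (f : R[i]^o -> R[i]^o) d.
Proof.
have E : (fun h : R[i]^o => h^-1 *: ((f \o shift z) (h *: (1 : R[i]^o)) - f z)) @ 0^' --> (d : R[i]^o) <-> cder f z d.
  split.
    move=> h e e0; have /dnbhs_cnear [dl dl0 hd] := h _ ((nbhs_cnear d _).2 (cnear_ball d e0)).
    exists dl => // w wz; have [->|wz0] := eqVneq w z.
      by rewrite !subrr mulr0 subr0 cmod0 mulr0.
    have := hd (w - z); rewrite subr0 subr_eq0 => /(_ wz wz0) /= H.
    have wz1 : w - z != 0 by rewrite subr_eq0.
    rewrite -ler_pdivrMr ?cmod_gt0 // -cmodf; apply: ltW; move: H.
    rewrite /shift /= [(w - z) *: _]mulr1 subrK => H.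
    rewrite [X in cmod X](_ : _ = (w - z)^-1 * (f w - f z) - d) //; by field.
  move=> h A /nbhs_cnear [e e0 hA].
  have e20 : 0 < e / 2 by rewrite divr_gt0.
  apply/dnbhs_cnear; have [dl dl0 hd] := h _ e20.
  exists dl => // w; rewrite subr0 => wz w0; apply: hA.
  have := hd (w + z); rewrite addrK => /(_ wz).
  rewrite -ler_pdivrMr ?cmod_gt0 // -cmodf => H.
  have : cmod ((f (w + z) - f z - d * w) / w) < e by apply: le_lt_trans H _; lra.
  rewrite /shift /= [w *: _]mulr1 => H'.
  rewrite [X in cmod X](_ : _ = (f (w + z) - f z - d * w) / w) //.
  rewrite [_ *: _](_ : _ = w^-1 * (f (w + z) - f z)) //; by field.
split => [/E h|[df Dd]].
  by apply: DeriveDef; [apply/cvg_ex; exists d|apply: (cvg_lim (@norm_hausdorff _ _)); exact: h].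
by apply/E; rewrite -Dd; exact: df.
Qed.

Lemma cdif_derivable f z :
  cdif f z <-> derivable (f : R[i]^o -> R[i]^o) (z : R[i]^o) 1.
Proof.
split => [[d /cder_is_derive []] //|df].
by exists ('D_1 (f : R[i]^o -> R[i]^o) (z : R[i]^o)); apply/cder_is_derive; exact/derivableP.
Qed.

Lemma holo_holomorphic_at f z : holo f z <-> holomorphic_at f z.
Proof.
rewrite /holomorphic_at; split => h.
  by apply/nbhs_cnear; apply: filterS h => w; move/cdif_derivable.
by move/nbhs_cnear: h; apply: filterS => w; move/cdif_derivable.
Qed.

Lemma cder_derive1 f z d : cder f z d -> derive1 (f : R[i]^o -> R[i]^o) (z : R[i]^o) = d.
Proof. by move=> /cder_is_derive[_ <-]; rewrite derive1E. Qed.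

End Bridge.

(** * Cauchy's theorem and integral formula *)

Section Bisection.
Context {R : realType}.

Lemma nested_point (a b : nat -> R) :
  (forall n, a n <= a n.+1) -> (forall n, b n.+1 <= b n) ->
  (forall n, a n <= b n) -> exists x, forall n, a n <= x <= b n.
Proof.
move=> ha hb ab.
have ma m n : (m <= n)%N -> a m <= a n.
  elim: n => [|n ih]; first by rewrite leqn0 => /eqP ->.
  by rewrite leq_eqVlt => /orP[/eqP -> //|/ih h]; apply: le_trans h (ha n).
have mb m n : (m <= n)%N -> b n <= b m.
  elim: n => [|n ih]; first by rewrite leqn0 => /eqP ->.
  by rewrite leq_eqVlt => /orP[/eqP -> //|/ih h]; apply: le_trans (hb n) h.
have mab m n : a m <= b n.
  case/orP: (leq_total m n) => h; first exact: le_trans (ma _ _ h) (ab _).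
  exact: le_trans (ab _) (mb _ _ h).
exists (sup (range a)) => n; apply/andP; split.
  apply: ub_le_sup; last by exists n.
  by exists (b 0) => _ [m _ <-].
apply: ge_sup; first by exists (a 0), 0.
by move=> _ [m _ <-].
Qed.

Lemma half_pow_lt (x e : R) : 0 < e -> exists n, x / 2 ^+ n < e.
Proof.
move=> e0; have [x0|x0] := lerP x 0.
  by exists 0%N; rewrite expr0 divr1 (le_lt_trans x0).
exists (Num.bound (x / e)); rewrite ltr_pdivrMr ?exprn_gt0 // mulrC -ltr_pdivrMr //.
have := archi_boundP (ltW (divr_gt0 x0 e0)); move=> /lt_le_trans; apply.
by rewrite -natrX ler_nat ltnW // ltn_expl.
Qed.

Definition quarters (P : R -> R -> R -> R -> Prop) (a b c d : R) :=
  let m := (a + b) / 2 in let n := (c + d) / 2 in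
  [/\ P a m c n, P m b c n, P a m n d & P m b n d].

(** Otherwise repeated quartering gives nested rectangles violating [P]; they shrink to a point,
    where the local hypothesis applies. This form of compactness serves both Goursat's theorem and
    the finiteness of discrete sets in a rectangle. *)
Lemma rect_bisection (P : R -> R -> R -> R -> Prop) (a b c d : R) :
  a <= b -> c <= d ->
  (forall a' b' c' d', a <= a' -> a' <= b' -> b' <= b -> c <= c' -> c' <= d' ->
    d' <= d -> quarters P a' b' c' d' -> P a' b' c' d') ->
  (forall x y, a <= x <= b -> c <= y <= d ->
    exists2 dl : R, 0 < dl & forall a' b' c' d',
      [/\ a <= a', a' <= x, x <= b' & b' <= b] ->
      [/\ c <= c', c' <= y, y <= d' & d' <= d] ->
      b' - a' < dl -> d' - c' < dl -> P a' b' c' d') ->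
  P a b c d.
Proof.
move=> ab cd hq hl; apply: contrapT => nP.
pose T := (R * R * R * R)%type.
pose PT (Q : T) := P Q.1.1.1 Q.1.1.2 Q.1.2 Q.2.
pose quart (Q : T) (i j : bool) : T :=
  let: (a, b, c, d) := Q in let m := (a + b) / 2 in let n := (c + d) / 2 in
  ((if i then m else a), (if i then b else m), (if j then n else c), (if j then d else n)).
pose inv (Q : T) := [/\ a <= Q.1.1.1, Q.1.1.1 <= Q.1.1.2, Q.1.1.2 <= b & [/\ c <= Q.1.2, Q.1.2 <= Q.2, Q.2 <= d & ~ PT Q]].
(* Stated for every [Q], the invariant being a premise, so that a choice function on all quadruples
   can be iterated. *)
have stepP (Q : T) : exists Q', inv Q -> inv Q' /\ exists i j, Q' = quart Q i j.
  have [iQ|niQ] := pselect (inv Q); last by exists Q.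
  case: Q iQ => [[[a' b'] c'] d'] [/= h1 h2 h3 [h4 h5 h6 h7]].
  have hm1 : a' <= (a' + b') / 2 by lra.
  have hm2 : (a' + b') / 2 <= b' by lra.
  have hn1 : c' <= (c' + d') / 2 by lra.
  have hn2 : (c' + d') / 2 <= d' by lra.
  have [p1|p1] := pselect (P a' ((a' + b') / 2) c' ((c' + d') / 2)); last first.
    exists (quart (a', b', c', d') false false) => _; split; last by exists false, false.
    by do !split => //=; lra.
  have [p2|p2] := pselect (P ((a' + b') / 2) b' c' ((c' + d') / 2)); last first.
    exists (quart (a', b', c', d') true false) => _; split; last by exists true, false.
    by do !split => //=; lra.
  have [p3|p3] := pselect (P a' ((a' + b') / 2) ((c' + d') / 2) d'); last first.
    exists (quart (a', b', c', d') false true) => _; split; last by exists false, true.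
    by do !split => //=; lra.
  exists (quart (a', b', c', d') true true) => _; split; last by exists true, true.
  do !split => //=; try lra; move=> p4; apply: h7; exact: hq.
pose step Q := projT1 (cid (stepP Q)).
have stepE Q : inv Q -> inv (step Q) /\ exists i j, step Q = quart Q i j.
  exact: (projT2 (cid (stepP Q))).
pose S n := iter n step (a, b, c, d).
have iS n : inv (S n).
  by elim: n => [|n /stepE[] //]; do !split => //=.
have qS n : exists i j, S n.+1 = quart (S n) i j by have [] := stepE _ (iS n).
have [x hx] : exists x, forall n, (S n).1.1.1 <= x <= (S n).1.1.2.
  apply: nested_point => n; last by case: (iS n).
    have [i [j ->]] := qS n; case: (iS n); case: (S n) => [[[a' b'] c'] d'] /= _ h _ _.
    by case: i; lra.
  have [i [j ->]] := qS n; case: (iS n); case: (S n) => [[[a' b'] c'] d'] /= _ h _ _.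
  by case: i; lra.
have [y hy] : exists y, forall n, (S n).1.2 <= y <= (S n).2.
  apply: nested_point => n; last by case: (iS n) => _ _ _ [].
    have [i [j ->]] := qS n; case: (iS n); case: (S n) => [[[a' b'] c'] d'] /= _ _ _ [_ h _ _].
    by case: j; lra.
  have [i [j ->]] := qS n; case: (iS n); case: (S n) => [[[a' b'] c'] d'] /= _ _ _ [_ h _ _].
  by case: j; lra.
have sz n : (S n).1.1.2 - (S n).1.1.1 = (b - a) / 2 ^+ n /\ (S n).2 - (S n).1.2 = (d - c) / 2 ^+ n.
  elim: n => [|n [ih1 ih2]]; first by rewrite /= expr0 !divr1.
  have [i [j ->]] := qS n; rewrite exprS invfM mulrCA [X in _ = X /\ _]mulrC.
  rewrite [(d - c) * _]mulrCA [X in _ /\ _ = X]mulrC -ih2 -mulrC -ih1.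
  case: (S n) => [[[a' b'] c'] d'] /=.
  by split; [case: i; lra|case: j; lra].
have [dl dl0 h] := hl x y (hx 0%N) (hy 0%N).
have [n1 hn1] := half_pow_lt (Num.max (b - a) (d - c)) dl0.
case: (iS n1) => h1 h2 h3 [h4 h5 h6]; apply; apply: h.
- by case/andP: (hx n1).
- by case/andP: (hy n1).
- rewrite (sz n1).1; apply: le_lt_trans hn1; rewrite ler_pM2r ?invr_gt0 ?exprn_gt0 //.
  by rewrite le_max lexx.
- rewrite (sz n1).2; apply: le_lt_trans hn1; rewrite ler_pM2r ?invr_gt0 ?exprn_gt0 //.
  by rewrite le_max lexx orbT.
Qed.

(** The case of a rectangle of height 0. It yields uniform continuity and the propagation of
    identities along a segment. *)
Lemma itv_bisection (P : R -> R -> Prop) (a b : R) : a <= b ->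
  (forall x y z, a <= x -> x <= y -> y <= z -> z <= b -> P x y -> P y z -> P x z) ->
  (forall x, a <= x <= b ->
    exists2 dl : R, 0 < dl & forall x1 x2,
      [/\ a <= x1, x1 <= x, x <= x2 & x2 <= b] -> x2 - x1 < dl -> P x1 x2) ->
  P a b.
Proof.
move=> ab hj hl.
apply: (@rect_bisection (fun a b _ _ => P a b) a b 0 0) => //.
  move=> a' b' c' d' h1 h2 h3 _ _ _ [p1 p2 _ _].
  by apply: (hj _ ((a' + b') / 2)) => //; lra.
move=> x y hx _; have [dl dl0 h] := hl x hx.
by exists dl => // a' b' c' d' h1 _ h2 _; apply: h.
Qed.

End Bisection.

(** * Integrals of continuous real functions *)

Section Integrals.
Context {R : realType}.
Notation C := R[i].
Notation mu := (@lebesgue_measure R).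
Implicit Types (phi psi : R -> R) (g h : R -> C).

Definition rint (a b : R) phi : R := \int[mu]_(t in `[a, b]) phi t.

(** Continuity is two-sided at the endpoints too: the integrands are defined beyond the interval,
    and no relative topology is needed when it is cut or shrunk. *)
Definition rcts (a b : R) phi := forall t, a <= t <= b -> {for t, continuous phi}.

Lemma rcts_within a b phi : rcts a b phi -> {within `[a, b], continuous phi}.
Proof.
move=> h; apply: continuous_in_subspaceT => x.
by rewrite inE /= in_itv /=; exact: h.
Qed.

Lemma rcts_integrable a b phi : rcts a b phi -> mu.-integrable `[a, b] (EFin \o phi).
Proof.
move=> /rcts_within h; apply: continuous_compact_integrable => //.
exact: segment_compact.
Qed.

Lemma rint_ext a b phi psi : (forall t, a <= t <= b -> phi t = psi t) ->
  rint a b phi = rint a b psi.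
Proof. by move=> h; apply: eq_Rintegral => t; rewrite inE /= in_itv /=; exact: h. Qed.

Lemma rintD a b phi psi : rcts a b phi -> rcts a b psi ->
  rint a b (fun t => phi t + psi t) = rint a b phi + rint a b psi.
Proof. by move=> h1 h2; rewrite /rint RintegralD //; exact: rcts_integrable. Qed.

Lemma rintZ a b (k : R) phi : rcts a b phi ->
  rint a b (fun t => k * phi t) = k * rint a b phi.
Proof. by move=> h1; rewrite /rint RintegralZl //; exact: rcts_integrable. Qed.

Lemma rint_le a b phi psi : rcts a b phi -> rcts a b psi ->
  (forall t, a <= t <= b -> phi t <= psi t) -> rint a b phi <= rint a b psi.
Proof.
move=> h1 h2 h; apply: (le_Rintegral _ (rcts_integrable h1) (rcts_integrable h2)) => //.
Qed.

Lemma rint_cst a b (k : R) : a <= b -> rint a b (fun _ => k) = k * (b - a).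
Proof.
move=> ab; rewrite /rint Rintegral_cst //; congr (_ * _).
suff H : mu `[a, b] = (b - a)%:E by exact: (congr1 fine H).
rewrite lebesgue_measure_itv /= lte_fin; case: ltP => ba; first by rewrite EFinB.
by rewrite (_ : a = b) ?subrr //; apply/eqP; rewrite eq_le ab.
Qed.

Lemma rcts_cst a b (k : R) : rcts a b (fun _ => k).
Proof. by move=> t _; exact: cvg_cst. Qed.

Lemma rctsD a b phi psi : rcts a b phi -> rcts a b psi -> rcts a b (fun t => phi t + psi t).
Proof. by move=> h1 h2 t ht; apply: cvgD; [exact: h1|exact: h2]. Qed.

Lemma rctsM a b phi psi : rcts a b phi -> rcts a b psi -> rcts a b (fun t => phi t * psi t).
Proof. by move=> h1 h2 t ht; apply: cvgM; [exact: h1|exact: h2]. Qed.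

Lemma rcts_norm a b phi : rcts a b phi -> rcts a b (fun t => `|phi t|).
Proof. by move=> h1 t ht; apply: cvg_norm; exact: h1. Qed.

Lemma rint_norm a b phi : rcts a b phi -> `|rint a b phi| <= rint a b (fun t => `|phi t|).
Proof. by move=> h; apply: le_normr_Rintegral => //; exact: rcts_integrable. Qed.

Lemma rint_ge0 a b phi : (forall t, a <= t <= b -> 0 <= phi t) -> 0 <= rint a b phi.
Proof. by move=> h; apply: Rintegral_ge0 => t; rewrite /= in_itv /=; exact: h. Qed.

Lemma rint_cat a b c phi : a <= c -> c <= b -> rcts a b phi ->
  rint a b phi = rint a c phi + rint c b phi.
Proof.
move=> ac cb h; have ih := rcts_integrable h.
have := @Rintegral_itvB R phi (BLeft a) (BRight b) c ih; rewrite !bnd_simp => /(_ ac cb) /eqP.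
rewrite subr_eq addrC => /eqP; rewrite /rint => ->; congr (_ + _).
apply: Rintegral_itv_obnd_cbnd; apply: integrableS ih => //.
by apply: subset_itvr; rewrite bnd_simp.
Qed.

Lemma rint_ftc a b phi (Phi : R -> R) : a <= b -> rcts a b phi ->
  (forall t, a <= t <= b -> is_derive t 1 Phi (phi t)) ->
  rint a b phi = Phi b - Phi a.
Proof.
rewrite le_eqVlt => /orP[/eqP <- _ _|ab h hd].
  by rewrite subrr /rint set_itv1 Rintegral_set1.
have cP t : a <= t <= b -> {for t, continuous Phi}.
  move=> ht; apply: differentiable_continuous; apply/derivable1_diffP.
  exact: (@ex_derive _ _ _ _ _ _ _ (hd t ht)).
rewrite /rint /Rintegral (@continuous_FTC2 _ phi Phi) ?EFinB //.
- exact: rcts_within.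
- split.
  + move=> x; rewrite in_itv /= => /andP[h1 h2].
    by apply: (@ex_derive _ _ _ _ _ _ _ (hd x _)); rewrite !ltW.
  + by apply: cvg_at_right_filter; apply: cP; rewrite lexx ltW.
  + by apply: cvg_at_left_filter; apply: cP; rewrite lexx ltW.
- move=> x; rewrite in_itv /= => /andP[h1 h2]; rewrite derive1E.
  by apply: (@derive_val _ _ _ _ _ _ _ (hd x _)); rewrite !ltW.
Qed.

Lemma rintE a b phi : rint a b phi = \int[mu]_(t in `[a, b]) phi t.
Proof. by []. Qed.

End Integrals.

(** * Integrals of complex functions of a real variable *)

Section ComplexIntegrals.
Context {R : realType}.
Notation C := R[i].
Implicit Types (g h : R -> C).

Definition pcont g (t : R) := forall e : R, 0 < e ->
  \forall s \near t, cmod (g s - g t) < e.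

Definition ccts (a b : R) g := forall t, a <= t <= b -> pcont g t.

Definition cint (a b : R) g : C :=
  Complex (rint a b (fun t => cRe (g t))) (rint a b (fun t => cIm (g t))).

Lemma cRe_cvg g t : pcont g t -> {for t, continuous (fun t => cRe (g t))}.
Proof.
move=> h; apply/cvgrPdist_lt => e e0; apply: filterS (h e e0) => s hs.
rewrite -opprB normrN; apply: le_lt_trans hs.
by rewrite -cReN -cReD cRe_le.
Qed.

Lemma cIm_cvg g t : pcont g t -> {for t, continuous (fun t => cIm (g t))}.
Proof.
move=> h; apply/cvgrPdist_lt => e e0; apply: filterS (h e e0) => s hs.
rewrite -opprB normrN; apply: le_lt_trans hs.
by rewrite -cImN -cImD cIm_le.
Qed.

Lemma cmod_cvg g t : pcont g t -> {for t, continuous (fun t => cmod (g t))}.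
Proof.
move=> h; apply/cvgrPdist_lt => e e0; apply: filterS (h e e0) => s hs.
apply: le_lt_trans hs; rewrite ler_norml; apply/andP; split.
  by rewrite lerNl opprB cmod_leB.
by rewrite cmodC cmod_leB.
Qed.

Lemma ReIm_pcont g t : {for t, continuous (fun t => cRe (g t))} ->
  {for t, continuous (fun t => cIm (g t))} -> pcont g t.
Proof.
move=> /cvgrPdist_lt h1 /cvgrPdist_lt h2 e e0; have e2 : 0 < e / 2 by rewrite divr_gt0.
near=> s; apply: (le_lt_trans (cmod_le_ReIm _)); rewrite !(cReD, cImD, cReN, cImN).
rewrite [e]splitr ltrD // -opprB normrN; near: s; [exact: h1|exact: h2].
Unshelve. all: end_near. Qed.

Lemma ccts_Re a b g : ccts a b g -> rcts a b (fun t => cRe (g t)).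
Proof. by move=> h t /h /cRe_cvg. Qed.
Lemma ccts_Im a b g : ccts a b g -> rcts a b (fun t => cIm (g t)).
Proof. by move=> h t /h /cIm_cvg. Qed.
Lemma ccts_cmod a b g : ccts a b g -> rcts a b (fun t => cmod (g t)).
Proof. by move=> h t /h /cmod_cvg. Qed.

Lemma pcont_cst (k : C) t : pcont (fun _ => k) t.
Proof.
move=> e e0; near=> s; by rewrite subrr cmod0.
Unshelve. all: end_near. Qed.

Lemma pcontD g h t : pcont g t -> pcont h t -> pcont (fun t => g t + h t) t.
Proof.
move=> c1 c2; apply: ReIm_pcont.
  rewrite (_ : (fun t => _) = (fun t => cRe (g t) + cRe (h t))).
    2: by apply/funext => s; rewrite cReD.
  by apply: cvgD; apply: cRe_cvg.
rewrite (_ : (fun t => _) = (fun t => cIm (g t) + cIm (h t))).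
  2: by apply/funext => s; rewrite cImD.
by apply: cvgD; apply: cIm_cvg.
Qed.

Lemma pcontM g h t : pcont g t -> pcont h t -> pcont (fun t => g t * h t) t.
Proof.
move=> c1 c2; apply: ReIm_pcont.
  rewrite (_ : (fun t => _) = (fun t => cRe (g t) * cRe (h t) - cIm (g t) * cIm (h t))).
    2: by apply/funext => s; rewrite cReM.
  by apply: cvgB; apply: cvgM; try (by apply: cRe_cvg); apply: cIm_cvg.
rewrite (_ : (fun t => _) = (fun t => cRe (g t) * cIm (h t) + cIm (g t) * cRe (h t))).
  2: by apply/funext => s; rewrite cImM.
by apply: cvgD; apply: cvgM; try (by apply: cRe_cvg); apply: cIm_cvg.
Qed.

Lemma pcont_comp (F : C -> C) g t : pcont g t -> ccont F (g t) -> pcont (fun t => F (g t)) t.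
Proof. by move=> c1 c2 e /c2 [d d0 h]; apply: filterS (c1 d d0) => s; exact: h. Qed.

Lemma pcont_real (phi : R -> R) t : {for t, continuous phi} -> pcont (fun t => (phi t)%:C%C) t.
Proof.
move=> /cvgrPdist_lt h e /h; apply: filterS => s hs.
by rewrite -rmorphB cmod_real -opprB normrN.
Qed.

Lemma cctsD a b g h : ccts a b g -> ccts a b h -> ccts a b (fun t => g t + h t).
Proof. by move=> h1 h2 t ht; apply: pcontD; [exact: h1|exact: h2]. Qed.
Lemma cctsM a b g h : ccts a b g -> ccts a b h -> ccts a b (fun t => g t * h t).
Proof. by move=> h1 h2 t ht; apply: pcontM; [exact: h1|exact: h2]. Qed.
Lemma ccts_cst a b (k : C) : ccts a b (fun _ => k).
Proof. by move=> t _; exact: pcont_cst. Qed.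
Lemma cctsZ a b (k : C) g : ccts a b g -> ccts a b (fun t => k * g t).
Proof. by apply: cctsM; exact: ccts_cst. Qed.
Lemma cctsN a b g : ccts a b g -> ccts a b (fun t => - g t).
Proof. by move=> h t ht e e0; apply: filterS (h t ht e e0) => s; rewrite -opprD cmodN. Qed.

Lemma cint_ext a b g h : (forall t, a <= t <= b -> g t = h t) -> cint a b g = cint a b h.
Proof. by move=> e; congr Complex; apply: rint_ext => t /e ->. Qed.

Lemma cintD a b g h : ccts a b g -> ccts a b h ->
  cint a b (fun t => g t + h t) = cint a b g + cint a b h.
Proof.
move=> h1 h2; rewrite /cint [RHS]/=.
under [in LHS]rint_ext do rewrite cReD.
under [X in Complex _ X]rint_ext do rewrite cImD.
by rewrite !rintD //; try exact: ccts_Re; exact: ccts_Im.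
Qed.

Lemma cintZ a b (k : C) g : ccts a b g -> cint a b (fun t => k * g t) = k * cint a b g.
Proof.
move=> h; have hR := ccts_Re h; have hI := ccts_Im h.
apply: ceq; rewrite /= ?cReM ?cImM /=.
  under rint_ext do rewrite cReM -mulNr.
  by rewrite rintD ?rintZ ?mulNr //; apply: rctsM => //; exact: rcts_cst.
under rint_ext do rewrite cImM.
by rewrite rintD ?rintZ //; apply: rctsM => //; exact: rcts_cst.
Qed.

Lemma cintN a b g : ccts a b g -> cint a b (fun t => - g t) = - cint a b g.
Proof.
move=> h; rewrite -mulN1r -cintZ //; apply: cint_ext => t _; by rewrite mulN1r.
Qed.

Lemma cintB a b g h : ccts a b g -> ccts a b h ->
  cint a b (fun t => g t - h t) = cint a b g - cint a b h.
Proof. by move=> h1 h2; rewrite cintD ?cintN //; exact: cctsN. Qed.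

Lemma cint_cst a b (k : C) : a <= b -> cint a b (fun _ => k) = k * (b - a)%:C%C.
Proof. by move=> ab; apply: ceq; rewrite /= ?cReM ?cImM /= rint_cst //; ring. Qed.

Lemma cint_cat a b c g : a <= c -> c <= b -> ccts a b g ->
  cint a b g = cint a c g + cint c b g.
Proof.
move=> ac cb h; apply: ceq; rewrite ?(cReD, cImD) /= -rint_cat //; [exact: ccts_Re|exact: ccts_Im].
Qed.

(** Real and imaginary parts are estimated separately, whence the factor 2. Where a sharp constant
    matters, in [max_principle], it is recovered by taking powers. *)
Lemma cint_cmod a b g : ccts a b g -> cmod (cint a b g) <= 2 * rint a b (fun t => cmod (g t)).
Proof.
move=> h; apply: (le_trans (cmod_le_ReIm _)); rewrite /= mulrDl mul1r.
have hR := ccts_Re h; have hI := ccts_Im h; have hc := ccts_cmod h.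
by apply: lerD; (apply: le_trans (rint_norm _) _ => //;
  apply: rint_le => // [|t _]; [exact: rcts_norm|exact: cRe_le || exact: cIm_le]).
Qed.

Lemma cint_le a b (M : R) g : a <= b -> ccts a b g ->
  (forall t, a <= t <= b -> cmod (g t) <= M) -> cmod (cint a b g) <= 2 * (M * (b - a)).
Proof.
move=> ab h hM; apply: (le_trans (cint_cmod h)); rewrite ler_pM2l // -rint_cst //.
by apply: rint_le => //; [exact: ccts_cmod|exact: rcts_cst].
Qed.

Lemma cint_ftc a b g (G : R -> C) : a <= b -> ccts a b g ->
  (forall t, a <= t <= b -> is_derive t 1 (fun t => cRe (G t)) (cRe (g t))) ->
  (forall t, a <= t <= b -> is_derive t 1 (fun t => cIm (G t)) (cIm (g t))) ->
  cint a b g = G b - G a.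
Proof.
move=> ab h h1 h2; apply: ceq; rewrite ?(cReD, cImD, cReN, cImN) /=.
  by apply: (@rint_ftc _ _ _ _ (fun t => cRe (G t))) => //; exact: ccts_Re.
by apply: (@rint_ftc _ _ _ _ (fun t => cIm (G t))) => //; exact: ccts_Im.
Qed.

Lemma cintE a b g :
  cint a b g = Complex (rint a b (fun t => cRe (g t))) (rint a b (fun t => cIm (g t))).
Proof. by []. Qed.

End ComplexIntegrals.

Global Opaque rint cint.

Section RealEps.
Context {R : realType}.
Implicit Types (phi : R -> R).

Lemma near_dist (t : R) (P : R -> Prop) :
  (\forall s \near t, P s) <-> exists2 d : R, 0 < d & forall s, `|s - t| < d -> P s.
Proof.
split => [/nbhs_ballP[d /= d0 h]|[d d0 h]].
  by exists d => // s hs; apply: h; rewrite /ball /= distrC.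
by apply/nbhs_ballP; exists d => // s; rewrite /ball /= distrC => /h.
Qed.

Lemma is_derive_eps phi (t d : R) : is_derive t 1 phi d <->
  forall e, 0 < e -> \forall s \near t, `|phi s - phi t - d * (s - t)| <= e * `|s - t|.
Proof.
have E : (fun h => h^-1 *: ((phi \o shift t) (h *: 1) - phi t)) @ 0^' --> d <->
  forall e, 0 < e -> \forall s \near t, `|phi s - phi t - d * (s - t)| <= e * `|s - t|.
  split.
    move=> /cvgrPdist_le h e e0; have /nbhs_ballP [dl /= dl0 hd] := h e e0.
    apply/near_dist; exists dl => // s hs; have [->|st] := eqVneq s t.
      by rewrite !subrr mulr0 subr0 normr0 mulr0.
    have st0 : s - t != 0 by rewrite subr_eq0.
    have := hd (s - t); rewrite /ball /= sub0r normrN => /(_ hs st0).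
    rewrite [_ *: 1]mulr1 subrK distrC => H.
    rewrite -ler_pdivrMr ?normr_gt0 // -normf_div.
    rewrite [X in `|X|](_ : _ = (s - t)^-1 * (phi s - phi t) - d) //; by field.
  move=> h; apply/cvgrPdist_le => e e0; have /near_dist [dl dl0 hd] := h e e0.
  apply/nbhs_ballP; exists dl => //= s; rewrite /ball /= sub0r normrN => hs s0.
  have := hd (s + t); rewrite addrK => /(_ hs).
  rewrite -ler_pdivrMr ?normr_gt0 // -normf_div /= [_ *: 1]mulr1 /shift /= distrC => H.
  rewrite [X in `|X|](_ : _ = (phi (s + t) - phi t - d * s) / s) //.
  rewrite [_ *: _](_ : _ = s^-1 * (phi (s + t) - phi t)) //; by field.
split => [[df Dd]|/E h].
  by apply/E; rewrite -Dd; exact: df.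
apply: DeriveDef; first by apply/cvg_ex; exists d.
by apply: (cvg_lim (@norm_hausdorff _ _)); exact: h.
Qed.

End RealEps.

(** * Goursat's theorem for rectangles *)

Section Goursat.
Context {R : realType}.
Notation C := R[i].
Implicit Types (F G : C -> C).

Lemma pcont_hor (c x : R) : pcont (fun x : R => x +i* c)%C x.
Proof. by apply: ReIm_pcont => /=; [exact: cvg_id|exact: cvg_cst]. Qed.

Lemma pcont_ver (a y : R) : pcont (fun y : R => a +i* y)%C y.
Proof. by apply: ReIm_pcont => /=; [exact: cvg_cst|exact: cvg_id]. Qed.

(** The integral of F(z) dz along the boundary, counterclockwise: bottom minus top, plus i times
    right minus left. *)
Definition rectint F (a b c d : R) : C :=
  cint a b (fun x => F (x +i* c)%C) - cint a b (fun x => F (x +i* d)%C) +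
  'i%C * (cint c d (fun y => F (b +i* y)%C) - cint c d (fun y => F (a +i* y)%C)).

Definition rectcts F (a b c d : R) :=
  forall x y, a <= x <= b -> c <= y <= d -> ccont F (x +i* y)%C.

Lemma rectcts_hor F a b c d y : rectcts F a b c d -> c <= y <= d ->
  ccts a b (fun x => F (x +i* y)%C).
Proof. by move=> h hy x hx; apply: pcont_comp; [exact: pcont_hor|exact: h]. Qed.

Lemma rectcts_ver F a b c d x : rectcts F a b c d -> a <= x <= b ->
  ccts c d (fun y => F (x +i* y)%C).
Proof. by move=> h hx y hy; apply: pcont_comp; [exact: pcont_ver|exact: h]. Qed.

Lemma rectcts_sub F a b c d a' b' c' d' : a <= a' -> b' <= b -> c <= c' -> d' <= d ->
  rectcts F a b c d -> rectcts F a' b' c' d'.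
Proof.
move=> h1 h2 h3 h4 h x y /andP[? ?] /andP[? ?]; apply: h; apply/andP; split; lra.
Qed.

Lemma rectint_quarter F a b c d m n : a <= m <= b -> c <= n <= d -> rectcts F a b c d ->
  rectint F a b c d = rectint F a m c n + rectint F m b c n + rectint F a m n d + rectint F m b n d.
Proof.
move=> /andP[am mb] /andP[cn nd] h; rewrite /rectint.
have ab := le_trans am mb; have cd := le_trans cn nd.
have hh y : c <= y <= d -> cint a b (fun x => F (x +i* y)%C) = cint a m (fun x => F (x +i* y)%C) + cint m b (fun x => F (x +i* y)%C).
  by move=> hy; apply: cint_cat => //; exact: rectcts_hor h _.
have hv x : a <= x <= b -> cint c d (fun y => F (x +i* y)%C) = cint c n (fun y => F (x +i* y)%C) + cint n d (fun y => F (x +i* y)%C).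
  by move=> hy; apply: cint_cat => //; exact: rectcts_ver h _.
rewrite !hh ?hv ?lexx ?ab ?cd //; ring.
Qed.

Lemma rectintD F G a b c d : a <= b -> c <= d -> rectcts F a b c d -> rectcts G a b c d ->
  rectint (fun z => F z + G z) a b c d = rectint F a b c d + rectint G a b c d.
Proof.
move=> ab cd h1 h2; rewrite /rectint.
have e1 y : c <= y <= d -> cint a b (fun x => F (x +i* y)%C + G (x +i* y)%C) =
  cint a b (fun x => F (x +i* y)%C) + cint a b (fun x => G (x +i* y)%C).
  by move=> hy; apply: cintD; [exact: rectcts_hor h1 _|exact: rectcts_hor h2 _].
have e2 x : a <= x <= b -> cint c d (fun y => F (x +i* y)%C + G (x +i* y)%C) =
  cint c d (fun y => F (x +i* y)%C) + cint c d (fun y => G (x +i* y)%C).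
  by move=> hy; apply: cintD; [exact: rectcts_ver h1 _|exact: rectcts_ver h2 _].
rewrite !e1 ?e2 ?lexx ?ab ?cd //; ring.
Qed.

Lemma cint_real_id (a b : R) : a <= b -> cint a b (fun x => x%:C%C) = ((b ^+ 2 - a ^+ 2) / 2)%:C%C.
Proof.
move=> ab; rewrite cintE; apply: ceq => /=; last by rewrite rint_cst // mul0r.
suff : rint a b id = b ^+ 2 / 2 - a ^+ 2 / 2 by move=> ->; ring.
apply: (@rint_ftc R a b id (fun x : R => x ^+ 2 / 2)) => //.
  by move=> t _; exact: cvg_id.
move=> t _; apply/is_derive_eps => e e0; apply/near_dist; exists e => // s hs.
have -> : s ^+ 2 / 2 - t ^+ 2 / 2 - t * (s - t) = (s - t) * (s - t) / 2 by field.
rewrite normf_div normrM [X in _ / X]gtr0_norm //.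
have : `|s - t| * `|s - t| <= e * `|s - t| by rewrite ler_wpM2r // ltW.
have : 0 <= `|s - t| * `|s - t| by rewrite mulr_ge0.
lra.
Qed.

Lemma rectint_affine (al be : C) a b c d : a <= b -> c <= d ->
  rectint (fun z => al + be * z) a b c d = 0.
Proof.
move=> ab cd; rewrite /rectint.
have hid x y : a <= x -> ccts x y (fun x : R => x%:C%C).
  by move=> _ t _; apply: pcont_real; exact: cvg_id.
have hx (y : R) : cint a b (fun x => al + be * (x +i* y)%C) =
  (al + be * (0 +i* y)%C) * (b - a)%:C%C + be * ((b ^+ 2 - a ^+ 2) / 2)%:C%C.
  rewrite -cint_real_id // -cint_cst // -cintZ; last by move=> t _; apply: pcont_real; exact: cvg_id.
  rewrite -cintD; last 2 first.
  - exact: ccts_cst.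
  - by apply: cctsZ => t _; apply: pcont_real; exact: cvg_id.
  apply: cint_ext => t _; rewrite -addrA -mulrDr; congr (_ + _ * _).
  by apply: ceq => /=; ring.
have hy (x : R) : cint c d (fun y => al + be * (x +i* y)%C) =
  (al + be * x%:C%C) * (d - c)%:C%C + be * 'i%C * ((d ^+ 2 - c ^+ 2) / 2)%:C%C.
  rewrite -cint_real_id // -cint_cst // -cintZ; last by move=> t _; apply: pcont_real; exact: cvg_id.
  rewrite -cintD; last 2 first.
  - exact: ccts_cst.
  - by apply: cctsZ => t _; apply: pcont_real; exact: cvg_id.
  apply: cint_ext => t _; rewrite -addrA -mulrA -mulrDr; congr (_ + _ * _).
  by apply: ceq => /=; ring.
rewrite !hx !hy; apply: ceq; rewrite ?(cReD, cImD, cReN, cImN, cReM, cImM) /=; by field.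
Qed.

Lemma rectint_le F (M : R) a b c d : a <= b -> c <= d -> rectcts F a b c d ->
  (forall x y, a <= x <= b -> c <= y <= d -> cmod (F (x +i* y)%C) <= M) ->
  cmod (rectint F a b c d) <= 4 * M * ((b - a) + (d - c)).
Proof.
move=> ab cd h hM; rewrite /rectint.
have h1 y : c <= y <= d -> cmod (cint a b (fun x => F (x +i* y)%C)) <= 2 * (M * (b - a)).
  by move=> hy; apply: cint_le => // [|t ht]; [exact: rectcts_hor h _|exact: hM].
have h2 x : a <= x <= b -> cmod (cint c d (fun y => F (x +i* y)%C)) <= 2 * (M * (d - c)).
  by move=> hx; apply: cint_le => // [|t ht]; [exact: rectcts_ver h _|exact: hM].
apply: (le_trans (cmodD _ _)); rewrite cmodM cmod_i mul1r.
apply: (le_trans (lerD (cmodB_le _ _) (cmodB_le _ _))).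
have := h1 c; have := h1 d; have := h2 a; have := h2 b.
rewrite !lexx ab cd => /(_ isT) ? /(_ isT) ? /(_ isT) ? /(_ isT) ?; lra.
Qed.

Lemma midf_bounds (a b : R) : a <= b -> a <= (a + b) / 2 <= b.
Proof. by move=> ab; apply/andP; split; lra. Qed.

(** For each [e] the integral is at most 4 e times the square of width plus height. Four quarters
    each carry a quarter of this bound, so it passes to the union. On a small rectangle the affine
    part of [F] integrates to 0 by direct computation, and the remainder is bounded by
    differentiability at one point. *)
Lemma goursat F a b c d : a <= b -> c <= d ->
  (forall x y, a <= x <= b -> c <= y <= d -> cdif F (x +i* y)%C) ->
  rectint F a b c d = 0.
Proof.
move=> ab cd hF.
have cF : rectcts F a b c d by move=> x y hx hy; apply: cdif_cont; exact: hF.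
pose L := (b - a) + (d - c).
have key (e : R) : 0 < e -> cmod (rectint F a b c d) <= e * (4 * L ^+ 2).
  move=> e0; pose P a b c d := cmod (rectint F a b c d) <= e * (4 * ((b - a) + (d - c)) ^+ 2).
  apply: (@rect_bisection _ P) => //.
    move=> a' b' c' d' h1 h2 h3 h4 h5 h6 []; rewrite /P => p1 p2 p3 p4.
    rewrite (@rectint_quarter _ _ _ _ _ ((a' + b') / 2) ((c' + d') / 2)); last 3 first.
    - exact: midf_bounds.
    - exact: midf_bounds.
    - exact: rectcts_sub cF.
    apply: (le_trans (cmodD _ _)); rewrite -lerBrDr.
    apply: (le_trans (cmodD _ _)); rewrite -lerBrDr.
    apply: (le_trans (cmodD _ _)); rewrite -lerBrDr.
    move: p1 p2 p3 p4; set u1 := cmod _; set u2 := cmod _; set u3 := cmod _; set u4 := cmod _.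
    set X := (b' - a') + (d' - c').
    rewrite (_ : (a' + b') / 2 - a' + ((c' + d') / 2 - c') = X / 2); last by rewrite /X; field.
    rewrite (_ : b' - (a' + b') / 2 + ((c' + d') / 2 - c') = X / 2); last by rewrite /X; field.
    rewrite (_ : (a' + b') / 2 - a' + (d' - (c' + d') / 2) = X / 2); last by rewrite /X; field.
    rewrite (_ : b' - (a' + b') / 2 + (d' - (c' + d') / 2) = X / 2); last by rewrite /X; field.
    rewrite (_ : (X / 2) ^+ 2 = X ^+ 2 / 4); last by field.
    clear; set Y := X ^+ 2 => q1 q2 q3 q4.
    by move: Y q1 q2 q3 q4; clear => Y q1 q2 q3 q4; lra.
  move=> x y hx hy; have [D hD] := hF x y hx hy; have [dl dl0 hd] := hD e e0.
  (* With both sides shorter than [dl / 2], the whole rectangle lies within [dl] of the point [p] it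
     contains. *)
  exists (dl / 2); first by rewrite divr_gt0.
  move=> a' b' c' d' [h1 h2 h3 h4] [h5 h6 h7 h8] h9 h10; rewrite /P.
  set p := (x +i* y)%C in hD hd.
  have ab' : a' <= b' by lra.
  have cd' : c' <= d' by lra.
  pose E z := F z - F p - D * (z - p).
  have cE : rectcts E a' b' c' d'.
    move=> x1 y1 hx1 hy1; apply: ccontD.
      by apply: ccontD; [apply: (rectcts_sub _ _ _ _ cF) hx1 hy1|exact: ccont_cst].
    apply: ccontN; apply: ccontM; first exact: ccont_cst.
    by apply: ccontD; [exact: ccont_id|exact: ccont_cst].
  have cA : rectcts (fun z => (F p - D * p) + D * z) a' b' c' d'.
    move=> x1 y1 _ _; apply: ccontD; first exact: ccont_cst.
    by apply: ccontM; [exact: ccont_cst|exact: ccont_id].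
  have -> : rectint F a' b' c' d' = rectint E a' b' c' d'.
    rewrite -[RHS]addr0 -(@rectint_affine (F p - D * p) D a' b' c' d') // -rectintD //.
    rewrite (_ : (fun z => _) = F) //; apply/funext => z; rewrite /E; ring.
  set X := (b' - a') + (d' - c').
  have -> : e * (4 * X ^+ 2) = 4 * (e * X) * X by ring.
  apply: rectint_le => // x1 y1 /andP[i1 i2] /andP[i3 i4].
  have q : cmod ((x1 +i* y1)%C - p) <= X.
    apply: (le_trans (cmod_le_ReIm _)); rewrite /X /=; apply: lerD; rewrite ler_norml; lra.
  apply: (@le_trans _ _ (e * cmod ((x1 +i* y1)%C - p))).
    by apply: hd; apply: le_lt_trans q _; rewrite /X; lra.
  by rewrite ler_pM2l.
apply/eqP; rewrite -cmod_eq0 eq_le cmod_ge0 andbT; apply/ler_addgt0Pr => e e0; rewrite add0r.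
have L0 : 0 < 4 * L ^+ 2 + 1 by rewrite ltr_wpDl // mulr_ge0 // sqr_ge0.
apply: (le_trans (key (e / (4 * L ^+ 2 + 1)) (divr_gt0 e0 L0))).
by rewrite mulrAC ler_pdivrMr // ler_pM2l // lerDl.
Qed.

End Goursat.

(** * The complex exponential *)

Section Exponential.
Context {R : realType}.
Notation C := R[i].

Definition cexp (z : C) : C := (expR (cRe z) * cos (cIm z) +i* (expR (cRe z) * sin (cIm z)))%C.

Lemma cexpD z w : cexp (z + w) = cexp z * cexp w.
Proof.
apply: ceq; rewrite ?(cReM, cImM) /= cReD cImD expRD ?cosD ?sinD; ring.
Qed.

Lemma cexp0 : cexp 0 = 1.
Proof. by apply: ceq => /=; rewrite expR0 ?cos0 ?sin0 ?mul1r. Qed.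

Lemma cmod_cexp z : cmod (cexp z) = expR (cRe z).
Proof.
by rewrite cmodE /= !exprMn -mulrDr cos2Dsin2 mulr1 sqrtr_sqr ger0_norm // expR_ge0.
Qed.

Lemma cexp_neq0 z : cexp z != 0.
Proof. by rewrite -cmod_gt0 cmod_cexp expR_gt0. Qed.

(** By the functional equation only the point 0 matters. There, with u = cos y + i sin y, the
    remainder splits into those of [expR], of [cos] and [sin], and the quadratic term x (u - 1). *)
Lemma cder_cexp z : cder cexp z (cexp z).
Proof.
have h0 (e : R) : 0 < e -> cnear 0 (fun h : C => cmod (cexp h - 1 - h) <= e * cmod h).
  move=> e0.
  have e4 : 0 < Num.min 1 (e / 4) by rewrite lt_min ltr01 divr_gt0.
  set e1 := Num.min 1 (e / 4) in e4.
  have := (is_derive_eps expR 0 (expR 0)).1 (is_derive_expR 0) _ e4.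
  have := (is_derive_eps cos 0 (- sin 0)).1 (is_derive_cos 0) _ e4.
  have := (is_derive_eps sin 0 (cos 0)).1 (is_derive_sin 0) _ e4.
  move=> /near_dist[d3 d30 h3] /near_dist[d2 d20 h2] /near_dist[d1 d10 h1].
  exists (Num.min (Num.min d1 d2) (Num.min d3 (e / 12))); first by rewrite !lt_min d10 d20 d30 divr_gt0.
  move=> w; rewrite subr0 !lt_min => /andP[/andP[w1 w2] /andP[w3 w4]].
  case: w w1 w2 w3 w4 => x y w1 w2 w3 w4; set w := (x +i* y)%C in w1 w2 w3 w4 *.
  have xw : `|x| <= cmod w := cRe_le w.
  have yw : `|y| <= cmod w := cIm_le w.
  have k1 : `|expR x - 1 - x| <= e1 * `|x|.
    by have := h1 x; rewrite expR0 mul1r !subr0; apply; exact: le_lt_trans xw w1.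
  have k2 : `|cos y - 1| <= e1 * `|y|.
    by have := h2 y; rewrite !subr0 cos0 sin0 oppr0 mul0r subr0; apply; exact: le_lt_trans yw w2.
  have k3 : `|sin y - y| <= e1 * `|y|.
    by have := h3 y; rewrite cos0 sin0 mul1r !subr0; apply; exact: le_lt_trans yw w3.
  pose u : C := (cos y +i* sin y)%C.
  have -> : cexp w - 1 - w = (expR x - 1 - x)%:C%C * u + (u - 1 - (0 +i* y)%C) + x%:C%C * (u - 1).
    by apply: ceq; rewrite ?(cReD, cImD, cReN, cImN, cReM, cImM) /=; ring.
  have cu : cmod u = 1 by rewrite cmodE /= cos2Dsin2 sqrtr1.
  have e1w : e1 * cmod w <= e / 4 * cmod w.
    by rewrite ler_wpM2r ?cmod_ge0 // ge_min lexx orbT.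
  have e1l : e1 <= 1 by rewrite ge_min lexx.
  have b (s : R) : `|s| <= cmod w -> e1 * `|s| <= e / 4 * cmod w.
    by move=> hs; apply: le_trans e1w; rewrite ler_pM2l.
  have p1 : cmod ((expR x - 1 - x)%:C%C * u) <= e / 4 * cmod w.
    by rewrite cmodM cu mulr1 cmod_real (le_trans k1) // b.
  have p2 : cmod (u - 1 - (0 +i* y)%C) <= e / 4 * cmod w + e / 4 * cmod w.
    apply: (le_trans (cmod_le_ReIm _)); rewrite /= ?subr0 ?oppr0 ?addr0; apply: lerD.
      by rewrite (le_trans k2) // b.
    by rewrite (le_trans k3) // b.
  have p3 : cmod (x%:C%C * (u - 1)) <= e / 4 * cmod w.
    have b1 (s : R) : `|s| <= cmod w -> e1 * `|s| <= cmod w.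
      by move=> hs; rewrite -[leRHS]mul1r; apply: ler_pM => //; exact: ltW.
    have q : cmod (u - 1) <= 3 * cmod w.
      apply: (le_trans (cmod_le_ReIm _)); rewrite /= ?subr0 ?oppr0 ?addr0.
      have := le_trans k2 (b1 _ yw); have := le_trans k3 (b1 _ yw).
      have : `|sin y| <= `|sin y - y| + `|y| by rewrite -{1}[sin y](subrK y) ler_normD.
      lra.
    rewrite cmodM cmod_real; apply: (@le_trans _ _ (cmod w * (3 * cmod w))).
      by apply: ler_pM => //; exact: cmod_ge0.
    have -> : cmod w * (3 * cmod w) = 3 * cmod w * cmod w by ring.
    by rewrite ler_wpM2r ?cmod_ge0 //; lra.
  apply: (le_trans (cmodD _ _)); apply: (le_trans (lerD (cmodD _ _) (lexx _))); lra.
move=> e e0; have c0 : 0 < cmod (cexp z) by rewrite cmod_gt0 cexp_neq0.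
have [d d0 h] := h0 _ (divr_gt0 e0 c0).
exists d => // w wz.
have -> : cexp w - cexp z - cexp z * (w - z) = cexp z * (cexp (w - z) - 1 - (w - z)).
  by rewrite -{1}[w](subrK z) addrC cexpD; ring.
rewrite cmodM.
have : cmod (cexp (w - z) - 1 - (w - z)) <= e / cmod (cexp z) * cmod (w - z).
  by apply: h; rewrite subr0.
by rewrite mulrAC ler_pdivlMr // mulrC.
Qed.

Lemma cexp_circle (s t : R) : cexp (s +i* t)%C = circle_pt (expR s) t.
Proof. by []. Qed.

End Exponential.

(** * Means over circles centred at 0 *)

Section Circle.
Context {R : realType}.
Notation C := R[i].
Implicit Types (u : C -> C) (r t : R).

Lemma cmod_circle r t : cmod (circle_pt r t) = `|r|.
Proof.
by rewrite cmodE /= !exprMn -mulrDr cos2Dsin2 mulr1 sqrtr_sqr.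
Qed.

Lemma circle_ptM r t : circle_pt r t = r%:C%C * circle_pt 1 t.
Proof. by apply: ceq; rewrite ?(cReM, cImM) /=; ring. Qed.

Lemma cmod_circleB r r' t : cmod (circle_pt r t - circle_pt r' t) = `|r - r'|.
Proof.
by rewrite circle_ptM [circle_pt r' t]circle_ptM -mulrBl -rmorphB cmodM cmod_real cmod_circle normr1 mulr1.
Qed.

Lemma pcont_circle r t : pcont (circle_pt r) t.
Proof.
apply: ReIm_pcont => /=.
  by apply: cvgM; [exact: cvg_cst|exact: continuous_cos].
by apply: cvgM; [exact: cvg_cst|exact: continuous_sin].
Qed.

Lemma circle_2pi r : circle_pt r (2 * pi) = circle_pt r 0.
Proof. by rewrite /circle_pt mulr_natl cos2pi sin2pi cos0 sin0. Qed.

Lemma twopi_gt0 : 0 < 2 * pi :> R.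
Proof. by rewrite mulr_gt0 // pi_gt0. Qed.

Definition circts u r := forall t, ccont u (circle_pt r t).

Lemma circts_ccts u r a b : circts u r -> ccts a b (fun t => u (circle_pt r t)).
Proof. by move=> h t _; apply: pcont_comp; [exact: pcont_circle|exact: h]. Qed.

(** Compactness of the circle, through bisection of the range of angles: continuity at its points
    gives one radial tolerance for all [t]. *)
Lemma circle_unif u r : circts u r -> forall e, 0 < e -> exists2 d, 0 < d &
  forall r' t, `|r' - r| < d -> 0 <= t <= 2 * pi ->
  cmod (u (circle_pt r' t) - u (circle_pt r t)) <= e.
Proof.
move=> cu e e0.
pose P a b := exists2 d, 0 < d & forall r' t, `|r' - r| < d -> a <= t <= b ->
  cmod (u (circle_pt r' t) - u (circle_pt r t)) <= e.
apply: (@itv_bisection _ P) => [|x y z _ xy yz _ [d1 d10 h1] [d2 d20 h2]|t ht].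
- exact: ltW twopi_gt0.
- exists (Num.min d1 d2) => [|r' t]; first by rewrite lt_min d10.
  rewrite lt_min => /andP[l1 l2] /andP[xt tz].
  have [ty|yt] := lerP t y; first by apply: h1 => //; rewrite xt.
  by apply: h2 => //; rewrite tz ltW.
have e2 : 0 < e / 2 by rewrite divr_gt0.
have [d d0 hd] := cu t _ e2; have d2 : 0 < d / 2 by rewrite divr_gt0.
have /near_dist [dl dl0 hl] := @pcont_circle r t _ d2.
exists dl => // x1 x2 [_ h1 h2 _] h3; exists (d / 2) => // r' s hr /andP[s1 s2].
have k1 : cmod (circle_pt r s - circle_pt r t) < d / 2.
  by apply: hl; rewrite ltr_norml; apply/andP; split; lra.
have k2 : cmod (circle_pt r' s - circle_pt r t) < d.
  apply: (le_lt_trans (cmod_tri _ _ (circle_pt r s))); rewrite [d]splitr ltrD //.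
  by rewrite cmod_circleB.
apply: (le_trans (cmod_tri _ _ (u (circle_pt r t)))); rewrite [e]splitr; apply: lerD.
  exact: ltW (hd _ k2).
by rewrite cmodC; apply: ltW; apply: hd; apply: lt_trans k1 _; lra.
Qed.

Definition cmean r u : C := ((2 * pi)^-1)%:C%C * cint 0 (2 * pi) (fun t => u (circle_pt r t)).

Lemma cmean_ext r u v : (forall t, u (circle_pt r t) = v (circle_pt r t)) -> cmean r u = cmean r v.
Proof. by move=> e; congr (_ * _); apply: cint_ext => t _; exact: e. Qed.

Lemma cmeanD r u v : circts u r -> circts v r -> cmean r (fun z => u z + v z) = cmean r u + cmean r v.
Proof. by move=> h1 h2; rewrite /cmean cintD ?mulrDr //; exact: circts_ccts. Qed.

Lemma cmeanB r u v : circts u r -> circts v r -> cmean r (fun z => u z - v z) = cmean r u - cmean r v.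
Proof. by move=> h1 h2; rewrite /cmean cintB ?mulrBr //; exact: circts_ccts. Qed.

Lemma cmeanZ r k u : circts u r -> cmean r (fun z => k * u z) = k * cmean r u.
Proof. by move=> h1; rewrite /cmean cintZ; [exact: mulrCA|exact: circts_ccts]. Qed.

Lemma cmean_cst r k : cmean r (fun _ => k) = k.
Proof.
rewrite /cmean cint_cst ?(ltW twopi_gt0) // subr0 mulrCA -rmorphM mulVf ?mulr1 //.
by rewrite gt_eqF // twopi_gt0.
Qed.

Lemma cmean_le r u M : circts u r ->
  (forall t, 0 <= t <= 2 * pi -> cmod (u (circle_pt r t)) <= M) -> cmod (cmean r u) <= 2 * M.
Proof.
move=> h hM; rewrite /cmean cmodM cmod_real ger0_norm ?invr_ge0 ?(ltW twopi_gt0) //.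
rewrite mulrC ler_pdivrMr ?twopi_gt0 //.
apply: (le_trans (@cint_le _ _ _ M _ _ _ _)) => //; first exact: (ltW twopi_gt0).
  exact: circts_ccts.
by rewrite subr0 mulrA.
Qed.

Lemma cmean_conj r u : circts u r -> cmean r (fun z => (u z)^*%C) = (cmean r u)^*%C.
Proof.
move=> cu; have cj (x : R) (z : C) : (x%:C * z)^*%C = (x%:C * z^*)%C.
  by case: z => a b; apply: ceq => /=; ring.
rewrite /cmean cj !cintE; congr (_ * _); apply: ceq => /=.
  by apply: rint_ext => t _; case: (u _).
rewrite -mulN1r -rintZ; last by apply: ccts_Im; exact: circts_ccts.
by apply: rint_ext => t _; rewrite mulN1r; case: (u _).
Qed.

Lemma cmean_cont u r0 : circts u r0 -> forall e, 0 < e -> exists2 d, 0 < d &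
  forall r, `|r - r0| < d -> circts u r -> cmod (cmean r u - cmean r0 u) <= e.
Proof.
move=> cu e e0; have e2 : 0 < e / 2 by rewrite divr_gt0.
have [d d0 hd] := circle_unif cu e2; exists d => // r hr cr.
rewrite /cmean -mulrBr -cintB; try exact: circts_ccts.
rewrite cmodM cmod_real ger0_norm ?invr_ge0 ?(ltW twopi_gt0) //.
rewrite mulrC ler_pdivrMr ?twopi_gt0 //.
apply: (le_trans (@cint_le _ _ _ (e / 2) _ _ _ _)); first exact: (ltW twopi_gt0).
- by apply: cctsD; [exact: circts_ccts|apply: cctsN; exact: circts_ccts].
- by move=> t ht; exact: hd.
- by have -> : 2 * (e / 2 * (2 * pi - 0)) = e * (2 * pi) by field.
Qed.

(* In logarithmic coordinates the annulus becomes a rectangle whose horizontal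
   sides are identified by periodicity. *)
Lemma cmean_annulus u r1 r2 : 0 < r1 -> r1 <= r2 ->
  (forall z, r1 <= cmod z <= r2 -> cdif u z) -> cmean r1 u = cmean r2 u.
Proof.
move=> r10 r12; have r20 := lt_le_trans r10 r12.
have [l1 E1] : exists l, r1 = expR l by exists (ln r1); rewrite lnK.
have [l2 E2] : exists l, r2 = expR l by exists (ln r2); rewrite lnK.
subst r1 r2 => hu; have L : l1 <= l2 by rewrite -ler_expR.
have := @goursat _ (fun z => u (cexp z)) l1 l2 0 (2 * pi) L (ltW twopi_gt0).
rewrite /rectint.
have -> : cint l1 l2 (fun x => u (cexp (x +i* 0)%C)) = cint l1 l2 (fun x => u (cexp (x +i* (2 * pi))%C)).
  by apply: cint_ext => x _; rewrite !cexp_circle circle_2pi.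
rewrite (subrr (cint l1 l2 _)) add0r => H.
have {}H : 'i%C * (cint 0 (2 * pi) (fun y => u (cexp (l2 +i* y)%C)) - cint 0 (2 * pi) (fun y => u (cexp (l1 +i* y)%C))) = 0.
  apply: H => x y /andP[x1 x2] hy.
  have : cdif u (cexp (x +i* y)%C).
    by apply: hu; rewrite cmod_cexp /= !ler_expR x1.
  by move=> [d hd]; eexists; apply: cder_comp; [exact: cder_cexp|exact: hd].
move/eqP: H; rewrite mulf_eq0 -cmod_eq0 cmod_i oner_eq0 subr_eq0 => /eqP H.
by rewrite /cmean; congr (_ * _); symmetry; exact: H.
Qed.

(** The annulus is shrunk by [dl] on both sides and the means at the extreme radii are recovered
    from [cmean_cont]. The inner radius may be 0, which turns the statement into the mean value
    property. *)
Lemma cmean_radii u r1 r2 : 0 <= r1 -> r1 <= r2 ->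
  (forall z, r1 <= cmod z <= r2 -> ccont u z) ->
  (forall z, r1 < cmod z < r2 -> cdif u z) -> cmean r1 u = cmean r2 u.
Proof.
move=> r10 r12 cu du; have [->//|n12] := eqVneq r1 r2.
have l12 : r1 < r2 by rewrite lt_neqAle n12.
have cc r : r1 <= r <= r2 -> circts u r.
  by move=> /andP[h1 h2] t; apply: cu; rewrite cmod_circle ger0_norm ?(le_trans r10) ?h1.
apply/eqP; rewrite -subr_eq0 -cmod_eq0 eq_le cmod_ge0 andbT.
apply/ler_addgt0Pr => e e0; rewrite add0r; have e2 : 0 < e / 2 by rewrite divr_gt0.
have c1 : circts u r1 by apply: cc; rewrite lexx.
have c2 : circts u r2 by apply: cc; rewrite lexx r12.
have [d1 d10 h1] := cmean_cont c1 e2.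
have [d2 d20 h2] := cmean_cont c2 e2.
(* The division by 3 keeps [dl] strictly below [d1] and [d2] and leaves a nondegenerate annulus
   after removing [dl] twice. *)
pose dl := Num.min (Num.min d1 d2) (r2 - r1) / 3.
have dl0 : 0 < dl by rewrite divr_gt0 // !lt_min d10 d20 subr_gt0.
have [l1 l2 l3] : [/\ dl < d1, dl < d2 & 3 * dl <= r2 - r1].
  have k : 3 * dl = Num.min (Num.min d1 d2) (r2 - r1) by rewrite /dl; field.
  have k1 : 3 * dl <= d1 by rewrite k !ge_min lexx.
  have k2 : 3 * dl <= d2 by rewrite k !ge_min lexx orbT.
  have k3 : 3 * dl <= r2 - r1 by rewrite k !ge_min lexx orbT.
  by split => //; lra.
have b1 : r1 < r1 + dl by rewrite ltrDl.
have b2 : r2 - dl < r2 by rewrite ltrBlDr ltrDl.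
have b3 : r1 + dl <= r2 - dl by lra.
have E : cmean (r1 + dl) u = cmean (r2 - dl) u.
  apply: cmean_annulus => // [|z /andP[z1 z2]]; first exact: le_lt_trans b1.
  by apply: du; rewrite (lt_le_trans b1) // (le_lt_trans z2).
have -> : cmean r1 u - cmean r2 u = (cmean (r2 - dl) u - cmean r2 u) - (cmean (r1 + dl) u - cmean r1 u).
  by rewrite E; ring.
apply: (le_trans (cmodB_le _ _)); rewrite [e]splitr; apply: lerD.
  apply: h2; first by rewrite addrAC subrr sub0r normrN gtr0_norm.
  by apply: cc; apply/andP; split; lra.
apply: h1; first by rewrite addrAC subrr add0r gtr0_norm.
by apply: cc; apply/andP; split; lra.
Qed.

(** The exceptional point lies on a single circle, so the radii are compared in two stages through
    [cmod p]. In Cauchy's formula [p] is the point where a difference quotient is merely known to be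
    continuous. *)
Lemma mean_value u p r0 r : 0 <= r -> r < r0 ->
  (forall z, cmod z < r0 -> ccont u z) ->
  (forall z, 0 < cmod z < r0 -> z != p -> cdif u z) -> cmean r u = u 0.
Proof.
move=> rp rr0 cu du.
have -> : u 0 = cmean 0 u.
  rewrite -[u 0](cmean_cst 0); apply: cmean_ext => t.
  by rewrite /circle_pt !mul0r.
have cont s1 s2 z : 0 <= s1 -> s2 < r0 -> s1 <= cmod z <= s2 -> ccont u z.
  by move=> _ h2 /andP[_ h]; apply: cu; exact: le_lt_trans h h2.
have [pr|rp'] := lerP (cmod p) r.
  have pr0 := le_lt_trans pr rr0.
  rewrite -(@cmean_radii u (cmod p) r) ?cmod_ge0 //; last 2 first.
  - by move=> z; apply: cont; rewrite ?cmod_ge0.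
  - move=> z /andP[h1 h2]; apply: du; first by rewrite (le_lt_trans _ h1) ?cmod_ge0 //= (lt_trans h2).
    by apply: contraTneq h1 => ->; rewrite ltxx.
  symmetry; apply: cmean_radii; rewrite ?cmod_ge0 //.
  - by move=> z; exact: cont.
  - move=> z /andP[h1 h2]; apply: du; first by rewrite h1 (lt_trans h2).
    by apply: contraTneq h2 => ->; rewrite ltxx.
symmetry; apply: cmean_radii => //.
- by move=> z; exact: cont.
- move=> z /andP[h1 h2]; apply: du; first by rewrite h1 (lt_trans h2).
  by apply: contraTneq h2 => ->; rewrite -leNgt ltW.
Qed.

End Circle.

Global Opaque cmean.

(** * Cauchy's integral formula and its consequences *)

Section CauchyFormula.
Context {R : realType}.
Notation C := R[i].
Implicit Types (u phi : C -> C) (r : R) (z w h : C).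

Lemma conjM z w : (z * w)^*%C = z^*%C * w^*%C. Proof. exact: rmorphM. Qed.
Lemma conjV z : (z^-1)^*%C = (z^*%C)^-1. Proof. exact: conjc_inv. Qed.
Lemma conjB z w : (z - w)^*%C = z^*%C - w^*%C. Proof. exact: rmorphB. Qed.

Lemma circle_neq r t z : cmod z < r -> circle_pt r t - z != 0.
Proof.
move=> zr; rewrite subr_eq0; apply: contraTneq zr => <-.
by rewrite cmod_circle -leNgt real_ler_norm ?num_real.
Qed.

Lemma circle_conj r t : (circle_pt r t)^*%C * circle_pt r t = (r ^+ 2)%:C%C.
Proof. by rewrite mulrC mul_conj cmod_circle real_normK ?num_real. Qed.

Lemma quot_cont u z d : cder u z d ->
  ccont (fun w => if w == z then d else (u w - u z) / (w - z)) z.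
Proof.
move=> h e e0; have e2 : 0 < e / 2 by rewrite divr_gt0.
apply: cnearS (h _ e2) => w hw; rewrite eqxx; case: eqVneq => [_|wz].
  by rewrite subrr cmod0.
have wz0 : w - z != 0 by rewrite subr_eq0.
have -> : (u w - u z) / (w - z) - d = (u w - u z - d * (w - z)) / (w - z) by field.
rewrite cmodf ltr_pdivrMr ?cmod_gt0 //; apply: (le_lt_trans hw).
by rewrite ltr_pM2r ?cmod_gt0 //; lra.
Qed.

Lemma cdifM u v z : cdif u z -> cdif v z -> cdif (fun w => u w * v w) z.
Proof. by move=> [a ha] [b hb]; eexists; exact: cderM ha hb. Qed.
Lemma cdifD u v z : cdif u z -> cdif v z -> cdif (fun w => u w + v w) z.
Proof. by move=> [a ha] [b hb]; eexists; exact: cderD ha hb. Qed.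
Lemma cdifV u z : u z != 0 -> cdif u z -> cdif (fun w => (u w)^-1) z.
Proof. by move=> uz [a ha]; eexists; exact: cderV ha. Qed.
Lemma cdif_cst (a : C) z : cdif (fun _ => a) z.
Proof. by exists 0; exact: cder_cst. Qed.
Lemma cdif_id z : cdif id z.
Proof. by exists 1; exact: cder_id. Qed.
Lemma cdif_subr (a : C) z : cdif (fun w => w - a) z.
Proof. by apply: cdifD; [exact: cdif_id|exact: cdif_cst]. Qed.
Lemma cdifN u z : cdif u z -> cdif (fun w => - u w) z.
Proof.
by move=> h; apply: (cdif_eq (f := fun w => -1 * u w)); [apply: cnearW => w; rewrite mulN1r|apply: cdifM => //; exact: cdif_cst].
Qed.
Lemma cdifX u n z : cdif u z -> cdif (fun w => u w ^+ n) z.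
Proof.
move=> h; elim: n => [|n ih].
  by apply: (cdif_eq (f := fun _ => 1)); [apply: cnearW|exact: cdif_cst].
apply: (cdif_eq (f := fun w => u w * u w ^+ n)); last exact: cdifM.
by apply: cnearW => w; rewrite exprS.
Qed.

(* On the circle the kernel is the conjugate of a function holomorphic in a larger disc. *)
Lemma mean_kernel r z : cmod z < r -> cmean r (fun w => w / (w - z)) = 1.
Proof.
move=> zr; have r0 : 0 < r := le_lt_trans (cmod_ge0 _) zr.
have rC : (r ^+ 2)%:C%C != 0 :> C by rewrite -cmod_eq0 cmod_real normr_eq0 expf_neq0 // gt_eqF.
pose g w := (r ^+ 2)%:C%C / ((r ^+ 2)%:C%C - z^*%C * w).
(* Larger than [r], and still below the modulus of the pole of [g], since |z| (2 r - |z|) = r^2 - (r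
   - |z|)^2. *)
pose r1 := 2 * r - cmod z.
have nz w : cmod w < r1 -> (r ^+ 2)%:C%C - z^*%C * w != 0.
  move=> wr; rewrite subr_eq0; apply/eqP => E.
  have : cmod ((r ^+ 2)%:C%C : C) = cmod z * cmod w by rewrite E cmodM cmod_conj.
  rewrite cmod_real ger0_norm ?sqr_ge0 // => E2.
  have : cmod z * cmod w <= cmod z * r1 by rewrite ler_wpM2l ?cmod_ge0 // ltW.
  have : 0 < (r - cmod z) ^+ 2 by rewrite exprn_gt0 // subr_gt0.
  rewrite -E2 /r1 !expr2; lra.
have dg w : cmod w < r1 -> cdif g w.
  move=> wr; apply: cdifM; first exact: cdif_cst.
  apply: cdifV; first exact: nz.
  apply: cdifD; first exact: cdif_cst.
  by apply: cdifN; apply: cdifM; [exact: cdif_cst|exact: cdif_id].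
have rr1 : r < r1 by rewrite /r1; lra.
have cg : circts g r.
  by move=> t; apply: cdif_cont; apply: dg; rewrite cmod_circle gtr0_norm.
have mg : cmean r g = 1.
  rewrite (@mean_value _ g 0 r1 r) ?(ltW r0) //.
  - by rewrite /g mulr0 subr0 divff.
  - by move=> w /dg /cdif_cont.
  - by move=> w /andP[_ /dg].
rewrite -[RHS]conjc1 -mg -cmean_conj //; apply: cmean_ext => t.
set w := circle_pt r t; have wz : w - z != 0 by exact: circle_neq.
have ww : w^*%C * w = (r ^+ 2)%:C%C := circle_conj r t.
have w0 : w != 0 by rewrite -cmod_eq0 cmod_circle normr_eq0 gt_eqF.
apply: (can_inj (@conjcK R)); rewrite conjcK /g -ww.
have cwz : (w^*)%C - (z^*)%C != 0.
  by rewrite subr_eq0; apply: contra wz => /eqP /(can_inj (@conjcK R)) ->; rewrite subrr.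
rewrite -mulrBl -mulf_div divff // mulr1; apply: (etrans (conjM _ _)).
by congr (_ * _); apply: (etrans (conjV _)); congr (_^-1); exact: conjB.
Qed.

(** With dw = i w dt this is the usual contour integral. The product of w and the difference
    quotient at [z] vanishes at 0, so its mean is 0, and [mean_kernel] evaluates the rest. At 0 only
    continuity is assumed; removable singularities are treated by translating them there. *)
Lemma cauchy_formula u r0 r z :
  (forall w, cmod w < r0 -> ccont u w) -> (forall w, 0 < cmod w < r0 -> cdif u w) ->
  cmod z < r -> r < r0 -> u z = cmean r (fun w => w * u w / (w - z)).
Proof.
move=> cu du zr rr0; have r00 : 0 < r := le_lt_trans (cmod_ge0 _) zr.
have cur : circts u r by move=> t; apply: cu; rewrite cmod_circle gtr0_norm.
have cq : circts (fun w => w / (w - z)) r.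
  move=> t; apply: ccontM; first exact: ccont_id.
  by apply: ccontV; [exact: circle_neq|apply: cdif_cont; exact: cdif_subr].
have [z0|z0] := eqVneq z 0.
  rewrite {1}z0 -(@mean_value _ u 0 r0 r) ?(ltW r00) //; last by move=> w /du.
  apply: cmean_ext => t; rewrite z0 subr0 mulrAC divff ?mul1r //.
  by rewrite -cmod_eq0 cmod_circle normr_eq0 gt_eqF.
have [d hd] : cdif u z by apply: du; rewrite cmod_gt0 z0 (lt_trans zr).
pose g w := w * (if w == z then d else (u w - u z) / (w - z)).
have dg w : 0 < cmod w < r0 -> w != z -> cdif g w.
  move=> wr wz; apply: (cdif_eq (f := fun w => w * ((u w - u z) / (w - z)))).
    by apply: cnearS (cnear_neq wz) => v vz; rewrite /g (negbTE vz).
  apply: cdifM; first exact: cdif_id.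
  apply: cdifM; first by apply: cdifD; [exact: du|exact: cdif_cst].
  by apply: cdifV; [rewrite subr_eq0|exact: cdif_subr].
have cg w : cmod w < r0 -> ccont g w.
  move=> wr; apply: ccontM; first exact: ccont_id.
  have [->|wz] := eqVneq w z; first exact: quot_cont.
  apply: (ccont_eq (f := fun w => (u w - u z) / (w - z))).
    by apply: cnearS (cnear_neq wz) => v vz; rewrite (negbTE vz).
  apply: ccontM; first by apply: ccontD; [exact: cu|exact: ccont_cst].
  by apply: ccontV; [rewrite subr_eq0|apply: cdif_cont; exact: cdif_subr].
have mg : cmean r g = 0 by rewrite (@mean_value _ g z r0 r) ?(ltW r00) // /g mul0r.
have -> : u z = u z * cmean r (fun w => w / (w - z)) by rewrite mean_kernel // mulr1.
rewrite -cmeanZ // -[LHS]add0r -mg -cmeanD.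
- apply: cmean_ext => t; set w := circle_pt r t.
  have wz : w != z by rewrite -subr_eq0 circle_neq.
  by rewrite /g (negbTE wz); field; rewrite subr_eq0.
- by move=> t; apply: cg; rewrite cmod_circle gtr0_norm.
- by move=> t; apply: ccontM; [exact: ccont_cst|exact: cq].
Qed.

Lemma circts_bounded u r : circts u r ->
  exists2 M, 0 < M & forall t, 0 <= t <= 2 * pi -> cmod (u (circle_pt r t)) <= M.
Proof.
move=> cu; have cm := ccts_cmod (@circts_ccts _ u r 0 (2 * pi) cu).
have [c _ hc] := @EVT_max _ _ 0 (2 * pi) (ltW twopi_gt0) (rcts_within cm).
exists (cmod (u (circle_pt r c)) + 1); first by rewrite ltr_wpDl ?cmod_ge0.
by move=> t ht; apply: (le_trans (hc t _)); rewrite ?in_itv //= lerDl.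
Qed.

(** Cauchy integrals without factorials: when [phi] satisfies Cauchy's formula, m = 1 gives [phi], m
    = 2 its derivative and m = 3 half of its second derivative. *)
Definition ckernel phi r m z := cmean r (fun w => w * phi w / (w - z) ^+ m).

Lemma ckernel_circts phi r m z : circts phi r -> cmod z < r ->
  circts (fun w => w * phi w / (w - z) ^+ m) r.
Proof.
move=> cp zr t; apply: ccontM; first by apply: ccontM; [exact: ccont_id|exact: cp].
apply: ccontV; first by rewrite expf_neq0 // circle_neq.
by apply: cdif_cont; apply: cdifX; exact: cdif_subr.
Qed.

Lemma circle_dist r t z rho : cmod z <= rho -> rho < r -> r - rho <= cmod (circle_pt r t - z).
Proof.
move=> h1 h2; apply: le_trans (cmod_leB _ _); rewrite cmod_circle gtr0_norm ?lerB //.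
exact: le_lt_trans (cmod_ge0 z) (le_lt_trans h1 h2).
Qed.

Lemma ckernel_bound phi r m z rho M : circts phi r -> 0 < M ->
  (forall t, 0 <= t <= 2 * pi -> cmod (phi (circle_pt r t)) <= M) ->
  cmod z <= rho -> rho < r -> cmod (ckernel phi r m z) <= 2 * (r * M / (r - rho) ^+ m).
Proof.
move=> cp M0 hM h1 h2; have zr := le_lt_trans h1 h2.
have r0 : 0 < r := le_lt_trans (cmod_ge0 _) zr.
apply: cmean_le; first exact: ckernel_circts.
move=> t ht; rewrite cmodf cmodM cmodX cmod_circle gtr0_norm //.
apply: ler_pM; rewrite ?mulr_ge0 ?invr_ge0 ?exprn_ge0 ?cmod_ge0 ?(ltW r0) //.
  by rewrite ler_pM2l // hM.
rewrite lef_pV2 ?posrE ?exprn_gt0 ?cmod_gt0 ?circle_neq ?subr_gt0 //.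
by apply: lerXn2r; rewrite ?nnegrE ?cmod_ge0 ?subr_ge0 ?(ltW h2) // circle_dist.
Qed.

Lemma ckernel_est1 phi r rho M z h : circts phi r -> 0 < M ->
  (forall t, 0 <= t <= 2 * pi -> cmod (phi (circle_pt r t)) <= M) ->
  cmod z <= rho -> cmod (z + h) <= rho -> rho < r ->
  cmod (ckernel phi r 1 (z + h) - ckernel phi r 1 z - h * ckernel phi r 2 z) <=
    2 * (r * M / (r - rho) ^+ 3) * cmod h ^+ 2.
Proof.
move=> cp M0 hM h1 h1' h2; have zr := le_lt_trans h1 h2; have zr' := le_lt_trans h1' h2.
have r0 : 0 < r := le_lt_trans (cmod_ge0 _) zr.
have c1 := @ckernel_circts phi r 1 (z + h) cp zr'.
have c2 := @ckernel_circts phi r 1 z cp zr; have c3 := @ckernel_circts phi r 2 z cp zr.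
rewrite /ckernel -cmeanB // -cmeanZ // -cmeanB; last 2 first.
- by move=> t; apply: ccontD; [exact: c1|apply: ccontN; exact: c2].
- by move=> t; apply: ccontM; [exact: ccont_cst|exact: c3].
rewrite -mulrA; apply: cmean_le.
  move=> t; apply: ccontD; first by apply: ccontD; [exact: c1|apply: ccontN; exact: c2].
  by apply: ccontN; apply: ccontM; [exact: ccont_cst|exact: c3].
move=> t ht; set w := circle_pt r t.
have n1 : w - z != 0 by exact: circle_neq.
have n2 : w - (z + h) != 0 by exact: circle_neq.
have -> : w * phi w / (w - (z + h)) ^+ 1 - w * phi w / (w - z) ^+ 1 - h * (w * phi w / (w - z) ^+ 2) =
   w * phi w / ((w - z) ^+ 2 * (w - (z + h))) * h ^+ 2 by field; rewrite n1 n2.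
rewrite cmodM [cmod (h ^+ 2)]cmodX ler_wpM2r ?exprn_ge0 ?cmod_ge0 //.
rewrite cmodf !cmodM cmod_circle gtr0_norm //.
have d1 := circle_dist t h1 h2; have d2 := circle_dist t h1' h2.
have s0 : 0 < r - rho by rewrite subr_gt0.
apply: ler_pM; rewrite ?mulr_ge0 ?invr_ge0 ?mulr_ge0 ?exprn_ge0 ?cmod_ge0 ?(ltW r0) //.
  by rewrite ler_pM2l // hM.
rewrite lef_pV2 ?posrE ?mulr_gt0 ?exprn_gt0 ?cmod_gt0 //.
rewrite exprSr expr2 ler_pM ?mulr_ge0 ?cmod_ge0 ?(ltW s0) //.
by rewrite ler_pM ?(ltW s0).
Qed.

Lemma ckernel_est2 phi r rho M z h : circts phi r -> 0 < M ->
  (forall t, 0 <= t <= 2 * pi -> cmod (phi (circle_pt r t)) <= M) ->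
  cmod z <= rho -> cmod (z + h) <= rho -> rho < r ->
  cmod (ckernel phi r 2 (z + h) - ckernel phi r 2 z - h * (2 * ckernel phi r 3 z)) <=
    2 * (r * M * (10 * r) / (r - rho) ^+ 5) * cmod h ^+ 2.
Proof.
move=> cp M0 hM h1 h1' h2; have zr := le_lt_trans h1 h2; have zr' := le_lt_trans h1' h2.
have r0 : 0 < r := le_lt_trans (cmod_ge0 _) zr.
have c1 := @ckernel_circts phi r 2 (z + h) cp zr'.
have c2 := @ckernel_circts phi r 2 z cp zr; have c3 := @ckernel_circts phi r 3 z cp zr.
rewrite mulrA /ckernel -cmeanB // -cmeanZ // -cmeanB; last 2 first.
- by move=> t; apply: ccontD; [exact: c1|apply: ccontN; exact: c2].
- by move=> t; apply: ccontM; [exact: ccont_cst|exact: c3].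
rewrite -mulrA; apply: cmean_le.
  move=> t; apply: ccontD; first by apply: ccontD; [exact: c1|apply: ccontN; exact: c2].
  by apply: ccontN; apply: ccontM; [exact: ccont_cst|exact: c3].
move=> t ht; set w := circle_pt r t.
have n1 : w - z != 0 by exact: circle_neq.
have n2 : w - (z + h) != 0 by exact: circle_neq.
have -> : w * phi w / (w - (z + h)) ^+ 2 - w * phi w / (w - z) ^+ 2 - h * 2 * (w * phi w / (w - z) ^+ 3) =
   w * phi w * (3 * (w - z) - 2 * h) / ((w - z) ^+ 3 * (w - (z + h)) ^+ 2) * h ^+ 2 by field; rewrite n1 n2.
rewrite cmodM [cmod (h ^+ 2)]cmodX ler_wpM2r ?exprn_ge0 ?cmod_ge0 //.
have d1 := circle_dist t h1 h2; have d2 := circle_dist t h1' h2.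
have s0 : 0 < r - rho by rewrite subr_gt0.
have cw : cmod w = r by rewrite cmod_circle gtr0_norm.
have b3 : cmod (3 * (w - z) - 2 * h) <= 10 * r.
  have -> : 3 * (w - z) - 2 * h = 3 * w - z - 2 * (z + h) by ring.
  have e1 := cmodB_le (3 * w - z) (2 * (z + h)); have e2 := cmodB_le (3 * w) z.
  move: e1 e2; rewrite !cmodM !cmod_nat cw; lra.
have cn : cmod ((w - z) ^+ 3 * (w - (z + h)) ^+ 2) = cmod (w - z) ^+ 3 * cmod (w - (z + h)) ^+ 2.
  by rewrite cmodM !cmodX.
rewrite cmodf cn [cmod (w * _ * _)]cmodM [cmod (w * _)]cmodM cw.
apply: ler_pM; rewrite ?mulr_ge0 ?invr_ge0 ?mulr_ge0 ?exprn_ge0 ?cmod_ge0 ?(ltW r0) //.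
  apply: ler_pM; rewrite ?mulr_ge0 ?cmod_ge0 ?(ltW r0) //.
  by rewrite ler_pM2l // hM.
rewrite lef_pV2 ?posrE ?mulr_gt0 ?exprn_gt0 ?cmod_gt0 //.
rewrite (exprD _ 3 2) ler_pM ?exprn_ge0 ?(ltW s0) // lerXn2r ?nnegrE ?cmod_ge0 ?(ltW s0) //.
Qed.

Lemma quad_cder u z d (K e : R) : 0 < e ->
  (forall h, cmod h < e -> cmod (u (z + h) - u z - h * d) <= K * cmod h ^+ 2) -> cder u z d.
Proof.
move=> e0 hK e1 e10; have K0 : 0 < `|K| + 1 by rewrite ltr_wpDl.
exists (Num.min e (e1 / (`|K| + 1))); first by rewrite lt_min e0 divr_gt0.
move=> w; rewrite lt_min => /andP[w1 w2]; have := hK _ w1.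
have -> : z + (w - z) = w by rewrite addrC subrK.
rewrite [_ * d]mulrC => /le_trans; apply.
rewrite expr2 mulrA ler_wpM2r ?cmod_ge0 //; move: w2; rewrite ltr_pdivlMr // mulrC => /ltW.
apply: le_trans; rewrite ler_wpM2r ?cmod_ge0 //.
by rewrite (le_trans (ler_norm _)) // lerDl.
Qed.

Lemma ckernel_cder phi r z : circts phi r -> cmod z < r ->
  cder (ckernel phi r 1) z (ckernel phi r 2 z) /\ cdif (ckernel phi r 2) z.
Proof.
move=> cp zr; have [M M0 hM] := circts_bounded cp.
pose rho := (cmod z + r) / 2.
have z1 : cmod z < rho by rewrite /rho; lra.
have z2 : rho < r by rewrite /rho; lra.
have e0 : 0 < rho - cmod z by rewrite subr_gt0.
have zh h : cmod h < rho - cmod z -> cmod (z + h) <= rho.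
  by move=> hh; apply: (le_trans (cmodD _ _)); lra.
split.
  apply: (quad_cder e0) => h /zh hh.
  exact: (ckernel_est1 cp M0 hM (ltW z1) hh z2).
exists (2 * ckernel phi r 3 z); apply: (quad_cder e0) => h /zh hh.
exact: (ckernel_est2 cp M0 hM (ltW z1) hh z2).
Qed.

(** The library derivative is kept, so that iterates of [cd] are those in [diff_monomial]. Its value
    is meaningful only where [cdif] holds. *)
Definition cd u z : C := derive1 (u : R[i]^o -> R[i]^o) z.

Lemma cd_cder u z d : cder u z d -> cd u z = d.
Proof. exact: cder_derive1. Qed.

Lemma cder_cd u z : cdif u z -> cder u z (cd u z).
Proof. by move=> [d hd]; rewrite (cd_cder hd). Qed.

Lemma cd_eq u v z : cnear z (fun w => u w = v w) -> cdif u z -> cd u z = cd v z.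
Proof. by move=> e [d hd]; rewrite (cd_cder hd) (cd_cder (cder_eq e hd)). Qed.

Section Disc.
Variables (u : C -> C) (r0 : R).
Hypothesis cu : forall w, cmod w < r0 -> ccont u w.
Hypothesis du : forall w, 0 < cmod w < r0 -> cdif u w.

Lemma disc_circts r : 0 <= r -> r < r0 -> circts u r.
Proof. by move=> h1 h2 t; apply: cu; rewrite cmod_circle ger0_norm. Qed.

Lemma disc_ckernel1 r z : cmod z < r -> r < r0 -> u z = ckernel u r 1 z.
Proof. by move=> h1 h2; rewrite (cauchy_formula cu du h1 h2). Qed.

Lemma disc_cder r z : cmod z < r -> r < r0 -> cder u z (ckernel u r 2 z).
Proof.
move=> zr rr0; have r00 : 0 <= r := ltW (le_lt_trans (cmod_ge0 _) zr).
apply: (cder_eq (f := ckernel u r 1)); last by case: (ckernel_cder (disc_circts r00 rr0) zr).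
by apply: cnearS (cnear_lt zr) => w wr; rewrite -disc_ckernel1.
Qed.

Lemma disc_cd r z : cmod z < r -> r < r0 -> cd u z = ckernel u r 2 z.
Proof. by move=> h1 h2; apply: cd_cder; exact: disc_cder. Qed.

Lemma disc_mid z : cmod z < r0 -> exists2 r, cmod z < r & r < r0.
Proof. by move=> h; exists ((cmod z + r0) / 2); lra. Qed.

Lemma disc_cdif z : cmod z < r0 -> cdif u z.
Proof. by move=> /disc_mid[r h1 h2]; eexists; exact: disc_cder h1 h2. Qed.

Lemma disc_cdif_cd z : cmod z < r0 -> cdif (cd u) z.
Proof.
move=> /disc_mid[r h1 h2]; have r00 : 0 <= r := ltW (le_lt_trans (cmod_ge0 _) h1).
apply: (cdif_eq (f := ckernel u r 2)); last by case: (ckernel_cder (disc_circts r00 h2) h1).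
by apply: cnearS (cnear_lt h1) => w wr; rewrite (disc_cd wr).
Qed.

(** A second-order remainder bounded uniformly on a smaller disc; it replaces differentiation under
    the integral sign in the construction of primitives. *)
Lemma disc_quad rho : rho < r0 -> exists2 K, 0 < K & forall z h,
  cmod z <= rho -> cmod (z + h) <= rho -> cmod (u (z + h) - u z - h * cd u z) <= K * cmod h ^+ 2.
Proof.
move=> hr; have [rn|rp] := ltP rho 0.
  by exists 1 => // z h hz; have := le_lt_trans (le_trans (cmod_ge0 z) hz) rn; rewrite ltxx.
pose r := (rho + r0) / 2; have h1 : rho < r by rewrite /r; lra.
have h2 : r < r0 by rewrite /r; lra.
have rp' : 0 < r by lra.
have cp := disc_circts (ltW rp') h2; have [M M0 hM] := circts_bounded cp.
exists (2 * (r * M / (r - rho) ^+ 3)).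
  by apply: mulr_gt0 => //; apply: divr_gt0; [exact: mulr_gt0|rewrite exprn_gt0 // subr_gt0].
move=> z h hz hzh; have zr := le_lt_trans hz h1; have zr' := le_lt_trans hzh h1.
rewrite (disc_cd zr) // {1}(disc_ckernel1 zr') // {1}(disc_ckernel1 zr) //.
exact: ckernel_est1.
Qed.

Lemma cauchy_estimate r M z : cmod z < r -> r < r0 -> 0 < M ->
  (forall t, 0 <= t <= 2 * pi -> cmod (u (circle_pt r t)) <= M) ->
  cmod (u z) <= 2 * (r * M / (r - cmod z)).
Proof.
move=> zr rr0 M0 hM; have r00 : 0 <= r := ltW (le_lt_trans (cmod_ge0 _) zr).
by rewrite (disc_ckernel1 zr) // ckernel_bound //; exact: disc_circts.
Qed.

End Disc.

Lemma cder_shift u z w d : cder u (z + w) d -> cder (fun v => u (z + v)) w d.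
Proof.
move=> h e /h [dl dl0 hd]; exists dl => // v hv.
by have := hd (z + v); rewrite opprD addrACA subrr add0r; apply.
Qed.

Lemma cder_unshift u z w d : cder (fun v => u (z + v)) w d -> cder u (z + w) d.
Proof.
move=> h e /h [dl dl0 hd]; exists dl => // v hv.
have E1 : z + (v - z) = v by rewrite addrC subrK.
have E2 : v - z - w = v - (z + w) by ring.
by have := hd (v - z); rewrite E1 E2; apply.
Qed.

Lemma ccont_shift u z w : ccont u (z + w) -> ccont (fun v => u (z + v)) w.
Proof.
move=> h e /h [dl dl0 hd]; exists dl => // v hv.
by have := hd (z + v); rewrite opprD addrACA subrr add0r; apply.
Qed.

Lemma cdif_shift u z w : cdif u (z + w) <-> cdif (fun v => u (z + v)) w.
Proof. by split => -[d hd]; exists d; [exact: cder_shift|exact: cder_unshift]. Qed.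

Lemma holo_cd u z : holo u z -> holo (cd u) z.
Proof.
move=> [d d0 h]; pose v w := u (z + w).
have dv w : cmod w < d -> cdif v w.
  by move=> wd; apply/cdif_shift; apply: h; rewrite addrC addKr.
have E w : cmod w < d -> cd v w = cd u (z + w).
  by move=> wd; apply: cd_cder; apply: cder_shift; apply: cder_cd; apply: h; rewrite addrC addKr.
exists d => // w wd; rewrite -[w](subrK z) addrC; apply/cdif_shift.
apply: (cdif_eq (f := cd v)); first by apply: cnearS (cnear_lt wd) => x /E.
apply: (@disc_cdif_cd v d) => // x; first by move=> /dv /cdif_cont.
by move=> /andP[_ /dv].
Qed.

(** After translation of [z] to 0 Cauchy's formula applies, and it represents [u] by a kernel that
    is differentiable at the centre as well. *)
Lemma removable u z : ccont u z -> cnear z (fun w => w != z -> cdif u w) -> holo u z.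
Proof.
move=> cu [d d0 h]; pose v w := u (z + w).
have dv w : 0 < cmod w < d -> cdif v w.
  move=> /andP[w0 wd]; apply/cdif_shift; apply: h; first by rewrite addrC addKr.
  by rewrite -subr_eq0 addrC addKr -cmod_gt0.
have cv w : cmod w < d -> ccont v w.
  have [->|w0] := eqVneq w 0; first by move=> _; apply: ccont_shift; rewrite addr0.
  by move=> wd; apply: cdif_cont; apply: dv; rewrite cmod_gt0 w0.
exists d => // w wd; rewrite -[w](subrK z) addrC; apply/cdif_shift.
exact: (disc_cdif cv dv).
Qed.

End CauchyFormula.

Global Opaque cd.

(** * Orders of meromorphic functions *)

Section Orders.
Context {R : realType}.
Notation C := R[i].
Implicit Types (f g u k : C -> C) (z w : C) (n m : int).

Lemma holoD f g z : holo f z -> holo g z -> holo (fun w => f w + g w) z.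
Proof. by move=> hf hg; apply: cnearS (cnearI hf hg) => w [h1 h2]; exact: cdifD. Qed.
Lemma holoM f g z : holo f z -> holo g z -> holo (fun w => f w * g w) z.
Proof. by move=> hf hg; apply: cnearS (cnearI hf hg) => w [h1 h2]; exact: cdifM. Qed.
Lemma holoN f z : holo f z -> holo (fun w => - f w) z.
Proof. by move=> hf; apply: cnearS hf => w h1; exact: cdifN. Qed.
Lemma holoX f (j : nat) z : holo f z -> holo (fun w => f w ^+ j) z.
Proof. by move=> hf; apply: cnearS hf => w h1; exact: cdifX. Qed.
Lemma holoV f z : f z != 0 -> holo f z -> holo (fun w => (f w)^-1) z.
Proof.
move=> fz hf; apply: cnearS (cnearI hf (ccont_neq0 (holo_cont hf) fz)) => w [h1 h2].
exact: cdifV.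
Qed.
Lemma holo_cst (a : C) z : holo (fun _ => a) z.
Proof. by apply: cnearW => w; exact: cdif_cst. Qed.
Lemma holo_subr (a z : C) : holo (fun w => w - a) z.
Proof. by apply: cnearW => w; exact: cdif_subr. Qed.
Lemma holo_id z : holo id z.
Proof. by apply: cnearW => w; exact: cdif_id. Qed.

Lemma holo_exprz (a z : C) n : z != a -> holo (fun w => (w - a) ^ n) z.
Proof.
move=> za; have h0 : z - a != 0 by rewrite subr_eq0.
case: n => j; first by apply: holoX; exact: holo_subr.
apply: (holo_eq (f := fun w => ((w - a) ^+ j.+1)^-1)).
  by apply: cnearW => w; rewrite NegzE -invr_expz.
apply: holoV; first by rewrite expf_neq0.
by apply: holoX; exact: holo_subr.
Qed.

Lemma cder_subX (a z : C) (j : nat) : cder (fun w => (w - a) ^+ j.+1) z (j.+1%:R * (z - a) ^+ j).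
Proof.
have d1 : cder (fun w => w - a) z 1.
  by rewrite -[1]addr0; apply: cderD; [exact: cder_id|exact: cder_cst].
elim: j => [|j ih].
  by rewrite mul1r expr0; apply: cder_eq d1; apply: cnearW => w; rewrite expr1.
have := cderM d1 ih; rewrite mul1r => h.
have -> : j.+2%:R * (z - a) ^+ j.+1 = (z - a) ^+ j.+1 + (z - a) * (j.+1%:R * (z - a) ^+ j).
  by rewrite mulrCA -exprS -[in LHS]addn1 natrD mulrDl mul1r addrC.
by apply: cder_eq h; apply: cnearW => w; rewrite [RHS]exprS.
Qed.

Lemma cder_exprz (a z : C) n : z != a ->
  cder (fun w => (w - a) ^ n) z (n%:~R * ((z - a) ^ n / (z - a))).
Proof.
move=> za; have h0 : z - a != 0 by rewrite subr_eq0.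
case: n => [[|j]|j].
- rewrite mul0r; apply: (cder_eq (f := fun _ => 1)); first by apply: cnearW.
  exact: cder_cst.
- have := @cder_subX a z j; congr (cder _ _ _).
  by rewrite -exprnP exprSr mulfK // pmulrn.
- have := @cderV R (fun w => (w - a) ^+ j.+1) z _ (expf_neq0 j.+1 h0) (@cder_subX a z j).
  have -> : - (j.+1%:R * (z - a) ^+ j) / ((z - a) ^+ j.+1) ^+ 2 =
    (Negz j)%:~R * ((z - a) ^ (Negz j) / (z - a)).
    rewrite NegzE -invr_expz mulrNz -exprnP !exprSr -pmulrn.
    have hj : (z - a) ^+ j != 0 by rewrite expf_neq0.
    by field; rewrite h0 hj.
  by apply: cder_eq; apply: cnearW => w; rewrite NegzE -invr_expz.
Qed.

Definition hord f z n := exists g, [/\ holo g z, g z != 0 &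
  cnear z (fun w => w != z -> f w = (w - z) ^ n * g w)].

Lemma has_order_hord f z n : has_order f z n <-> hord f z n.
Proof.
split=> -[g [h1 h2 h3]]; exists g; split => //.
- by apply/holo_holomorphic_at.
- by apply/dnbhs_cnear.
- by apply/holo_holomorphic_at.
- by apply/dnbhs_cnear.
Qed.

Lemma hord_uniq_le f z n m : hord f z n -> hord f z m -> n <= m -> n = m.
Proof.
move=> [g [hg g0 eg]] [k [hk k0 ek]]; rewrite le_eqVlt => /orP[/eqP //|nm].
exfalso; have [j Ej] : exists j : nat, m = n + j.+1%:Z.
  by exists (absz (m - n)).-1; lia.
have : g z = (z - z) ^+ j.+1 * k z.
  apply: (ccont_lim_eq (f := g) (g := fun w => (w - z) ^+ j.+1 * k w)).
  - exact: holo_cont.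
  - by apply: holo_cont; apply: holoM => //; apply: holoX; exact: holo_subr.
  - apply: cnearS (cnearI eg ek) => w [h1 h2] wz.
    have w0 : w - z != 0 by rewrite subr_eq0.
    have := h1 wz; rewrite (h2 wz) Ej expfzDr // -mulrA => /(mulfI (expfz_neq0 n w0)).
    by rewrite -exprnP => ->.
by rewrite subrr expr0n mul0r; apply/eqP.
Qed.

Lemma hord_uniq f z n m : hord f z n -> hord f z m -> n = m.
Proof.
move=> h1 h2; case: (leP n m) => [|/ltW] h; first exact: hord_uniq_le h1 h2 h.
by symmetry; exact: hord_uniq_le h2 h1 h.
Qed.

Lemma hord_order_at f z n : hord f z n -> order_at f z = n.
Proof.
move=> h; rewrite /order_at; case: xgetP => [m _ /has_order_hord hm|/(_ n) hn].
  exact: hord_uniq hm h.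
by exfalso; apply: hn; apply/has_order_hord.
Qed.

Lemma hord_eq f g z n : cnear z (fun w => w != z -> f w = g w) -> hord f z n -> hord g z n.
Proof.
move=> e [k [hk k0 ek]]; exists k; split => //.
by apply: cnearS (cnearI e ek) => w [h1 h2] wz; rewrite -h1 // h2.
Qed.

Lemma hord0 f z : holo f z -> f z != 0 -> hord f z 0.
Proof. by move=> h1 h2; exists f; split => //; apply: cnearW => w _; rewrite expr0z mul1r. Qed.

Lemma hord_subr z : hord (fun w => w - z) z 1.
Proof.
exists (fun _ => 1); split; [exact: holo_cst|exact: oner_neq0|].
by apply: cnearW => w _; rewrite expr1z mulr1.
Qed.

Lemma hordM f g z n m : hord f z n -> hord g z m -> hord (fun w => f w * g w) z (n + m).
Proof.
move=> [k [hk k0 ek]] [l [hl l0 el]]; exists (fun w => k w * l w); split.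
- exact: holoM.
- by rewrite mulf_neq0.
- apply: cnearS (cnearI ek el) => w [h1 h2] wz; rewrite h1 // h2 //.
  by rewrite expfzDr ?subr_eq0 // mulrACA.
Qed.

Lemma hordV f z n : hord f z n -> hord (fun w => (f w)^-1) z (- n).
Proof.
move=> [k [hk k0 ek]]; exists (fun w => (k w)^-1); split; [exact: holoV|by rewrite invr_eq0|].
by apply: cnearS ek => w h1 wz; rewrite h1 // invfM invr_expz.
Qed.

Lemma hordXz f z n m : hord f z n -> hord (fun w => f w ^ m) z (n * m).
Proof.
move=> [k [hk k0 ek]]; exists (fun w => k w ^ m); split; last first.
- by apply: cnearS ek => w h1 wz; rewrite h1 // expfzMl exprz_exp.
- exact: expfz_neq0.
case: m => j; first exact: holoX.
apply: (holo_eq (f := fun w => (k w ^+ j.+1)^-1)).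
  by apply: cnearW => w; rewrite NegzE -invr_expz.
by apply: holoV; [rewrite expf_neq0|exact: holoX].
Qed.

Lemma hordX f z n (j : nat) : hord f z n -> hord (fun w => f w ^+ j) z (n * j%:Z).
Proof. exact: (@hordXz f z n j). Qed.

Lemma hord_prod (I : eqType) (s : seq I) (F : I -> C -> C) (o : I -> int) z :
  (forall i, i \in s -> hord (F i) z (o i)) ->
  hord (fun w => \prod_(i <- s) F i w) z (\sum_(i <- s) o i).
Proof.
elim: s => [|i s ih] h.
  rewrite big_nil; apply: (hord_eq (f := fun _ => 1)).
    by apply: cnearW => w _; rewrite big_nil.
  by apply: hord0; [exact: holo_cst|exact: oner_neq0].
rewrite big_cons; apply: (hord_eq (f := fun w => F i w * \prod_(i <- s) F i w)).
  by apply: cnearW => w _; rewrite big_cons.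
apply: hordM; first by apply: h; rewrite inE eqxx.
by apply: ih => j js; apply: h; rewrite inE js orbT.
Qed.

Definition regular f z := holo f z /\ f z != 0.

Lemma regular_hord f z : regular f z -> hord f z 0.
Proof. by case; exact: hord0. Qed.

Lemma hord_regular f z n : hord f z n -> cnear z (fun w => w != z -> regular f w).
Proof.
move=> [k [hk k0 ek]].
have := cnearI (cnearI (cnear_near hk) (ccont_neq0 (holo_cont hk) k0)) (cnear_near ek).
apply: cnearS => w [[h1 h2] h3] wz.
have e : cnear w (fun v => (v - z) ^ n * k v = f v).
  by apply: cnearS (cnearI h3 (cnear_neq wz)) => v [h vz]; rewrite h.
split.
  by apply: holo_eq e _; apply: holoM => //; exact: holo_exprz.
by rewrite -(cnear_self e) mulf_neq0 // expfz_neq0 // subr_eq0.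
Qed.

(** Without a finite order, [u] can be divided by every power (w - z)^j. Cauchy's estimate bounds
    the quotients on a disc by a constant times (d/2)^(-j), and multiplying back on the disc of
    radius d/4 gives |u| <= 4 M / 2^j for all j. *)
Lemma vanish_dichotomy u z : holo u z ->
  (exists j : nat, hord u z j) \/ cnear z (fun w => u w = 0).
Proof.
move=> [d d0 hu]; have [ex|nex] := pselect (exists j : nat, hord u z j); first by left.
right; pose v w := u (z + w).
have dv w : cmod w < d -> cdif v w.
  by move=> wd; apply/cdif_shift; apply: hu; rewrite addrC addKr.
have G (j : nat) : exists g, (forall w, cmod w < d -> cdif g w) /\ (forall w, cmod w < d -> v w = w ^+ j * g w).
  elim: j => [|j [g [dg eg]]]; first by exists v; split => // w _; rewrite mul1r.
  have g0 : g 0 = 0.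
    apply: contrapT => /eqP g0; apply: nex; exists j; exists (fun w => g (w - z)); split.
    - exists d => // w wd; have := dg _ wd => -[e he]; exists e.
      have := @cder_shift R g (- z) w e; rewrite addrC => /(_ he).
      by apply: cder_eq; apply: cnearW => x; rewrite addrC.
    - by rewrite subrr.
    - exists d => // w wd _; rewrite -exprnP -eg // /v; congr u.
      by rewrite addrC subrK.
  have d00 : cmod (0 : C) < d by rewrite cmod0.
  have [e he] := dg 0 d00.
  (* One more factor w is extracted from [g], which vanishes at 0; filling in the derivative makes
     the quotient continuous, so [disc_cdif] applies. *)
  pose g1 w := if w == 0 then e else (g w - g 0) / (w - 0).
  have cg1 : forall w, 0 < cmod w < d -> cdif g1 w.
    move=> w /andP[w0 wd]; rewrite cmod_gt0 in w0.
    apply: (cdif_eq (f := fun w => (g w - g 0) / (w - 0))).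
      by apply: cnearS (cnear_neq w0) => x x0; rewrite /g1 (negbTE x0).
    apply: cdifM; first by apply: cdifD; [exact: dg|exact: cdif_cst].
    by apply: cdifV; [rewrite subr0|exact: cdif_subr].
  have cc w : cmod w < d -> ccont g1 w.
    have [->|w0] := eqVneq w 0; first by move=> _; exact: quot_cont.
    by move=> wd; apply: cdif_cont; apply: cg1; rewrite cmod_gt0 w0.
  exists g1; split; first exact: (disc_cdif cc cg1).
  move=> w wd; rewrite eg // /g1 g0; case: eqVneq => [->|w0].
    by rewrite g0 mulr0 expr0n mul0r.
  by rewrite !subr0 exprSr -mulrA [w * _]mulrC divfK.
have rp : 0 < d / 2 by rewrite divr_gt0.
have rd : d / 2 < d by lra.
have cv : circts v (d / 2).
  by move=> t; apply: cdif_cont; apply: dv; rewrite cmod_circle gtr0_norm.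
have [M M0 hM] := circts_bounded cv.
exists (d / 4); first by rewrite divr_gt0.
move=> w wd; set x := w - z in wd.
have -> : u w = v x by rewrite /v /x addrC subrK.
apply/eqP; rewrite -cmod_eq0 eq_le cmod_ge0 andbT; apply/ler_addgt0Pr => e e0; rewrite add0r.
have [j hj] := half_pow_lt (4 * M) e0; apply: ltW; apply: le_lt_trans hj.
have [g [dg eg]] := G j.
have xd : cmod x < d by lra.
have xd2 : cmod x < d / 2 by lra.
rewrite eg // cmodM cmodX.
have Mj : 0 < M / (d / 2) ^+ j by rewrite divr_gt0 // exprn_gt0.
have dg' w' : cmod w' < d -> ccont g w' by move=> /dg /cdif_cont.
have := @cauchy_estimate R g d dg' (fun w h => dg w (proj2 (andP h))) (d / 2) _ x xd2 rd Mj.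
have hb t : 0 <= t <= 2 * pi -> cmod (g (circle_pt (d / 2) t)) <= M / (d / 2) ^+ j.
  move=> /hM; rewrite eg ?cmod_circle ?gtr0_norm // cmodM cmodX cmod_circle gtr0_norm //.
  by rewrite ler_pdivlMr ?exprn_gt0 // mulrC.
move=> /(_ hb) H.
apply: (le_trans (ler_wpM2l (exprn_ge0 _ (cmod_ge0 _)) H)).
have y1 : cmod x ^+ j <= (d / 4) ^+ j by rewrite lerXn2r ?nnegrE ?cmod_ge0 // ltW // divr_gt0.
have y2 : d / 2 * (M / (d / 2) ^+ j) / (d / 2 - cmod x) <= 2 * (M / (d / 2) ^+ j).
  rewrite ler_pdivrMr ?subr_gt0 //; move: (M / _) Mj => Q Q0.
  rewrite (_ : 2 * Q * _ = Q * (2 * (d / 2 - cmod x))); last by ring.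
  by rewrite (mulrC (d / 2)) ler_pM2l //; lra.
apply: (@le_trans _ _ ((d / 4) ^+ j * (2 * (2 * (M / (d / 2) ^+ j))))).
  apply: ler_pM; rewrite ?exprn_ge0 ?cmod_ge0 //; last by rewrite ler_pM2l.
  exact: le_trans (cmod_ge0 _) H.
have -> : d / 4 = (d / 2) * 2^-1 by field.
rewrite exprMn exprVn; have q : (d / 2) ^+ j != 0 by rewrite expf_neq0 // gt_eqF.
have -> : (d / 2) ^+ j * 2 ^- j * (2 * (2 * (M / (d / 2) ^+ j))) = 4 * M / 2 ^+ j.
  by field; rewrite q expf_neq0.
by [].
Qed.

(** Unlike in [hord], [g] may vanish at [z], even identically. This makes the notion stable under
    sums and derivatives; [mer_atP] recovers an order or local vanishing. *)
Definition mer_at f z := exists n g, holo g z /\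
  cnear z (fun w => w != z -> f w = (w - z) ^ n * g w).

Definition vanish_at f z := cnear z (fun w => w != z -> f w = 0).

Lemma hord_mer f z n : hord f z n -> mer_at f z.
Proof. by move=> [g [h1 _ h2]]; exists n, g. Qed.

Lemma hord_nvanish f z n : hord f z n -> ~ vanish_at f z.
Proof.
move=> /hord_regular h1 h2.
have [w _ [[_ /negP h3] h4]] : exists2 w, w != z & regular f w /\ f w = 0.
  by apply: cnear_ex; apply: cnearS (cnearI h1 h2) => w [k1 k2] wz; split; [exact: k1|exact: k2].
by apply: h3; rewrite h4.
Qed.

Lemma mer_atP f z : mer_at f z -> (exists n, hord f z n) \/ vanish_at f z.
Proof.
move=> [n [g [hg eg]]]; case: (vanish_dichotomy hg) => [[j hj]|g0]; last first.
  by right; apply: cnearS (cnearI eg g0) => w [h1 h2] wz; rewrite h1 // h2 mulr0.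
left; exists (n + j); apply: (hord_eq (f := fun w => (w - z) ^ n * g w)).
  by apply: cnearS eg => w h wz; rewrite h.
by apply: hordM => //; have := hordXz n (hord_subr z); rewrite mul1r.
Qed.

Lemma mer_at_eq f g z : cnear z (fun w => w != z -> f w = g w) -> mer_at f z -> mer_at g z.
Proof.
move=> e [n [k [hk ek]]]; exists n, k; split => //.
by apply: cnearS (cnearI e ek) => w [h1 h2] wz; rewrite -h1 // h2.
Qed.

Lemma holo_mer f z : holo f z -> mer_at f z.
Proof. by move=> h; exists 0, f; split => //; apply: cnearW => w _; rewrite expr0z mul1r. Qed.

Lemma mer_atM f g z : mer_at f z -> mer_at g z -> mer_at (fun w => f w * g w) z.
Proof.
move=> [n [k [hk ek]]] [m [l [hl el]]]; exists (n + m), (fun w => k w * l w); split.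
  exact: holoM.
apply: cnearS (cnearI ek el) => w [h1 h2] wz; rewrite h1 // h2 //.
by rewrite expfzDr ?subr_eq0 // mulrACA.
Qed.

(** Every sufficiently negative exponent is admissible, so that two functions acquire a common one
    and can be added. *)
Lemma mer_at_low f z : mer_at f z -> exists j : nat, forall i : nat, (j <= i)%N ->
  exists g, holo g z /\ cnear z (fun w => w != z -> f w = (w - z) ^ (- i%:Z) * g w).
Proof.
move=> [n [g [hg eg]]]; exists (absz n) => i ji.
have [l El] : exists l : nat, n + i%:Z = l.
  by exists (absz (n + i)); lia.
exists (fun w => (w - z) ^+ l * g w); split.
  by apply: holoM => //; apply: holoX; exact: holo_subr.
apply: cnearS eg => w h wz; rewrite h // mulrA; congr (_ * _).
by rewrite exprnP -expfzDr ?subr_eq0 // -El addrCA addNr addr0.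
Qed.

Lemma mer_atD f g z : mer_at f z -> mer_at g z -> mer_at (fun w => f w + g w) z.
Proof.
move=> /mer_at_low[j1 h1] /mer_at_low[j2 h2]; pose i := maxn j1 j2.
have [k [hk ek]] := h1 i (leq_maxl _ _); have [l [hl el]] := h2 i (leq_maxr _ _).
exists (- i%:Z), (fun w => k w + l w); split; first exact: holoD.
by apply: cnearS (cnearI ek el) => w [e1 e2] wz; rewrite e1 // e2 // mulrDr.
Qed.

Lemma mer_at_cst (a : C) z : mer_at (fun _ => a) z.
Proof. by apply: holo_mer; exact: holo_cst. Qed.

Lemma mer_atN f z : mer_at f z -> mer_at (fun w => - f w) z.
Proof.
move=> h; apply: (mer_at_eq (f := fun w => -1 * f w)); first by apply: cnearW => w _; rewrite mulN1r.
by apply: mer_atM => //; exact: mer_at_cst.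
Qed.

Lemma cd_factor f z n g : holo g z ->
  cnear z (fun w => w != z -> f w = (w - z) ^ n * g w) ->
  cnear z (fun w => w != z -> cd f w = (w - z) ^ (n - 1) * (n%:~R * g w + (w - z) * cd g w)).
Proof.
move=> hg /cnear_near eg; apply: cnearS (cnearI hg eg) => w [dg ew] wz.
have w0 : w - z != 0 by rewrite subr_eq0.
have := cderM (@cder_exprz z w n wz) (cder_cd dg).
move=> h; apply: cd_cder; apply: (cder_eq (f := fun w => (w - z) ^ n * g w)).
  by apply: cnearS (cnearI ew (cnear_neq wz)) => v [e vz]; rewrite e.
move: h; congr (cder _ _ _); rewrite expfzDr // exprN1; by field.
Qed.

Lemma mer_at_cd f z : mer_at f z -> mer_at (cd f) z.
Proof.
move=> [n [g [hg eg]]]; exists (n - 1), (fun w => n%:~R * g w + (w - z) * cd g w).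
split; last exact: cd_factor.
apply: holoD; first by apply: holoM => //; exact: holo_cst.
by apply: holoM; [exact: holo_subr|exact: holo_cd].
Qed.

Lemma intC_neq0 n : n != 0 -> (n%:~R : C) != 0.
Proof. by move=> n0; rewrite intr_eq0. Qed.

Lemma hord_cd f z n : n != 0 -> hord f z n -> hord (cd f) z (n - 1).
Proof.
move=> n0 [g [hg g0 eg]]; exists (fun w => n%:~R * g w + (w - z) * cd g w); split.
- apply: holoD; first by apply: holoM => //; exact: holo_cst.
  by apply: holoM; [exact: holo_subr|exact: holo_cd].
- by rewrite subrr mul0r addr0 mulf_neq0 // intC_neq0.
- exact: cd_factor.
Qed.

Lemma hord0_holo f z : hord f z 0 -> exists g, [/\ holo g z, g z != 0 &
  cnear z (fun w => w != z -> f w = g w)].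
Proof.
move=> [g [h1 h2 h3]]; exists g; split => //.
by apply: cnearS h3 => w h wz; rewrite h // expr0z mul1r.
Qed.

Lemma cd_punctured f g z : cnear z (fun w => w != z -> f w = g w) -> holo g z ->
  cnear z (fun w => w != z -> cd f w = cd g w).
Proof.
move=> /cnear_near e hg; apply: cnearS (cnearI e hg) => w [ew dw] wz.
symmetry; apply: cd_eq => //.
by apply: cnearS (cnearI ew (cnear_neq wz)) => v [h vz]; rewrite h.
Qed.

(** The reciprocal, set to 0 at [z], is continuous there, hence holomorphic. Its zero at [z] has a
    finite positive order because the reciprocal does not vanish nearby. *)
Lemma pole_hord f z : pole_at f z -> exists j : nat, hord f z (- j.+1%:Z).
Proof.
move=> [/dnbhs_cnear df fy].
have big (A : R) : cnear z (fun w => w != z -> A < cmod (f w)).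
  by apply/dnbhs_cnear; move/cvgryPgt: fy; apply.
pose k w := if w == z then 0 else (f w)^-1.
have ck : ccont k z.
  move=> e e0; apply: cnearS (big e^-1) => w h; rewrite /k eqxx subr0.
  case: eqVneq => [_|wz]; first by rewrite cmod0.
  rewrite cmodV -[e]invrK ltf_pV2 ?posrE ?invr_gt0 //; first exact: h.
  by apply: lt_trans (h wz); rewrite invr_gt0.
have hk : holo k z.
  apply: removable => //.
  have := cnear_near (cnearI df (big 0)); apply: cnearS => w h wz.
  apply: (cdif_eq (f := fun w => (f w)^-1)).
    by apply: cnearS (cnear_neq wz) => v vz; rewrite /k (negbTE vz).
  have [h1 h2] := cnear_self h.
  by apply: cdifV; [rewrite -cmod_gt0; exact: h2|apply/cdif_derivable; exact: h1].
have ek : cnear z (fun w => w != z -> (k w)^-1 = f w).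
  by apply: cnearW => w wz; rewrite /k (negbTE wz) invrK.
case: (vanish_dichotomy hk) => [[[|j] hj]|k0].
- have [g [hg g0 eg]] := hord0_holo hj; exfalso; move/eqP: g0; apply.
  have -> : g z = k z by apply: ccont_lim_eq; [exact: holo_cont|done|apply: cnearS eg => w h wz; rewrite h].
  by rewrite /k eqxx.
- by exists j; apply: hord_eq ek _; exact: hordV.
- exfalso; have [w wz [h1 h2]] : exists2 w, w != z & (k w = 0) /\ 0 < cmod (f w).
    by apply: cnear_ex; apply: cnearS (cnearI k0 (big 0)) => w [h1 h2] wz; split => //; exact: h2.
  by move: h2 h1; rewrite /k (negbTE wz) cmod_gt0 => fw /eqP; rewrite invr_eq0 (negbTE fw).
Qed.

(* Functions are considered up to junk values on a discrete set: [mer] and [merNZ] mean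
   meromorphic, respectively meromorphic and not identically zero, after correcting them. *)
Definition mer f := forall z, mer_at f z.

Lemma meromorphic_mer f : meromorphic f -> mer f.
Proof.
move=> h z; case: (h z) => [/holo_holomorphic_at /holo_mer //|/pole_hord[j]].
exact: hord_mer.
Qed.

(** Connectedness of a segment: at each of its points, either an order exists and no nearby point is
    one of local vanishing, or every nearby point is. On a subinterval, [P] says that local
    vanishing at one point implies it at all others. *)
Lemma vanish_propag f z0 z1 : mer f -> vanish_at f z0 -> vanish_at f z1.
Proof.
move=> mf h0; pose ga (t : R) := z0 + t%:C%C * (z1 - z0).
pose P a b := forall s t, a <= s <= b -> a <= t <= b -> vanish_at f (ga s) -> vanish_at f (ga t).
have /(_ 0 1) : P 0 1.
  apply: itv_bisection => // [x y v _ xy yv _ p1 p2 s t /andP[s1 s2] /andP[t1 t2] hs|t ht].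
    have hy : vanish_at f (ga y).
      have [sy|ys] := lerP s y; first by apply: (p1 s y) => //; rewrite ?s1 ?sy ?xy ?lexx.
      by apply: (p2 s y) => //; rewrite ?s2 ?lexx ?yv ?(ltW ys).
    have [ty|yt] := lerP t y; first by apply: (p1 y t) => //; rewrite ?t1 ?ty ?xy ?lexx.
    by apply: (p2 y t) => //; rewrite ?t2 ?lexx ?yv ?(ltW yt).
  have near_ga (Q : C -> Prop) : cnear (ga t) Q -> exists2 dl, 0 < dl & forall s, `|s - t| < dl -> Q (ga s).
    move=> [d d0 hQ]; exists (d / (cmod (z1 - z0) + 1)).
      by rewrite divr_gt0 // ltr_wpDl ?cmod_ge0.
    move=> s; rewrite ltr_pdivlMr ?ltr_wpDl ?cmod_ge0 // => hs; apply: hQ.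
    rewrite /ga opprD addrACA subrr add0r -mulrBl -rmorphB cmodM cmod_real.
    by apply: le_lt_trans hs; rewrite ler_wpM2l // lerDl.
  case: (mer_atP (mf (ga t))) => [[n hn]|van].
    have nv : cnear (ga t) (fun w => ~ vanish_at f w).
      apply: cnearS (hord_regular hn) => w h.
      have [->|wz] := eqVneq w (ga t); first exact: hord_nvanish hn.
      exact: (hord_nvanish (regular_hord (h wz))).
    have [dl dl0 hd] := near_ga _ nv; exists dl => // x1 x2 [_ a1 a2 _] a3 s s' /andP[s1 s2] _ hs.
    by exfalso; apply: (hd s) => //; rewrite ltr_norml; apply/andP; split; lra.
  have vv : cnear (ga t) (vanish_at f).
    apply: cnearS (cnear_near van) => w h.
    have [->//|wz] := eqVneq w (ga t).
    by apply: cnearS (cnearI h (cnear_neq wz)) => v [h1 h2] _; exact: h1.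
  have [dl dl0 hd] := near_ga _ vv; exists dl => // x1 x2 [_ a1 a2 _] a3 s s' _ /andP[s1 s2] _.
  by apply: hd; rewrite ltr_norml; apply/andP; split; lra.
move=> /(_ _ _); rewrite !lexx ler01 => /(_ isT isT).
by rewrite /ga mul0r addr0 mul1r addrC subrK; apply.
Qed.

Definition merNZ f := forall z, exists n, hord f z n.

Lemma merNZ_mer f : merNZ f -> mer f.
Proof. by move=> h z; have [n /hord_mer] := h z. Qed.

Lemma mer_alt f : mer f -> merNZ f \/ forall z, vanish_at f z.
Proof.
move=> mf; have [[z hz]|nz] := pselect (exists z, vanish_at f z).
  by right => w; exact: vanish_propag hz.
by left => z; case: (mer_atP (mf z)) => // hz; exfalso; apply: nz; exists z.
Qed.

Lemma hord_ord f z : merNZ f -> hord f z (order_at f z).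
Proof. by move=> /(_ z)[n hn]; rewrite (hord_order_at hn). Qed.

(* Removes the junk values of [k] inside the open set [D]. *)
Lemma regularize k (D : C -> Prop) :
  (forall w, D w -> cnear w D) ->
  (forall w, D w -> exists g, holo g w /\ cnear w (fun v => v != w -> k v = g v)) ->
  exists K, forall w, D w -> holo K w /\ cnear w (fun v => v != w -> k v = K v).
Proof.
move=> oD h.
have {}h w : exists g, D w -> holo g w /\ cnear w (fun v => v != w -> k v = g v).
  by have [/h [g hg]|nD] := pselect (D w); [exists g|exists id].
pose g w := projT1 (cid (h w)); have gP w : D w -> holo (g w) w /\ cnear w (fun v => v != w -> k v = g w v).
  exact: (projT2 (cid (h w))).
pose K w := g w w.
have KE w : D w -> cnear w (fun v => g w v = K v).
  move=> Dw; have [hg eg] := gP w Dw.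
  have := cnearI (cnearI (oD w Dw) (cnear_near hg)) (cnear_near eg).
  apply: cnearS => v [[Dv hv] ev].
  have [->//|vw] := eqVneq v w.
  have [hgv egv] := gP v Dv.
  apply: (@ccont_lim_eq R (g w) (g v) v); [by apply: holo_cont|exact: holo_cont|].
  apply: cnearS (cnearI (cnearI ev egv) (cnear_neq vw)) => x [[e1 e2] xw] xv.
  by rewrite -e1 // e2.
exists K => w Dw; have [hg eg] := gP w Dw; split; first exact: holo_eq (KE w Dw) hg.
by apply: cnearS (cnearI eg (KE w Dw)) => v [e1 e2] vw; rewrite e1 // e2.
Qed.

End Orders.

(** * Logarithmic derivatives in a disc *)

Section Primitives.
Context {R : realType}.
Notation C := R[i].
Implicit Types (u v h g : C -> C) (z w a : C) (r t : R).

Lemma cder_path (F : C -> C) t d : cder F t%:C%C d ->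
  is_derive t 1 (fun s : R => cRe (F s%:C%C)) (cRe d) /\
  is_derive t 1 (fun s : R => cIm (F s%:C%C)) (cIm d).
Proof.
move=> h; split; apply/is_derive_eps => e /h [dl dl0 hd]; apply/near_dist;
  exists dl => // s hs; have := hd s%:C%C; rewrite -rmorphB cmod_real => /(_ hs); apply: le_trans.
- have -> : cRe (F s%:C%C) - cRe (F t%:C%C) - cRe d * (s - t) =
    cRe (F s%:C%C - F t%:C%C - d * (s - t)%:C%C).
    by rewrite !(cReD, cReN, cReM) /=; ring.
  exact: cRe_le.
- have -> : cIm (F s%:C%C) - cIm (F t%:C%C) - cIm d * (s - t) =
    cIm (F s%:C%C - F t%:C%C - d * (s - t)%:C%C).
    by rewrite !(cImD, cImN, cImM) /=; ring.
  exact: cIm_le.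
Qed.

Lemma cder_lin (F : C -> C) z w d : cder F (w * z) d -> cder (fun x => F (x * z)) w (d * z).
Proof.
move=> h; apply: (@cder_comp R (fun x => x * z) F w z d) => //.
have := cderM (cder_id w) (cder_cst z w); rewrite mul1r mulr0 addr0; exact.
Qed.

Lemma cmod_seg t z : 0 <= t <= 1 -> cmod (t%:C%C * z) <= cmod z.
Proof.
move=> /andP[t0 t1]; rewrite cmodM cmod_real ger0_norm //.
by rewrite -[leRHS]mul1r ler_wpM2r ?cmod_ge0.
Qed.

Lemma seg_ccts v z : (forall w, cmod w <= cmod z -> ccont v w) ->
  ccts 0 1 (fun t => v (t%:C%C * z)).
Proof.
move=> cv t ht; apply: pcont_comp; last by apply: cv; exact: cmod_seg.
by apply: pcontM; [apply: pcont_real; exact: cvg_id|exact: pcont_cst].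
Qed.

Lemma realC_ccts (a b : R) : ccts a b (fun t : R => t%:C%C : C).
Proof. by move=> t _; apply: pcont_real; exact: cvg_id. Qed.

Lemma cder0_const k r0 z : (forall w, cmod w < r0 -> cder k w 0) -> cmod z < r0 -> k z = k 0.
Proof.
move=> dk zr.
have lez w : cmod w <= cmod z -> cmod w < r0 by move=> h; exact: le_lt_trans h zr.
have E : cint 0 1 (fun _ : R => 0 : C) = k (1%:C%C * z) - k (0%:C%C * z).
  have dp t : 0 <= t <= 1 -> cder (fun w => k (w * z)) t%:C%C 0.
    by move=> ht; rewrite -(mul0r z); apply: cder_lin; apply: dk; apply: lez; exact: cmod_seg.
  apply: (@cint_ftc R 0 1 (fun _ => 0) (fun t => k (t%:C%C * z))) => //.
  - exact: ccts_cst.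
  - by move=> t /dp /cder_path[].
  - by move=> t /dp /cder_path[].
move: E; rewrite cint_cst // mul0r mul1r mul0r => /esym/eqP.
by rewrite subr_eq0 => /eqP.
Qed.

(* The primitive is the radial integral z * int_0^1 v(tz) dt. *)
Lemma primitive v r0 : (forall w, cmod w < r0 -> cdif v w) ->
  exists2 h, h 0 = 0 & forall z, cmod z < r0 -> cder h z (v z).
Proof.
move=> dv; pose h z := z * cint 0 1 (fun t => v (t%:C%C * z)).
exists h; first by rewrite /h mul0r.
move=> z /[dup] zr /disc_mid[rho zrho rr].
have cv w : cmod w < r0 -> ccont v w by move=> /dv /cdif_cont.
have dv' w : 0 < cmod w < r0 -> cdif v w by move=> /andP[_ /dv].
have [K K0 hK] := disc_quad cv dv' rr.
have ccd w : cmod w < r0 -> ccont (cd v) w by move=> /(disc_cdif_cd cv dv') /cdif_cont.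
have le_r0 w : cmod w <= rho -> cmod w < r0 by move=> h1; exact: le_lt_trans h1 rr.
have cseg g w : cmod w <= rho -> (forall w, cmod w < r0 -> ccont g w) -> ccts 0 1 (fun t => g (t%:C%C * w)).
  by move=> wr cg; apply: seg_ccts => x hx; apply: cg; apply: le_r0; exact: le_trans hx wr.
have zr' := ltW zrho.
have cz := cseg v z zr' cv; have czd := cseg (cd v) z zr' ccd.
pose D t := v (t%:C%C * z) + t%:C%C * (cd v (t%:C%C * z) * z).
have cD : ccts 0 1 D.
  apply: cctsD => //; apply: cctsM; first exact: realC_ccts.
  by apply: cctsM => //; exact: ccts_cst.
have ID : cint 0 1 D = v z.
  have dp t : 0 <= t <= 1 -> cder (fun w => w * v (w * z)) t%:C%C (D t).
    move=> ht; have := cderM (cder_id t%:C%C) (cder_lin (cder_cd (dv (t%:C%C * z) _))).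
    by rewrite mul1r; apply; apply: le_r0; apply: le_trans (cmod_seg _ ht) zr'.
  have -> : v z = 1%:C%C * v (1%:C%C * z) - 0%:C%C * v (0%:C%C * z) by rewrite !mul1r !mul0r subr0.
  apply: (@cint_ftc R 0 1 D (fun t => t%:C%C * v (t%:C%C * z))) => //.
  - by move=> t /dp /cder_path[].
  - by move=> t /dp /cder_path[].
have cm : rcts 0 1 (fun t => cmod (cd v (t%:C%C * z))) := ccts_cmod czd.
have [c _ hc] := @EVT_max _ _ 0 1 ler01 (rcts_within cm).
pose M := cmod (cd v (c%:C%C * z)).
have hM t : 0 <= t <= 1 -> cmod (cd v (t%:C%C * z)) <= M.
  by move=> ht; apply: hc; rewrite in_itv.
apply: (@quad_cder R h z (v z) (2 * (rho * K + M)) (rho - cmod z)); first by rewrite subr_gt0.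
move=> dl hdl; have zd : cmod (z + dl) <= rho.
  by apply: (le_trans (cmodD _ _)); lra.
have czdl := cseg v (z + dl) zd cv.
pose F t := (z + dl) * v (t%:C%C * (z + dl)) - z * v (t%:C%C * z) - dl * D t.
have cF : ccts 0 1 F.
  by apply: cctsD; [apply: cctsD; [exact: cctsZ|apply: cctsN; exact: cctsZ]|apply: cctsN; exact: cctsZ].
have -> : h (z + dl) - h z - dl * v z = cint 0 1 F.
  rewrite /h -ID -(cintZ (z + dl) czdl) -(cintZ z cz) -(cintZ dl cD).
  have c1 := cctsZ (z + dl) czdl; have c2 := cctsZ z cz; have c3 := cctsZ dl cD.
  rewrite -(cintB c1 c2) -cintB //.
  by apply: cctsD => //; exact: cctsN.
rewrite -mulrA; have -> : (rho * K + M) * cmod dl ^+ 2 = (rho * K + M) * cmod dl ^+ 2 * (1 - 0) by rewrite subr0 mulr1.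
apply: cint_le => // t ht.
pose E := v (t%:C%C * z + t%:C%C * dl) - v (t%:C%C * z) - t%:C%C * dl * cd v (t%:C%C * z).
have -> : F t = (z + dl) * E + t%:C%C * dl ^+ 2 * cd v (t%:C%C * z).
  by rewrite /F /D /E mulrDr; ring.
have /andP[t0 t1] := ht.
have hE : cmod E <= K * cmod dl ^+ 2.
  apply: (le_trans (hK _ _ _ _)).
  - exact: le_trans (cmod_seg _ ht) zr'.
  - by rewrite -mulrDr; exact: le_trans (cmod_seg _ ht) zd.
  - by rewrite ler_pM2l // lerXn2r ?nnegrE ?cmod_ge0 ?cmod_seg.
apply: (le_trans (cmodD _ _)); rewrite !cmodM mulrDl; apply: lerD.
  by rewrite -mulrA ler_pM ?cmod_ge0.
rewrite cmod_real ger0_norm // -expr2 mulrC ler_pM ?cmod_ge0 ?mulr_ge0 ?cmod_ge0 ?hM //.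
by rewrite -[leRHS]mul1r ler_wpM2r ?mulr_ge0 ?cmod_ge0.
Qed.

(** With [h] a primitive of u'/u, the product of u and exp(-h) has derivative 0 and is constant.
    Only moduli are compared, so no branch of the logarithm is chosen. *)
Lemma log_nonvanish u r0 : 0 < r0 -> (forall w, cmod w < r0 -> cdif u w /\ u w != 0) ->
  exists h, forall z, cmod z < r0 -> cder h z (cd u z / u z) /\ ln (cmod (u z)) = cRe (h z).
Proof.
move=> r00 hu.
have cu w : cmod w < r0 -> ccont u w by move=> /hu[/cdif_cont].
have du w : 0 < cmod w < r0 -> cdif u w by move=> /andP[_ /hu[]].
have dv w : cmod w < r0 -> cdif (fun w => cd u w / u w) w.
  move=> wr; apply: cdifM; first exact: disc_cdif_cd cu du _ wr.
  by apply: cdifV; case: (hu w wr).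
have [h h0 dh] := primitive dv.
exists (fun w => h w + (ln (cmod (u 0)))%:C%C) => z zr; split.
  by rewrite -[_ / _]addr0; apply: cderD; [exact: dh|exact: cder_cst].
have dk w : cmod w < r0 -> cder (fun x => u x * cexp (- h x)) w 0.
  move=> wr; have [dw w0] := hu w wr.
  have dN : cder (fun x => - h x) w (- (cd u w / u w)).
    apply: (cder_eq (f := fun x => -1 * h x)); first by apply: cnearW => x; rewrite mulN1r.
    have := cderM (cder_cst (-1) w) (dh w wr); rewrite mul0r add0r mulN1r; exact.
  have := cderM (cder_cd dw) (cder_comp dN (cder_cexp (- h w))).
  by congr (cder _ _ _); field.
have := cder0_const dk zr; rewrite h0 oppr0 cexp0 mulr1 => E.
have {}E : cmod (u z) = cmod (u 0) * expR (cRe (h z)).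
  rewrite -E cmodM cmod_cexp -mulrA -expRD cReN addNr expR0 mulr1 //.
have u00 : 0 < cmod (u 0) by rewrite cmod_gt0; case: (hu 0); rewrite ?cmod0.
by rewrite E lnM ?posrE ?expR_gt0 // expRK cReD /= addrC.
Qed.

Definition rmean r (phi : C -> R) : R := (2 * pi)^-1 * rint 0 (2 * pi) (fun t => phi (circle_pt r t)).

Definition circr (phi : C -> R) r := forall t, {for t, continuous (fun t => phi (circle_pt r t))}.

Lemma circr_rcts phi r (a b : R) : circr phi r -> rcts a b (fun t => phi (circle_pt r t)).
Proof. by move=> h t _; exact: h. Qed.

Lemma rmeanD r phi psi : circr phi r -> circr psi r -> rmean r (fun w => phi w + psi w) = rmean r phi + rmean r psi.
Proof. by move=> h1 h2; rewrite /rmean rintD ?mulrDr //; exact: circr_rcts. Qed.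

Lemma rmeanZ r k phi : circr phi r -> rmean r (fun w => k * phi w) = k * rmean r phi.
Proof. by move=> h1; rewrite /rmean rintZ; [exact: mulrCA|exact: circr_rcts]. Qed.

Lemma rmean_ext r phi psi : (forall t, phi (circle_pt r t) = psi (circle_pt r t)) -> rmean r phi = rmean r psi.
Proof. by move=> h; congr (_ * _); apply: rint_ext => t _; exact: h. Qed.

Lemma rmean_cst r k : rmean r (fun _ => k) = k.
Proof.
rewrite /rmean rint_cst ?(ltW twopi_gt0) // subr0 mulrCA mulVf ?mulr1 //.
by rewrite gt_eqF // twopi_gt0.
Qed.

Lemma rmean_le r phi psi : circr phi r -> circr psi r ->
  (forall t, phi (circle_pt r t) <= psi (circle_pt r t)) -> rmean r phi <= rmean r psi.
Proof.
move=> h1 h2 h; rewrite /rmean ler_wpM2l ?invr_ge0 ?(ltW twopi_gt0) //.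
by apply: (rint_le (circr_rcts h1) (circr_rcts h2)) => t _; exact: h.
Qed.

Lemma rmean_ge0 r phi : (forall t, 0 <= phi (circle_pt r t)) -> 0 <= rmean r phi.
Proof.
move=> h; rewrite /rmean mulr_ge0 ?invr_ge0 ?(ltW twopi_gt0) //.
by apply: rint_ge0 => t _; exact: h.
Qed.

Lemma circr_cst k r : circr (fun _ => k) r.
Proof. by move=> t; exact: cvg_cst. Qed.

Lemma circr_Re u r : circts u r -> circr (fun w => cRe (u w)) r.
Proof. by move=> h t; apply: cRe_cvg; apply: pcont_comp; [exact: pcont_circle|exact: h]. Qed.

Lemma circr_cmod u r : circts u r -> circr (fun w => cmod (u w)) r.
Proof. by move=> h t; apply: cmod_cvg; apply: pcont_comp; [exact: pcont_circle|exact: h]. Qed.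

Lemma circr_norm phi r : circr phi r -> circr (fun w => `|phi w|) r.
Proof. by move=> h t; apply: cvg_norm; exact: h. Qed.

Lemma circrZ k phi r : circr phi r -> circr (fun w => k * phi w) r.
Proof. by move=> h t; apply: cvgM; [exact: cvg_cst|exact: h]. Qed.

Lemma circrD phi psi r : circr phi r -> circr psi r -> circr (fun w => phi w + psi w) r.
Proof. by move=> h h' t; apply: cvgD; [exact: h|exact: h']. Qed.

Lemma cmeanE r u : cmean r u = ((2 * pi)^-1)%:C%C * cint 0 (2 * pi) (fun t => u (circle_pt r t)).
Proof. by []. Qed.

Lemma cRe_cmean r u : cRe (cmean r u) = rmean r (fun w => cRe (u w)).
Proof. by rewrite cmeanE cReM cintE /= mul0r subr0. Qed.

Lemma cmod_cmean r u : circts u r -> cmod (cmean r u) <= 2 * rmean r (fun w => cmod (u w)).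
Proof.
move=> cu; rewrite cmeanE cmodM cmod_real ger0_norm ?invr_ge0 ?(ltW twopi_gt0) //.
rewrite /rmean mulrCA ler_wpM2l ?invr_ge0 ?(ltW twopi_gt0) //.
by apply: cint_cmod; exact: circts_ccts.
Qed.

Lemma jensen_nonvanish u r0 r : 0 <= r -> r < r0 ->
  (forall w, cmod w < r0 -> cdif u w /\ u w != 0) ->
  rmean r (fun w => ln (cmod (u w))) = ln (cmod (u 0)).
Proof.
move=> rp rr0 hu; have r00 := le_lt_trans rp rr0; have [h hh] := log_nonvanish r00 hu.
have z0 : cmod (0 : C) < r0 by rewrite cmod0.
rewrite (hh 0 z0).2 -(@mean_value _ h 0 r0 r) // ?cRe_cmean.
- by apply: rmean_ext => t; rewrite (hh _ _).2 // cmod_circle ger0_norm.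
- by move=> z /hh[/cder_cont].
- by move=> z /andP[_ /hh[hz _]] _; eexists; exact: hz.
Qed.

(** The zero of w |-> r^2 - conj(z) w lies beyond 2 r - |z|, since |z| (2 r - |z|) = r^2 - (r -
    |z|)^2 < r^2. Hence the recurring bound 2 r - |z|, which exceeds [r]. *)
Lemma blaschke_nz r z w : cmod z < r -> cmod w < 2 * r - cmod z -> (r ^+ 2)%:C%C - z^*%C * w != 0.
Proof.
move=> zr wr; rewrite subr_eq0; apply/eqP => E.
have : cmod ((r ^+ 2)%:C%C : C) = cmod z * cmod w by rewrite E cmodM cmod_conj.
rewrite cmod_real ger0_norm ?sqr_ge0 // => E2.
have : cmod z * cmod w <= cmod z * (2 * r - cmod z) by rewrite ler_wpM2l ?cmod_ge0 // ltW.
have : 0 < (r - cmod z) ^+ 2 by rewrite exprn_gt0 // subr_gt0.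
rewrite -E2 !expr2; lra.
Qed.

(* Only the real part of [h] on the circle is needed, since the conjugate of [h]
   contributes the value at 0 of a holomorphic function vanishing there. *)
Lemma cd_real_part h r0 r z : (forall w, cmod w < r0 -> cdif h w) -> cmod z < r -> r < r0 ->
  cd h z = cmean r (fun w => (2 * cRe (h w))%:C%C * (w / (w - z) ^+ 2)).
Proof.
move=> dh zr rr0; have rp := le_lt_trans (cmod_ge0 _) zr.
have ch w : cmod w < r0 -> ccont h w by move=> /dh /cdif_cont.
have dh' w : 0 < cmod w < r0 -> cdif h w by move=> /andP[_ /dh].
have cch : circts h r by move=> t; apply: ch; rewrite cmod_circle gtr0_norm.
have ck m : circts (fun w => w / (w - z) ^+ m) r.
  move=> t; apply: ccontM; first exact: ccont_id.
  apply: ccontV; first by rewrite expf_neq0 // circle_neq.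
  by apply: cdif_cont; apply: cdifX; exact: cdif_subr.
have cconj : circts (fun w => (h w)^*%C) r.
  by move=> t e /(cch t); apply: cnearS => w; rewrite -rmorphB cmod_conj.
pose g w := (r ^+ 2)%:C%C * w * h w / ((r ^+ 2)%:C%C - z^*%C * w) ^+ 2.
pose r1 := Num.min r0 (2 * r - cmod z).
have rr1 : r < r1 by rewrite lt_min rr0; lra.
have dg w : cmod w < r1 -> cdif g w.
  rewrite lt_min => /andP[w1 w2]; apply: cdifM.
    by apply: cdifM; [apply: cdifM; [exact: cdif_cst|exact: cdif_id]|exact: dh].
  apply: cdifV; first by rewrite expf_neq0 // blaschke_nz.
  apply: cdifX; apply: cdifD; first exact: cdif_cst.
  by apply: cdifN; apply: cdifM; [exact: cdif_cst|exact: cdif_id].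
have mg : cmean r g = 0.
  rewrite (@mean_value _ g 0 r1 r) ?(ltW rp) //; first by rewrite /g mulr0 !mul0r.
    by move=> w /dg /cdif_cont.
  by move=> w /andP[_ /dg].
have m0 : cmean r (fun w => (h w)^*%C * (w / (w - z) ^+ 2)) = 0.
  have cg : circts g r by move=> t; apply: cdif_cont; apply: dg; rewrite cmod_circle gtr0_norm.
  rewrite -[RHS]conjc0 -mg -cmean_conj //; apply: cmean_ext => t.
  set w := circle_pt r t; have wz : w - z != 0 by exact: circle_neq.
  have ww : (r ^+ 2)%:C%C = w^*%C * w by rewrite circle_conj.
  have w0 : w != 0 by rewrite -cmod_eq0 cmod_circle normr_eq0 gt_eqF.
  have cw0 : (w^*)%C != 0 by rewrite conjc_eq0.
  have cwz : (w^*)%C - (z^*)%C != 0.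
    by rewrite subr_eq0; apply: contra wz => /eqP /(can_inj (@conjcK R)) ->; rewrite subrr.
  have -> : g w = w^*%C * h w / (w^*%C - z^*%C) ^+ 2.
    by rewrite /g ww -mulrBl; field; rewrite w0 cwz.
  rewrite (conjM (w^*%C * h w)) (conjM (w^*%C)) conjV conjcK expr2 (conjM (_ - _)) (conjB (w^*%C)) !conjcK -expr2.
  by ring.
rewrite (disc_cd ch dh' zr rr0) /ckernel.
rewrite -[LHS]addr0 -m0 -cmeanD; last 2 first.
- exact: ckernel_circts.
- by move=> t; apply: ccontM; [exact: cconj|exact: ck].
apply: cmean_ext => t; set w := circle_pt r t.
have -> : w * h w / (w - z) ^+ 2 + (h w)^*%C * (w / (w - z) ^+ 2) = (h w + (h w)^*%C) * (w / (w - z) ^+ 2) by ring.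
congr (_ * _); case: (h w) => x y; apply: ceq => /=; ring.
Qed.

(** The constant 4 is the factor 2 in front of Re h times the factor 2 of [cmod_cmean]; the rest is
    the size of the kernel on the circle. *)
Lemma cd_real_bound h r0 r z : (forall w, cmod w < r0 -> cdif h w) -> cmod z < r -> r < r0 ->
  cmod (cd h z) <= 4 * r / (r - cmod z) ^+ 2 * rmean r (fun w => `|cRe (h w)|).
Proof.
move=> dh zr rr0; have rp := le_lt_trans (cmod_ge0 _) zr.
have cch : circts h r by move=> t; apply: cdif_cont; apply: dh; rewrite cmod_circle gtr0_norm.
have ck : circts (fun w => w / (w - z) ^+ 2) r.
  move=> t; apply: ccontM; first exact: ccont_id.
  apply: ccontV; first by rewrite expf_neq0 // circle_neq.
  by apply: cdif_cont; apply: cdifX; exact: cdif_subr.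
have cR : circts (fun w => (2 * cRe (h w))%:C%C) r.
  move=> t e e0; have e2 : 0 < e / 2 by rewrite divr_gt0.
  apply: cnearS (cch t _ e2) => w hw; rewrite -rmorphB cmod_real -mulrBr normrM ger0_norm //.
  rewrite mulrC -ltr_pdivlMr //; apply: le_lt_trans hw.
  by rewrite -cReN -cReD cRe_le.
have cg : circts (fun w => (2 * cRe (h w))%:C%C * (w / (w - z) ^+ 2)) r.
  by move=> t; apply: ccontM; [exact: cR|exact: ck].
rewrite (cd_real_part dh zr rr0); apply: (le_trans (cmod_cmean cg)).
have -> : 4 * r / (r - cmod z) ^+ 2 * rmean r (fun w => `|cRe (h w)|) =
  2 * rmean r (fun w => (2 * (r / (r - cmod z) ^+ 2)) * `|cRe (h w)|).
  rewrite rmeanZ; last by apply: circr_norm; exact: circr_Re.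
  by ring.
rewrite ler_pM2l //; apply: rmean_le.
- exact: circr_cmod.
- by apply: circrZ; apply: circr_norm; exact: circr_Re.
move=> t; rewrite cmodM cmod_real normrM ger0_norm // -mulrA.
rewrite -[leLHS]mulrA ler_pM2l // [leRHS]mulrC ler_wpM2l // cmodf cmod_circle gtr0_norm // ler_pM2l //.
have s0 : 0 < r - cmod z by rewrite subr_gt0.
rewrite cmodX lef_pV2 ?posrE ?exprn_gt0 ?cmod_gt0 ?circle_neq //.
by rewrite lerXn2r ?nnegrE ?cmod_ge0 ?(ltW s0) // circle_dist.
Qed.

Lemma logder_nonvanish u r0 r z : (forall w, cmod w < r0 -> cdif u w /\ u w != 0) ->
  cmod z < r -> r < r0 ->
  cmod (cd u z / u z) <= 4 * r / (r - cmod z) ^+ 2 * rmean r (fun w => `|ln (cmod (u w))|).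
Proof.
move=> hu zr rr0; have r00 : 0 < r0 := le_lt_trans (cmod_ge0 _) (lt_trans zr rr0).
have rp := le_lt_trans (cmod_ge0 _) zr.
have [h hh] := log_nonvanish r00 hu.
have dh w : cmod w < r0 -> cdif h w by move=> /hh[? _]; eexists; eassumption.
have -> : cd u z / u z = cd h z by rewrite (cd_cder (hh z _).1) // (lt_trans zr).
rewrite (_ : rmean r (fun w => `|ln (cmod (u w))|) = rmean r (fun w => `|cRe (h w)|)).
  exact: cd_real_bound dh zr rr0.
by apply: rmean_ext => t; rewrite (hh _ _).2 // cmod_circle gtr0_norm.
Qed.

End Primitives.

(** * Blaschke products, Jensen's formula and the bound for g'/g *)

Section Blaschke.
Context {R : realType}.
Notation C := R[i].
Implicit Types (u h g : C -> C) (z w v a : C) (r t : R) (s : seq C) (o : C -> int).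

Definition blaschke r a w : C := r%:C%C * (w - a) / ((r ^+ 2)%:C%C - a^*%C * w).

Lemma blaschke_cdif r a w : cmod a < r -> cmod w < 2 * r - cmod a -> cdif (blaschke r a) w.
Proof.
move=> ar wr; apply: cdifM; first by apply: cdifM; [exact: cdif_cst|exact: cdif_subr].
apply: cdifV; first exact: blaschke_nz.
apply: cdifD; first exact: cdif_cst.
by apply: cdifN; apply: cdifM; [exact: cdif_cst|exact: cdif_id].
Qed.

Lemma blaschke_holo r a w : cmod a < r -> cmod w < 2 * r - cmod a -> holo (blaschke r a) w.
Proof. by move=> ar wr; apply: cnearS (cnear_lt wr) => v; exact: blaschke_cdif. Qed.

Lemma blaschke_neq0 r a w : cmod a < r -> cmod w < 2 * r - cmod a -> w != a -> blaschke r a w != 0.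
Proof.
move=> ar wr wa; rewrite mulf_neq0 ?invr_eq0 ?blaschke_nz // mulf_neq0 ?subr_eq0 //.
by rewrite -cmod_eq0 cmod_real normr_eq0 gt_eqF // (le_lt_trans (cmod_ge0 _) ar).
Qed.

Lemma blaschke_hord r a w : cmod a < r -> cmod w < 2 * r - cmod a ->
  hord (blaschke r a) w (w == a)%:Z.
Proof.
move=> ar wr; case: eqVneq => [wa|wa]; last first.
  by apply: hord0; [exact: blaschke_holo|exact: blaschke_neq0].
exists (fun w => r%:C%C / ((r ^+ 2)%:C%C - a^*%C * w)); split.
- apply: holoM; first exact: holo_cst.
  apply: holoV; first exact: blaschke_nz.
  apply: holoD; first exact: holo_cst.
  by apply: holoN; apply: holoM; [exact: holo_cst|exact: holo_id].
- rewrite mulf_neq0 ?invr_eq0 ?blaschke_nz //.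
  by rewrite -cmod_eq0 cmod_real normr_eq0 gt_eqF // (le_lt_trans (cmod_ge0 _) ar).
- by apply: cnearW => v _; rewrite expr1z wa /blaschke -mulrA mulrCA mulrA.
Qed.

Lemma blaschke_circle r a t : cmod a < r -> cmod (blaschke r a (circle_pt r t)) = 1.
Proof.
move=> ar; have r0 := le_lt_trans (cmod_ge0 _) ar.
set w := circle_pt r t; have wa : w - a != 0 by exact: circle_neq.
have E : (r ^+ 2)%:C%C - a^*%C * w = w * (w - a)^*%C.
  by rewrite conjB -(circle_conj r t) -/w; ring.
rewrite /blaschke E cmodf !cmodM cmod_conj cmod_real gtr0_norm // cmod_circle gtr0_norm //.
by rewrite divff // mulf_neq0 ?cmod_eq0 // gt_eqF.
Qed.

(** The logarithmic derivative is 1/(z - a) + conj(a)/(r^2 - conj(a) z), and |a| (r - |z|) <= r^2 -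
    |a| |z| bounds the second term by 1/(r - |z|). *)
Lemma blaschke_logder r a z : cmod a < r -> cmod z < r -> z != a ->
  exists2 d, cder (blaschke r a) z d & cmod (d / blaschke r a z) <= (cmod (z - a))^-1 + (r - cmod z)^-1.
Proof.
move=> ar zr za; have r0 := le_lt_trans (cmod_ge0 _) ar.
have zr2 : cmod z < 2 * r - cmod a by lra.
have nz := blaschke_nz ar zr2; set q := (r ^+ 2)%:C%C - a^*%C * z in nz.
have rC : (r%:C%C : C) != 0 by rewrite -cmod_eq0 cmod_real normr_eq0 gt_eqF.
have d1 : cder (fun w => r%:C%C * (w - a)) z r%:C%C.
  have := cderM (cder_cst r%:C%C z) (cderD (cder_id z) (cder_cst (- a) z)).
  by rewrite mul0r add0r addr0 mulr1.
have d2 : cder (fun w => (r ^+ 2)%:C%C - a^*%C * w) z (- a^*%C).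
  have := cderD (cder_cst (r ^+ 2)%:C%C z) (cderM (cder_cst (- a^*%C) z) (cder_id z)).
  rewrite mul0r !add0r mulr1; apply: cder_eq; apply: cnearW => w; by rewrite mulNr.
have d3 := cderM d1 (@cderV R (fun w => (r ^+ 2)%:C%C - a^*%C * w) z _ nz d2).
eexists; first exact: d3.
have za0 : z - a != 0 by rewrite subr_eq0.
rewrite -/q [X in cmod X](_ : _ = (z - a)^-1 + a^*%C / q); last first.
  by rewrite /blaschke -/q; field; rewrite rC za0 nz.
apply: (le_trans (cmodD _ _)); rewrite cmodV lerD2l cmodf cmod_conj.
rewrite ler_pdivrMr ?cmod_gt0 // mulrC ler_pdivlMr ?subr_gt0 //.
have q1 : r ^+ 2 - cmod a * cmod z <= cmod q.
  apply: le_trans (cmod_leB _ _); rewrite cmodM cmod_conj cmod_real ger0_norm ?sqr_ge0 //.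
have q2 : cmod a * (r - cmod z) <= r * (r - cmod z) by rewrite ler_wpM2r ?subr_ge0 ?ltW.
have q3 : cmod a * cmod z <= r * cmod z by rewrite ler_wpM2r ?cmod_ge0 ?ltW.
by apply: le_trans q1; rewrite expr2; lra.
Qed.

Definition blprod r s o w : C := \prod_(a <- s) blaschke r a w ^ o a.

Lemma sum_at s x o : uniq s -> \sum_(a <- s) (x == a)%:Z * o a = if x \in s then o x else 0.
Proof.
elim: s => [|a s ih] /=; first by rewrite big_nil.
move=> /andP[na us]; rewrite big_cons inE ih //; case: eqVneq => [->|_] /=.
  by rewrite (negbTE na) mul1r addr0.
by rewrite mul0r add0r.
Qed.

Lemma prod_at (s : seq C) x (F : C -> C) : uniq s ->
  \prod_(a <- s) (if a == x then F a else 1) = if x \in s then F x else 1.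
Proof.
elim: s => [|a s ih] /=; first by rewrite big_nil.
move=> /andP[na us]; rewrite big_cons inE ih // eq_sym; case: eqVneq => [->|_] /=.
  by rewrite (negbTE na) mulr1.
by rewrite mul1r.
Qed.

Lemma blprod_hord r s o w : uniq s -> (forall a, a \in s -> cmod a < r /\ cmod w < 2 * r - cmod a) ->
  hord (blprod r s o) w (if w \in s then o w else 0).
Proof.
move=> us hs; rewrite -sum_at //; apply: hord_prod => a /hs[h1 h2].
by apply: hordXz; exact: blaschke_hord.
Qed.

Lemma exprz_cder u z d (n : int) : u z != 0 -> cder u z d ->
  cder (fun w => u w ^ n) z (n%:~R * (u z ^ n / u z) * d).
Proof.
move=> uz hd; have := cder_comp hd (@cder_exprz R 0 (u z) n uz).
by rewrite subr0; apply: cder_eq; apply: cnearW => w; rewrite subr0.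
Qed.

Lemma blprod_logder r s o z : cmod z < r -> (forall a, a \in s -> cmod a < r) -> z \notin s ->
  exists2 d, cder (blprod r s o) z d &
    cmod (d / blprod r s o z) <= \sum_(a <- s) `|o a|%:~R * ((cmod (z - a))^-1 + (r - cmod z)^-1).
Proof.
move=> zr; elim: s => [|a s ih] hs zs.
  exists 0; last by rewrite mul0r cmod0 big_nil.
  by apply: (cder_eq (f := fun _ => 1)); [apply: cnearW => w; rewrite /blprod big_nil|exact: cder_cst].
move: zs; rewrite inE negb_or => /andP[za zs].
have ar : cmod a < r by apply: hs; rewrite inE eqxx.
have [d hd bd] := ih (fun b bs => hs b (mem_behead (s := a :: s) bs)) zs.
have [e he be] := blaschke_logder ar zr za.
have zr2 : cmod z < 2 * r - cmod a by lra.
have bn := blaschke_neq0 ar zr2 za.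
have pn : blprod r s o z != 0.
  rewrite /blprod prodf_seq_neq0; apply/allP => b bs /=.
  have br : cmod b < r by apply: hs; rewrite inE bs orbT.
  apply: expfz_neq0; apply: blaschke_neq0 => //; first by lra.
  by apply: contra zs => /eqP ->.
have h := cderM (exprz_cder (o a) bn he) hd.
eexists; first by apply: cder_eq h; apply: cnearW => w; rewrite /blprod big_cons.
have -> : blprod r (a :: s) o z = blaschke r a z ^ o a * blprod r s o z by rewrite /blprod big_cons.
have bon : blaschke r a z ^ o a != 0 by rewrite expfz_neq0.
rewrite [X in cmod X](_ : _ = (o a)%:~R * (e / blaschke r a z) + d / blprod r s o z); last first.
  by field; rewrite bn pn bon.
rewrite big_cons; apply: (le_trans (cmodD _ _)); apply: lerD => //.
rewrite cmodM; apply: ler_pM; rewrite ?cmod_ge0 //.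
have -> : ((o a)%:~R : C) = ((o a)%:~R : R)%:C%C by rewrite rmorph_int.
by rewrite cmod_real intr_norm.
Qed.

Lemma blprod_circle r s o t : (forall a, a \in s -> cmod a < r) -> cmod (blprod r s o (circle_pt r t)) = 1.
Proof.
move=> hs; rewrite /blprod cmod_prod big_seq big1 // => a /hs ar.
by rewrite cmodXz blaschke_circle // exp1rz.
Qed.

(** Room beyond the circle of radius [r] in which all Blaschke factors with zeros in [s] remain
    regular, so that the results for nonvanishing functions apply on that circle. *)
Lemma ex_radius r r0 s : r < r0 -> (forall a, a \in s -> cmod a < r) ->
  exists r1, [/\ r < r1, r1 <= r0 & forall a, a \in s -> r1 <= 2 * r - cmod a].
Proof.
move=> rr0; elim: s => [|a s ih] hs; first by exists r0.
have [r1 [h1 h2 h3]] := ih (fun b bs => hs b (mem_behead (s := a :: s) bs)).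
have ar : cmod a < r by apply: hs; rewrite inE eqxx.
exists (Num.min r1 (2 * r - cmod a)); split.
- by rewrite lt_min h1 /=; lra.
- by rewrite ge_min h2.
- move=> b; rewrite inE => /orP[/eqP ->|/h3 hb]; first by rewrite ge_min lexx orbT.
  by rewrite ge_min hb.
Qed.

(** Dividing by the Blaschke product with the same orders leaves order 0 at every point;
    [regularize] then supplies the values of [u] at the zeros and poles. *)
Lemma blaschke_factor g s o r r0 : uniq s -> (forall a, a \in s -> cmod a < r) -> r < r0 ->
  (forall w, cmod w < r0 -> hord g w (o w)) ->
  (forall w, cmod w < r0 -> w \notin s -> o w = 0) ->
  exists u r1, [/\ r < r1, r1 <= r0, (forall a, a \in s -> r1 <= 2 * r - cmod a),
    (forall w, cmod w < r1 -> cdif u w /\ u w != 0) &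
    forall w, cmod w < r1 -> cnear w (fun x => x != w -> g x = blprod r s o x * u x)].
Proof.
move=> us hs rr0 hg ho; have [r1 [h1 h2 h3]] := ex_radius rr0 hs.
have hb w : cmod w < r1 -> hord (blprod r s o) w (if w \in s then o w else 0).
  move=> wr; apply: blprod_hord => // a as_; split; first exact: hs.
  exact: lt_le_trans wr (h3 a as_).
have hk w : cmod w < r1 -> hord (fun v => g v / blprod r s o v) w 0.
  move=> wr; have wr0 := lt_le_trans wr h2.
  have -> : 0 = o w - (if w \in s then o w else 0).
    by case: ifPn => [_|ws]; rewrite ?subrr // subr0 ho.
  by apply: hordM; [exact: hg|apply: hordV; exact: hb].
have [u hu] : exists u, forall w, cmod w < r1 -> holo u w /\ cnear w (fun v => v != w -> g v / blprod r s o v = u v).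
  apply: (regularize (D := fun w => cmod w < r1)); first by move=> w; exact: cnear_lt.
  by move=> w /hk /hord0_holo[k [k1 k2 k3]]; exists k.
exists u, r1; split => // w wr; have [hw ew] := hu w wr.
  split; first exact: holo_cdif.
  have [k [k1 k2 k3]] := hord0_holo (hk w wr).
  have -> : u w = k w; last by [].
  apply: ccont_lim_eq; [exact: holo_cont|exact: holo_cont|].
  by apply: cnearS (cnearI ew k3) => v [e1 e2] vw; rewrite -e1 // e2.
apply: cnearS (cnearI ew (hord_regular (hb w wr))) => v [e1 e2] vw.
by rewrite -e1 // mulrC divfK //; case: (e2 vw).
Qed.

Lemma holo_expz f z (n : int) : f z != 0 -> holo f z -> holo (fun w => f w ^ n) z.
Proof.
move=> fz hf; case: n => j; first exact: holoX.
apply: (holo_eq (f := fun w => (f w ^+ j.+1)^-1)).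
  by apply: cnearW => w; rewrite NegzE -invr_expz.
by apply: holoV; [rewrite expf_neq0|exact: holoX].
Qed.

Lemma holo_prod s (F : C -> C -> C) z : (forall a, a \in s -> holo (F a) z) ->
  holo (fun w => \prod_(a <- s) F a w) z.
Proof.
elim: s => [|a s ih] h.
  by apply: (holo_eq (f := fun _ => 1)); [apply: cnearW => w; rewrite big_nil|exact: holo_cst].
apply: (holo_eq (f := fun w => F a w * \prod_(b <- s) F b w)).
  by apply: cnearW => w; rewrite big_cons.
apply: holoM; first by apply: h; rewrite inE eqxx.
by apply: ih => b bs; apply: h; rewrite inE bs orbT.
Qed.

Lemma factor_eq g u r s o w : (forall a, a \in s -> cmod a < r /\ cmod w < 2 * r - cmod a) ->
  w \notin s -> cdif u w -> regular g w ->
  cnear w (fun x => x != w -> g x = blprod r s o x * u x) -> g w = blprod r s o w * u w.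
Proof.
move=> hs ws du [/holo_cont cg _] e.
apply: (@ccont_lim_eq R g (fun v => blprod r s o v * u v) w) => //.
apply: ccontM; last exact: cdif_cont.
apply: holo_cont; apply: holo_prod => a as_; have [ar wr] := hs a as_.
apply: holo_expz; last exact: blaschke_holo.
by apply: blaschke_neq0 => //; apply: contraNneq ws => ->.
Qed.

(** The contribution of one simple point to the integrated counting function: the integral of dt/t
    from |a| to r, with ln r by convention for the origin. *)
Definition radial r a : R := if a == 0 then ln r else ln (r / cmod a).

Lemma lnXz (x : R) (n : int) : 0 < x -> ln (x ^ n) = n%:~R * ln x.
Proof.
move=> x0; case: n => n; first by rewrite -exprnP lnXn // mulr_natl.
rewrite NegzE -invr_expz -exprnP lnV ?posrE ?exprn_gt0 // lnXn // mulrNz mulNr.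
by rewrite -pmulrn mulr_natl.
Qed.

Lemma ln_prod (I : eqType) (s : seq I) (F : I -> R) : (forall i, i \in s -> 0 < F i) ->
  ln (\prod_(i <- s) F i) = \sum_(i <- s) ln (F i) /\ 0 < \prod_(i <- s) F i.
Proof.
elim: s => [|i s ih] h; first by rewrite !big_nil ln1 ltr01.
have [e p] := ih (fun j js => h j (mem_behead (s := i :: s) js)).
have ip : 0 < F i by apply: h; rewrite inE eqxx.
by rewrite !big_cons lnM ?posrE // e mulr_gt0.
Qed.

(** On the circle |g| equals |u|, and the mean of ln|u| is ln|u(0)|. The value u(0) is then computed
    from the leading Laurent coefficient [g0 0] and the Blaschke product at 0. *)
Lemma jensen_formula g g0 s o r r0 : 0 < r -> r < r0 -> uniq s ->
  (forall a, a \in s -> cmod a < r) ->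
  (forall w, cmod w < r0 -> hord g w (o w)) ->
  (forall w, cmod w < r0 -> w \notin s -> o w = 0) ->
  (forall t, regular g (circle_pt r t)) ->
  holo g0 0 -> g0 0 != 0 -> cnear 0 (fun w => w != 0 -> g w = w ^ o 0 * g0 w) ->
  rmean r (fun w => ln (cmod (g w))) = ln (cmod (g0 0)) + \sum_(a <- s) (o a)%:~R * radial r a.
Proof.
move=> rp rr0 us hs hg ho rg hg0 g00 eg0.
have [u [r1 [h1 h2 h3 h4 h5]]] := blaschke_factor us hs rr0 hg ho.
have hb w : cmod w < r1 -> hord (blprod r s o) w (if w \in s then o w else 0).
  move=> wr; apply: blprod_hord => // a as_; split; first exact: hs.
  exact: lt_le_trans wr (h3 a as_).
have E t : cmod (g (circle_pt r t)) = cmod (u (circle_pt r t)).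
  set w := circle_pt r t; have cw : cmod w = r by rewrite cmod_circle gtr0_norm.
  have wr : cmod w < r1 by rewrite cw.
  have -> : g w = blprod r s o w * u w; last by rewrite cmodM blprod_circle // mul1r.
  apply: factor_eq.
  - move=> a as_; have ar := hs _ as_; split=> //; rewrite cw; lra.
  - by apply/negP => /hs; rewrite cw ltxx.
  - by case: (h4 w wr).
  - exact: rg.
  - exact: h5.
rewrite (rmean_ext (psi := fun w => ln (cmod (u w)))); last by move=> t; rewrite E.
rewrite (jensen_nonvanish (r0 := r1)) ?(ltW rp) //.
have r10 : cmod (0 : C) < r1 by rewrite cmod0 (lt_trans rp).
(* The Blaschke product with the power of v belonging to the origin taken out; there the factor is
   v/r, which leaves 1/r. *)
pose K v := \prod_(a <- s) (if a == 0 then (r%:C%C)^-1 else blaschke r a v) ^ o a.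
have rC : (r%:C%C : C) != 0 by rewrite -cmod_eq0 cmod_real normr_eq0 gt_eqF.
have bK v : v != 0 -> blprod r s o v = v ^ o 0 * K v.
  move=> v0; rewrite /blprod (eq_bigr (fun a => (if a == 0 then v ^ o a else 1) *
      (if a == 0 then (r%:C%C)^-1 else blaschke r a v) ^ o a)); last first.
    move=> a _; case: eqVneq => [->|_]; last by rewrite mul1r.
    rewrite -expfzMl; congr (_ ^ _); rewrite /blaschke subr0 conjc0 mul0r subr0 rmorphXn /=.
    by field.
  rewrite big_split /= prod_at //; congr (_ * _); case: ifPn => // n0.
  by rewrite ho ?cmod0 ?(lt_trans rp) // expr0z.
have gK : g0 0 = K 0 * u 0.
  apply: (@ccont_lim_eq R g0 (fun v => K v * u v) 0); first exact: holo_cont.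
    apply: ccontM; last by apply: cdif_cont; case: (h4 0 r10).
    apply: holo_cont; rewrite /K; apply: holo_prod => a as_; have ar := hs _ as_.
    have wr2 : cmod (0 : C) < 2 * r - cmod a by rewrite cmod0; lra.
    apply: holo_expz.
      have [_|a0] := eqVneq a 0; first by rewrite invr_eq0.
      by apply: blaschke_neq0 => //; rewrite eq_sym.
    have [_|a0] := eqVneq a 0; first exact: holo_cst.
    exact: blaschke_holo.
  apply: cnearS (cnearI eg0 (h5 0 r10)) => v [e1 e2] v0.
  by apply: (mulfI (expfz_neq0 (o 0) v0)); rewrite -e1 // e2 // bK // mulrA.
have lK : ln (cmod (K 0)) = - \sum_(a <- s) (o a)%:~R * radial r a /\ 0 < cmod (K 0).
  rewrite /K cmod_prod.
  have pos a : a \in s -> 0 < cmod ((if a == 0 then (r%:C%C)^-1 else blaschke r a 0) ^ o a).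
    move=> as_; have ar := hs _ as_; rewrite cmodXz exprz_gt0 // cmod_gt0.
    have [_|a0] := eqVneq a 0; first by rewrite invr_eq0.
    by apply: blaschke_neq0 => //; [rewrite cmod0; lra|rewrite eq_sym].
  have [e p] := ln_prod pos; split => //; rewrite e -sumrN !big_seq; apply: eq_bigr => a as_.
  have ar := hs _ as_; rewrite cmodXz /radial; case: eqVneq => a0.
    rewrite lnXz ?cmod_gt0 ?invr_eq0 // cmodV cmod_real gtr0_norm // lnV ?posrE //.
    by rewrite mulrN.
  have a1 : 0 < cmod a by rewrite cmod_gt0.
  have -> : cmod (blaschke r a 0) = cmod a / r.
    rewrite /blaschke mulr0 subr0 sub0r cmodf cmodM cmodN !cmod_real ger0_norm ?(ltW rp) //.
    by rewrite ger0_norm ?sqr_ge0 //; field; rewrite gt_eqF.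
  by rewrite lnXz ?divr_gt0 // -mulrN -lnV ?posrE ?divr_gt0 // invf_div.
have u00 : 0 < cmod (u 0) by rewrite cmod_gt0; case: (h4 0 r10).
rewrite gK cmodM lnM ?posrE //; last by case: lK.
by case: lK => -> _; rewrite addrAC addNr add0r.
Qed.

(** The logarithmic derivative of a Blaschke product times [u] is the sum of theirs. The mean for
    [u] is rewritten with [g], because the product has modulus 1 on the circle. *)
Lemma logder_bound g s o r r0 z : r < r0 -> uniq s ->
  (forall a, a \in s -> cmod a < r) ->
  (forall w, cmod w < r0 -> hord g w (o w)) ->
  (forall w, cmod w < r0 -> w \notin s -> o w = 0) ->
  (forall t, regular g (circle_pt r t)) ->
  cmod z < r -> z \notin s -> regular g z ->
  cmod (cd g z / g z) <= 4 * r / (r - cmod z) ^+ 2 * rmean r (fun w => `|ln (cmod (g w))|) +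
    \sum_(a <- s) `|o a|%:~R * ((cmod (z - a))^-1 + (r - cmod z)^-1).
Proof.
move=> rr0 us hs hg ho rg zr zs rz; have rp := le_lt_trans (cmod_ge0 _) zr.
have [u [r1 [h1 h2 h3 h4 h5]]] := blaschke_factor us hs rr0 hg ho.
have E t : cmod (g (circle_pt r t)) = cmod (u (circle_pt r t)).
  set w := circle_pt r t; have cw : cmod w = r by rewrite cmod_circle gtr0_norm.
  have wr : cmod w < r1 by rewrite cw.
  have -> : g w = blprod r s o w * u w; last by rewrite cmodM blprod_circle // mul1r.
  apply: factor_eq.
  - move=> a as_; have ar := hs _ as_; split=> //; rewrite cw; lra.
  - by apply/negP => /hs; rewrite cw ltxx.
  - by case: (h4 w wr).
  - exact: rg.
  - exact: h5.
have zr1 := lt_trans zr h1; have [du u0] := h4 z zr1.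
have ez : g z = blprod r s o z * u z.
  apply: factor_eq => //; last exact: h5.
  by move=> a as_; have ar := hs _ as_; split=> //; lra.
have en : cnear z (fun x => blprod r s o x * u x = g x).
  apply: cnearS (h5 z zr1) => x e; have [->|xz] := eqVneq x z; first by rewrite ez.
  by rewrite e.
have [d hd bd] := blprod_logder o zr hs zs.
have bz : blprod r s o z != 0.
  by apply: contraTneq (proj2 rz) => b0; rewrite ez b0 mul0r eqxx.
have -> : cd g z = d * u z + blprod r s o z * cd u z.
  by apply: cd_cder; apply: cder_eq en _; apply: cderM hd (cder_cd du).
rewrite ez [X in cmod X](_ : _ = cd u z / u z + d / blprod r s o z); last first.
  by field; rewrite bz u0.
apply: (le_trans (cmodD _ _)); apply: lerD => //.
rewrite (rmean_ext (psi := fun w => `|ln (cmod (u w))|)); last by move=> t; rewrite E.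
exact: logder_nonvanish h4 zr h1.
Qed.

End Blaschke.

(** * Counting functions and Jensen's formula *)

Section DiscreteSets.
Context {R : realType}.
Notation C := R[i].
Implicit Types (B : C -> Prop) (z w : C) (r : R).

Definition discrete B := forall z, cnear z (fun w => w != z -> ~ B w).

Lemma discreteU B1 B2 : discrete B1 -> discrete B2 -> discrete (fun z => B1 z \/ B2 z).
Proof. by move=> h1 h2 z; apply: cnearS (cnearI (h1 z) (h2 z)) => w [k1 k2] wz [/k1|/k2]; apply. Qed.

(** Lists for the four quarters are concatenated; in a small rectangle around a point, only that
    point can belong to [B]. *)
Lemma discrete_rect B (r : R) : 0 <= r -> discrete B ->
  exists s : seq C, forall x y : R, - r <= x <= r -> - r <= y <= r -> B (x +i* y)%C -> (x +i* y)%C \in s.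
Proof.
move=> r0 dB.
pose P a b c d := exists s : seq C, forall x y : R, a <= x <= b -> c <= y <= d -> B (x +i* y)%C -> (x +i* y)%C \in s.
have rr : - r <= r by rewrite (le_trans _ r0) // oppr_le0.
apply: (@rect_bisection _ P (- r) r (- r) r rr rr) => [a b c d _ _ _ _ _ _ [[s1 h1] [s2 h2] [s3 h3] [s4 h4]]|x y _ _].
  exists (s1 ++ s2 ++ s3 ++ s4) => x y /andP[x1 x2] /andP[y1 y2] Bxy; rewrite !mem_cat.
  case: (leP x ((a + b) / 2)) => [l1|/ltW l1]; case: (leP y ((c + d) / 2)) => [l2|/ltW l2].
  - by rewrite h1 ?x1 ?y1.
  - by rewrite h3 ?x1 ?y2 ?l2 ?orbT.
  - by rewrite h2 ?x2 ?y1 ?l1 ?orbT.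
  - by rewrite h4 ?x2 ?y2 ?l1 ?l2 ?orbT.
have [d d0 hd] := dB (x +i* y)%C; exists (d / 2); first by rewrite divr_gt0.
move=> a b c e [_ a1 a2 _] [_ c1 c2 _] ab ce; exists [:: (x +i* y)%C] => x' y' /andP[? ?] /andP[? ?] Bxy.
rewrite inE; apply: contraPT Bxy => ne; apply: hd ne.
apply: (le_lt_trans (cmod_le_ReIm _)); rewrite /= [d]splitr; apply: ltrD; rewrite ltr_norml; apply/andP; split; lra.
Qed.

Lemma discrete_finite B (r : R) : discrete B ->
  exists2 s : seq C, uniq s & forall z, z \in s <-> cmod z <= r /\ B z.
Proof.
move=> dB; have [r0|r0] := leP 0 r; last first.
  by exists [::] => // z; split => // -[zr _]; have := le_lt_trans (le_trans (cmod_ge0 z) zr) r0; rewrite ltxx.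
have [s hs] := discrete_rect r0 dB.
exists [seq z <- undup s | `[< cmod z <= r /\ B z >]]; first by rewrite filter_uniq ?undup_uniq.
move=> z; rewrite mem_filter mem_undup; split => [/andP[/asboolP] //|[zr Bz]].
apply/andP; split; first exact/asboolP.
case: z zr Bz => x y zr Bz; apply: hs => //; rewrite -ler_norml.
  exact: le_trans (cRe_le (x +i* y)%C) zr.
exact: le_trans (cIm_le (x +i* y)%C) zr.
Qed.

Definition free_radius B r := 0 < r /\ forall z, cmod z = r -> ~ B z.

Lemma avoid_seq (s : seq R) (x y : R) : x < y ->
  exists x' y', [/\ x <= x', x' < y', y' <= y & forall t, x' < t < y' -> t \notin s].
Proof.
elim: s x y => [|c s ih] x y xy; first by exists x, y.
have [x1 [y1 [h1 h2 h3 h4]]] := ih x y xy.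
have [cm|cm] := leP c ((x1 + y1) / 2).
  exists ((x1 + y1) / 2), y1; split => //; try lra.
  move=> t /andP[t1 t2]; rewrite inE negb_or h4 ?andbT; last by apply/andP; split; lra.
  by rewrite gt_eqF // (le_lt_trans cm).
exists x1, ((x1 + y1) / 2); split => //; try lra.
move=> t /andP[t1 t2]; rewrite inE negb_or h4 ?andbT; last by apply/andP; split; lra.
by rewrite lt_eqF // (lt_trans t2).
Qed.

Lemma free_between B (x y : R) : discrete B -> 0 <= x -> x < y ->
  exists2 r, x < r < y & free_radius B r.
Proof.
move=> dB x0 xy; have [s _ hs] := discrete_finite y dB.
have [x1 [y1 [h1 h2 h3 h4]]] := avoid_seq (map (fun z : C => cmod z) s) xy.
pose r := (x1 + y1) / 2.
have r1 : x1 < r by rewrite /r; lra.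
have r2 : r < y1 by rewrite /r; lra.
exists r; first by rewrite (le_lt_trans h1) //= (lt_le_trans r2).
split; first exact: le_lt_trans x0 (le_lt_trans h1 r1).
move=> z zr Bz; have : r \notin map (fun z : C => cmod z) s by apply: h4; rewrite r1.
move/negP; apply; rewrite -zr; apply: map_f; apply/hs; split => //.
by rewrite zr (le_trans (ltW r2)).
Qed.

(** Only finitely many points of [B] have modulus at most r + 1, so those beyond the circle stay at
    a positive distance. This gives the slightly larger disc demanded by Jensen's formula. *)
Lemma free_gap B r : discrete B -> free_radius B r ->
  exists2 r0, r < r0 & forall z, r <= cmod z -> cmod z < r0 -> ~ B z.
Proof.
move=> dB [rp fr]; have [s _ hs] := discrete_finite (r + 1) dB.
have [r0 [h1 h2 h3]] : exists r0, [/\ r < r0, r0 <= r + 1 & forall z, z \in s -> r < cmod z -> r0 <= cmod z].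
  elim: (s) => [|a l [r0 [h1 h2 h3]]]; first by exists (r + 1); split => //; rewrite ltrDl.
  have [ra|ar] := ltP r (cmod a).
    exists (Num.min r0 (cmod a)); rewrite lt_min h1 ra ge_min h2; split => // z.
    rewrite inE => /orP[/eqP ->|zl] rz; first by rewrite ge_min lexx orbT.
    by rewrite ge_min h3.
  exists r0; split => // z; rewrite inE => /orP[/eqP ->|zl] rz; last exact: h3.
  by have := lt_le_trans rz ar; rewrite ltxx.
exists r0 => // z zr zr0 Bz; have zs : z \in s.
  by apply/hs; split => //; rewrite ltW // (lt_le_trans zr0).
move: zr; rewrite le_eqVlt => /orP[/eqP rz|rz]; first by apply: (fr z).
by have := le_lt_trans (h3 z zs rz) zr0; rewrite ltxx.
Qed.

(** The radii to be avoided. For a discrete [B] they form a countable set, hence an exceptional set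
    of measure 0. *)
Definition nonfree B : set R := [set r | exists2 z, B z & cmod z = r].

Lemma nonfree_countable B : discrete B -> countable (nonfree B).
Proof.
move=> dB; have h n := discrete_finite (n%:R : R) dB.
pose S n : set R := [set` map (fun z : C => cmod z) (s2val (cid2 (h n)))].
have : countable (\bigcup_(n in [set: nat]) S n).
  apply: bigcup_countable; first exact: countableP.
  by move=> n _; apply: finite_set_countable; exact: finite_seq.
apply: sub_countable; apply: subset_card_le => r [z Bz zr].
exists (Num.bound (cmod z)) => //; rewrite /S /= -zr; apply: map_f.
by apply/(s2valP' (cid2 (h _))); split => //; exact: ltW (archi_boundP (cmod_ge0 _)).
Qed.

End DiscreteSets.

(** * Integrated counting functions as finite sums *)

Section Counting.
Context {R : realType}.
Notation C := R[i].
Notation mu := (@lebesgue_measure R).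
Implicit Types (s : seq C) (r : R) (mult : C -> nat).

Lemma counting_funE mult s r t : uniq s -> (forall z, cmod z <= r -> mult z != 0%N -> z \in s) ->
  t <= r -> counting_fun mult t = \sum_(a <- s) (mult a)%:R * (nat_of_bool (cmod a <= t)%R)%:R.
Proof.
move=> us hs tr; rewrite /counting_fun.
rewrite (fsbigE [seq a <- s | cmod a <= t]); last 3 first.
- by rewrite filter_uniq.
- by move=> z; rewrite /= mem_filter => /andP[].
- move=> z /= zt; rewrite mem_filter zt /=; apply: contraNeq => mz; apply: hs.
    exact: le_trans zt tr.
  by apply: contra mz => /eqP ->.
rewrite big_filter_cond big_mkcond /=; apply: eq_bigr => a _.
case: (leP (cmod a) t) => at_; last by rewrite mulr0.
by rewrite mulr1 /= mem_set.
Qed.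

(** The share of a single point of modulus [rho] in n(t)/t; its integral is ln(r/rho). *)
Definition stepf (rho r : R) : R -> R := (fun t : R => t^-1) \_ `[rho, r].

Lemma inv_rcts (rho r : R) : 0 < rho -> rcts rho r (fun t : R => t^-1).
Proof.
by move=> r0 t /andP[t0 _]; apply: inv_continuous; rewrite gt_eqF // (lt_le_trans r0).
Qed.

Lemma stepf_integrable (rho r : R) : 0 < rho ->
  mu.-integrable `[0, r] (EFin \o stepf rho r).
Proof.
move=> r0; have h := rcts_integrable (@inv_rcts rho r r0).
rewrite /stepf -restrict_EFin; apply/integrable_restrict => //=.
by apply: integrableS h => //; first exact: measurableI.
Qed.

Lemma stepf_int (rho r : R) : 0 < rho -> rho <= r ->
  \int[mu]_(t in `[0, r]) stepf rho r t = ln (r / rho).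
Proof.
move=> r0 rr; rewrite /stepf -Rintegral_mkcondr.
have -> : `[0, r] `&` `[rho, r] = `[rho, r]%classic.
  apply/seteqP; split => x /=; rewrite !in_itv /=; first by case.
  by move=> /andP[h1 h2]; split; apply/andP; split => //; exact: le_trans (ltW r0) h1.
rewrite -rintE ln_div ?posrE ?(lt_le_trans r0) //.
apply: (@rint_ftc R rho r (fun t => t^-1) (@ln R)) => //.
- exact: inv_rcts.
- by move=> t /andP[t0 _]; apply: is_derive1_ln; exact: lt_le_trans r0 t0.
Qed.

(** The integral of the finite sum of steps is taken termwise. Through this formula, inequalities
    between counting functions become pointwise inequalities between multiplicities. *)
Lemma int_countingE mult s r : 0 < r -> uniq s ->
  (forall z, cmod z <= r -> mult z != 0%N -> z \in s) -> (forall a, a \in s -> cmod a <= r) ->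
  int_counting mult r = \sum_(a <- s) (mult a)%:R * radial r a.
Proof.
move=> r0 us hs hs'; rewrite /int_counting.
have c0 : counting_fun mult 0 = \sum_(a <- s) (mult a)%:R * (a == 0)%:R.
  rewrite (@counting_funE mult s r) ?(ltW r0) //; apply: eq_bigr => a _.
  by rewrite -cmod_eq0 eq_le cmod_ge0 andbT.
pose F a t := (mult a)%:R * (if a == 0 then 0 else stepf (cmod a) r t).
have E t : t \in `[0, r]%classic -> (counting_fun mult t - counting_fun mult 0) / t = \sum_(a <- s) F a t.
  rewrite inE /= in_itv /= => /andP[t0 tr].
  rewrite (@counting_funE mult s r) // c0 -sumrB mulr_suml; apply: eq_bigr => a _.
  rewrite /F -mulrBr -mulrA; congr (_ * _); case: eqVneq => [->|a0].
    by rewrite cmod0 t0 subrr mul0r.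
  rewrite subr0 /stepf patchE; case: (leP (cmod a) t) => at_.
    by rewrite mem_set /= ?in_itv /= ?at_ // mul1r.
  by rewrite mul0r memNset //= in_itv /= => /andP[]; rewrite leNgt at_.
rewrite (@eq_Rintegral _ _ _ mu _ (fun t => \sum_(a <- s) F a t)) //.
have iF a : mu.-integrable `[0, r] (EFin \o F a).
  have [az|a0] := eqVneq a 0.
    rewrite (_ : EFin \o F a = cst 0%E); first exact: integrable0.
    by apply/funext => t; rewrite /F /= az eqxx mulr0.
  have a1 : 0 < cmod a by rewrite cmod_gt0.
  rewrite (_ : EFin \o F a = (fun t => ((mult a)%:R)%:E * (EFin \o stepf (cmod a) r) t)%E).
    by apply: integrableZl => //; exact: stepf_integrable.
  by apply/funext => t; rewrite /F /= (negbTE a0) EFinM.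
have IF a : a \in s -> \int[mu]_(t in `[0, r]) F a t = (mult a)%:R * (if a == 0 then 0 else ln (r / cmod a)).
  move=> as_; have [az|a0] := eqVneq a 0.
    rewrite (@eq_Rintegral _ _ _ mu _ (fun _ => 0)); last by move=> t _; rewrite /F az eqxx mulr0.
    by rewrite Rintegral_cst // mul0r mulr0.
  have a1 : 0 < cmod a by rewrite cmod_gt0.
  rewrite (@eq_Rintegral _ _ _ mu _ (fun t => (mult a)%:R * stepf (cmod a) r t)); last by move=> t _; rewrite /F (negbTE a0).
  by rewrite RintegralZl ?stepf_int ?hs' //; exact: stepf_integrable.
have IS l : mu.-integrable `[0, r] (EFin \o (fun t => \sum_(a <- l) F a t)) /\
    \int[mu]_(t in `[0, r]) (\sum_(a <- l) F a t) = \sum_(a <- l) \int[mu]_(t in `[0, r]) F a t.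
  elim: l => [|a l [i1 i2]].
    rewrite big_nil; split.
      rewrite (_ : EFin \o _ = cst 0%E); first exact: integrable0.
      by apply/funext => t; rewrite /= big_nil.
    rewrite (@eq_Rintegral _ _ _ mu _ (fun _ => 0)); last by move=> t _; rewrite big_nil.
    by rewrite Rintegral_cst // mul0r.
  split.
    rewrite (_ : EFin \o _ = ((EFin \o F a) \+ (EFin \o (fun t => (\sum_(b <- l) F b t)%R)))%E).
      exact: integrableD.
    by apply/funext => t; rewrite /= big_cons EFinD.
  rewrite big_cons (@eq_Rintegral _ _ _ mu _ (fun t => F a t + \sum_(b <- l) F b t)); last by move=> t _; rewrite big_cons.
  by rewrite RintegralD // i2.
rewrite (IS s).2 c0 mulr_suml -big_split /= !big_seq; apply: eq_bigr => a as_.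
rewrite IF // /radial -mulrA -mulrDr; congr (_ * _).
by case: eqVneq => _; rewrite ?add0r ?mul1r // mul0r addr0.
Qed.

(** The origin has weight ln r, so 1 <= r is what makes all weights nonnegative; the same condition
    accompanies the comparisons of counting functions below. *)
Lemma radial_ge0 r a : 1 <= r -> cmod a <= r -> 0 <= radial r a.
Proof.
move=> r1 ar; rewrite /radial; case: eqVneq => a0; first exact: ln_ge0.
by apply: ln_ge0; rewrite ler_pdivlMr ?mul1r // cmod_gt0.
Qed.

End Counting.

(** * The positive part of the logarithm *)

Section LogPlus.
Context {R : realType}.
Implicit Types x y : R.

Lemma log_plus_ge0 x : 0 <= log_plus x.
Proof. by rewrite /log_plus le_max lexx. Qed.

Lemma log_plus_ge x : ln x <= log_plus x.
Proof. by rewrite /log_plus le_max lexx orbT. Qed.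

Lemma log_plus_small x : x <= 1 -> log_plus x = 0.
Proof. by move=> x1; rewrite /log_plus; apply/max_idPl; exact: ln_le0. Qed.

Lemma log_plus_big x : 1 <= x -> log_plus x = ln x.
Proof. by move=> x1; rewrite /log_plus; apply/max_idPr; exact: ln_ge0. Qed.

Lemma log_plus_le x y : x <= y -> log_plus x <= log_plus y.
Proof.
move=> xy; have [x1|/ltW x1] := leP x 1; first by rewrite log_plus_small ?log_plus_ge0.
have x0 : 0 < x by rewrite (lt_le_trans _ x1).
rewrite log_plus_big // log_plus_big ?(le_trans x1) //.
by rewrite ler_ln ?posrE // (lt_le_trans x0).
Qed.

Lemma log_plus_ln x : 0 < x -> ln x = log_plus x - log_plus x^-1 /\ `|ln x| = log_plus x + log_plus x^-1.
Proof.
move=> x0; have [x1|/ltW x1] := leP x 1.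
  have i1 : 1 <= x^-1 by rewrite invf_ge1.
  rewrite (log_plus_small x1) (log_plus_big i1) lnV ?posrE // opprK !add0r; split => //.
  by rewrite ler0_norm // ln_le0.
have i1 : x^-1 <= 1 by rewrite invf_le1.
by rewrite (log_plus_small i1) (log_plus_big x1) subr0 addr0 ger0_norm // ln_ge0.
Qed.

Lemma log_plusM x y : 0 <= x -> 0 <= y -> log_plus (x * y) <= log_plus x + log_plus y.
Proof.
rewrite le_eqVlt => /orP[/eqP <- _|x0].
  by rewrite mul0r log_plus_small // addr_ge0 ?log_plus_ge0.
rewrite le_eqVlt => /orP[/eqP <-|y0].
  by rewrite mulr0 log_plus_small // addr_ge0 ?log_plus_ge0.
rewrite {1}/log_plus ge_max addr_ge0 ?log_plus_ge0 //=.
by rewrite lnM ?posrE // lerD ?log_plus_ge.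
Qed.

Lemma log_plusX x n : 0 <= x -> log_plus (x ^+ n) <= n%:R * log_plus x.
Proof.
move=> x0; elim: n => [|n ih]; first by rewrite expr0 mul0r log_plus_small.
rewrite exprS -addn1 natrD mulrDl mul1r [leRHS]addrC.
apply: le_trans (log_plusM x0 (exprn_ge0 _ x0)) _; exact: lerD.
Qed.

Lemma log_plusD x y : 0 <= x -> 0 <= y -> log_plus (x + y) <= log_plus x + log_plus y + ln 2.
Proof.
move=> x0 y0; have l2 : 0 <= ln 2 :> R by rewrite ln_ge0 // ler1n.
have [xy|/ltW xy] := leP x y.
  apply: le_trans (log_plus_le (_ : x + y <= 2 * y)) _; first by lra.
  apply: le_trans (log_plusM _ y0) _ => //; rewrite log_plus_big ?ler1n //.
  by rewrite addrC lerD2r lerDr log_plus_ge0.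
apply: le_trans (log_plus_le (_ : x + y <= 2 * x)) _; first by lra.
apply: le_trans (log_plusM _ x0) _ => //; rewrite log_plus_big ?ler1n //.
by rewrite addrC lerD2r lerDl log_plus_ge0.
Qed.

Lemma log_plus_cvg x : {for x, continuous (@log_plus R)}.
Proof.
have [x1|x1] := ltP x 1.
  apply/cvgrPdist_lt => e e0; apply/near_dist; exists (1 - x); first by rewrite subr_gt0.
  move=> y hy; have y1 : y <= 1 by move: hy; rewrite ltr_norml => /andP[]; lra.
  by rewrite !log_plus_small ?(ltW x1) // subrr normr0.
have x0 : 0 < x by rewrite (lt_le_trans _ x1).
rewrite (_ : @log_plus R = ((fun _ : R => 0 : R^o) \max (@ln R : R -> R^o))) //.
apply: continuous_max; first exact: cvg_cst.
exact: continuous_ln.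
Qed.

Lemma expR_log_plus x : 0 <= x -> x <= expR (log_plus x).
Proof.
rewrite le_eqVlt => /orP[/eqP <-|x0]; first exact: expR_ge0.
by rewrite -{1}(lnK (x := x)) ?posrE // ler_expR log_plus_ge.
Qed.

End LogPlus.

Section IntCounting.
Context {R : realType}.
Notation C := R[i].
Implicit Types (mult : C -> nat) (r : R).

Definition discrete_mult mult := discrete (fun z => mult z != 0%N).

Lemma discreteS (B1 B2 : C -> Prop) : (forall z, B1 z -> B2 z) -> discrete B2 -> discrete B1.
Proof. by move=> s h z; apply: cnearS (h z) => w k wz /s; exact: k. Qed.

Lemma discrete0 : discrete (fun _ : C => False).
Proof. by move=> z; apply: cnearW => w _ []. Qed.

(** One list serves all multiplicities supported in [B], so that several counting functions are
    compared as sums over the same points. *)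
Lemma int_counting_list B r : 0 < r -> discrete B ->
  exists s : seq C, [/\ uniq s, (forall a, a \in s <-> cmod a <= r /\ B a) & forall mult, (forall z, mult z != 0%N -> B z) ->
    int_counting mult r = \sum_(a <- s) (mult a)%:R * radial r a].
Proof.
move=> r0 dB; have [s us hs] := discrete_finite r dB; exists s; split => //.
move=> mult hm; apply: int_countingE => //.
  by move=> z zr /hm Bz; apply/hs.
by move=> a /hs[].
Qed.

Lemma int_counting_le m1 m2 r : discrete_mult m2 -> (forall z, (m1 z <= m2 z)%N) -> 1 <= r ->
  int_counting m1 r <= int_counting m2 r.
Proof.
move=> d2 h r1; have r0 : 0 < r by rewrite (lt_le_trans _ r1).
have [s [us hs hc]] := int_counting_list r0 d2.
rewrite hc; last by move=> z; apply: contraNN => /eqP z0; rewrite -leqn0 -z0 h.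
rewrite hc // !big_seq; apply: ler_sum => a /hs[ar _].
by rewrite ler_wpM2r ?radial_ge0 // ler_nat.
Qed.

Lemma int_counting_ge0 m r : discrete_mult m -> 1 <= r -> 0 <= int_counting m r.
Proof.
move=> d r1; have r0 : 0 < r by rewrite (lt_le_trans _ r1).
have [s [us hs hc]] := int_counting_list r0 d.
rewrite hc // big_seq; apply: sumr_ge0 => a /hs[ar _].
by rewrite mulr_ge0 ?radial_ge0.
Qed.

Lemma int_countingD m1 m2 r : discrete_mult m1 -> discrete_mult m2 -> 0 < r ->
  int_counting (fun z => (m1 z + m2 z)%N) r = int_counting m1 r + int_counting m2 r.
Proof.
move=> d1 d2 r0; have [s [us hs hc]] := int_counting_list r0 (discreteU d1 d2).
rewrite !hc; first by rewrite -big_split; apply: eq_bigr => a _; rewrite natrD mulrDl.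
- by move=> z; right.
- by move=> z; left.
- by move=> z; rewrite addn_eq0 negb_and => /orP[]; [left|right].
Qed.

Lemma int_countingZ k m r : discrete_mult m -> 0 < r ->
  int_counting (fun z => (k * m z)%N) r = k%:R * int_counting m r.
Proof.
move=> d r0; have [s [us hs hc]] := int_counting_list r0 d.
rewrite !hc //; last by move=> z; rewrite muln_eq0 negb_or => /andP[].
by rewrite mulr_sumr; apply: eq_bigr => a _; rewrite natrM mulrA.
Qed.

Lemma discrete_multD m1 m2 : discrete_mult m1 -> discrete_mult m2 -> discrete_mult (fun z => (m1 z + m2 z)%N).
Proof.
move=> d1 d2; apply: discreteS (discreteU d1 d2) => z.
by rewrite addn_eq0 negb_and => /orP[]; [left|right].
Qed.

Lemma discrete_multZ k m : discrete_mult m -> discrete_mult (fun z => (k * m z)%N).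
Proof. by apply: discreteS => z; rewrite muln_eq0 negb_or => /andP[]. Qed.

Lemma discrete_reduced m : discrete_mult m -> discrete_mult (reduced_mult m).
Proof. by apply: discreteS => z; rewrite /reduced_mult -lt0n; case: (m z). Qed.

End IntCounting.

(** * Jensen's formula and the first fundamental theorem *)

Section Nevanlinna.
Context {R : realType}.
Notation C := R[i].
Implicit Types (f g h : C -> C) (z w : C) (r : R).

(* A point is bad if it is a zero, a pole, or carries a junk value; integrals over circles
   are only studied for the good radii, which avoid the bad points. *)
Definition bad g z := ~ regular g z.
Definition good g r := free_radius (bad g) r.

Lemma merNZ_discrete g : merNZ g -> discrete (bad g).
Proof. by move=> mg z; have [n /hord_regular hn] := mg z; apply: cnearS hn => w h wz; apply; exact: h. Qed.

Lemma good_regular g r z : good g r -> cmod z = r -> regular g z.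
Proof. by move=> [_ h] zr; apply: contrapT; exact: h. Qed.

Lemma good_circle g r t : good g r -> regular g (circle_pt r t).
Proof. by move=> gr; apply: (good_regular gr); case: gr => r0 _; rewrite cmod_circle gtr0_norm. Qed.

Lemma good_circts g r : good g r -> circts g r.
Proof. by move=> gr t; case: (good_circle t gr) => /holo_cont. Qed.

Lemma proximityE r g : proximity r g = rmean r (fun w => log_plus (cmod (g w))).
Proof. by rewrite /rmean rintE. Qed.

Lemma circr_log_plus g r : circts g r -> circr (fun w => log_plus (cmod (g w))) r.
Proof.
move=> cg t; apply: (@continuous_comp _ _ _ (fun t => cmod (g (circle_pt r t))) (@log_plus R)).
  exact: circr_cmod.
exact: log_plus_cvg.
Qed.

Lemma circtsV g r : good g r -> circts (fun w => (g w)^-1) r.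
Proof.
move=> gr t; have [hg g0] := good_circle t gr; apply: ccontV => //; exact: holo_cont.
Qed.

Lemma proximity_ge0 r g : 0 <= proximity r g.
Proof. by rewrite proximityE; apply: rmean_ge0 => t; exact: log_plus_ge0. Qed.

Lemma merNZV g : merNZ g -> merNZ (fun w => (g w)^-1).
Proof. by move=> mg z; have [n hn] := mg z; exists (- n); exact: hordV. Qed.

Lemma rmean_ln g r : good g r -> rmean r (fun w => ln (cmod (g w))) =
  proximity r g - proximity r (fun w => (g w)^-1) /\
  rmean r (fun w => `|ln (cmod (g w))|) = proximity r g + proximity r (fun w => (g w)^-1).
Proof.
move=> gr; have c1 := circr_log_plus (good_circts gr); have c2 := circr_log_plus (circtsV gr).
have E t : 0 < cmod (g (circle_pt r t)) by rewrite cmod_gt0; case: (good_circle t gr).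
rewrite !proximityE; split.
  rewrite -[X in _ - X]mul1r -mulNr -rmeanZ // -rmeanD //; last exact: circrZ.
  by apply: rmean_ext => t; rewrite cmodV mulN1r (log_plus_ln (E t)).1.
by rewrite -rmeanD //; apply: rmean_ext => t; rewrite cmodV (log_plus_ln (E t)).2.
Qed.

Definition zero_mult g := point_mult (fun _ => 0) g.

Lemma zero_multE g z : zero_mult g z = if order_at g z is Posz n then n else 0%N.
Proof. by rewrite /zero_mult /point_mult; under eq_fun do rewrite subr0. Qed.

Lemma order_mult g z : order_at g z = (zero_mult g z)%:Z - (pole_mult g z)%:Z.
Proof. by rewrite zero_multE /pole_mult; case: (order_at g z) => n; rewrite ?subr0 // sub0r NegzE. Qed.

Lemma abs_order_mult g z : absz (order_at g z) = (zero_mult g z + pole_mult g z)%N.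
Proof. by rewrite zero_multE /pole_mult; case: (order_at g z) => n; rewrite ?addn0. Qed.

Lemma regular_order g z : regular g z -> order_at g z = 0.
Proof. by move/regular_hord/hord_order_at. Qed.

Lemma zero_mult_bad g z : zero_mult g z != 0%N -> bad g z.
Proof. by move=> h /regular_order h2; move: h; rewrite zero_multE h2. Qed.

Lemma pole_mult_bad g z : pole_mult g z != 0%N -> bad g z.
Proof. by move=> h /regular_order h2; move: h; rewrite /pole_mult h2. Qed.

Lemma discrete_zero g : merNZ g -> discrete_mult (zero_mult g).
Proof. by move=> /merNZ_discrete; apply: discreteS => z; exact: zero_mult_bad. Qed.

Lemma discrete_pole g : merNZ g -> discrete_mult (pole_mult g).
Proof. by move=> /merNZ_discrete; apply: discreteS => z; exact: pole_mult_bad. Qed.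

Lemma N_pole_ge0 g r : merNZ g -> 1 <= r -> 0 <= N_pole r g.
Proof. by move=> mg r1; apply: int_counting_ge0 => //; exact: discrete_pole. Qed.

Lemma T_ge0 g r : merNZ g -> 1 <= r -> 0 <= nevanlinna_T r g.
Proof. by move=> mg r1; rewrite addr_ge0 ?proximity_ge0 ?N_pole_ge0. Qed.

Lemma order_atV g z : merNZ g -> order_at (fun w => (g w)^-1) z = - order_at g z.
Proof. by move=> mg; apply: hord_order_at; apply: hordV; exact: hord_ord. Qed.

Lemma pole_multV g z : merNZ g -> pole_mult (fun w => (g w)^-1) z = zero_mult g z.
Proof.
move=> mg; rewrite /pole_mult order_atV // zero_multE; by case: (order_at g z) => [[|n]|n].
Qed.

Lemma N_poleV g r : merNZ g -> N_pole r (fun w => (g w)^-1) = N_point r (fun _ => 0) g.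
Proof. by move=> mg; congr int_counting; apply/funext => z; exact: pole_multV. Qed.

(** The hypotheses concern only a disc: the formula is also applied to functions obtained by
    removing poles in a disc, which are controlled nowhere else. *)
Lemma jensen_local g r0 r o g0 : 0 < r -> r < r0 -> discrete (fun z => cmod z < r0 /\ bad g z) ->
  (forall z, r <= cmod z -> cmod z < r0 -> regular g z) ->
  (forall w, cmod w < r0 -> hord g w (o w)) ->
  holo g0 0 -> g0 0 != 0 -> cnear 0 (fun w => w != 0 -> g w = w ^ o 0 * g0 w) ->
  exists s, [/\ uniq s, (forall a, a \in s <-> cmod a <= r /\ bad g a) &
   rmean r (fun w => ln (cmod (g w))) = ln (cmod (g0 0)) + \sum_(a <- s) (o a)%:~R * radial r a].
Proof.
move=> rp rr0 dB rg ho hg0 g00 eg0; have [s us hs] := discrete_finite r dB.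
have hs' a : a \in s <-> cmod a <= r /\ bad g a.
  split => [/hs[h1 []] //|[h1 h2]]; apply/hs; do !split => //; exact: le_lt_trans h1 rr0.
exists s; split => //; apply: (jensen_formula (r0 := r0)) => //.
- move=> a /hs'[ar ba]; rewrite lt_neqAle ar andbT; apply/eqP => E; apply: ba.
  by apply: rg; rewrite ?E.
- move=> w wr ws; apply: (hord_uniq (ho w wr)); apply: regular_hord; apply: contrapT => bw.
  have [wr'|/ltW wr'] := leP (cmod w) r; first by move/negP: ws; apply; apply/hs'.
  exact/bw/rg.
- by move=> t; apply: rg; rewrite cmod_circle gtr0_norm.
Qed.

(** The constant is the logarithm of the modulus of the leading Laurent coefficient at 0, the same
    for all radii. *)
Lemma jensen g : merNZ g -> exists c, forall r, good g r ->
  rmean r (fun w => ln (cmod (g w))) = c + N_point r (fun _ => 0) g - N_pole r g.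
Proof.
move=> mg; have [g0 [hg0 g00 eg0]] := hord_ord 0 mg.
exists (ln (cmod (g0 0))) => r gr; have dB := merNZ_discrete mg; have [rp _] := gr.
have [r0 rr0 hr0] := free_gap dB gr.
have dB' : discrete (fun z => cmod z < r0 /\ bad g z) by apply: discreteS dB => z [].
have rg z : r <= cmod z -> cmod z < r0 -> regular g z by move=> z1 z2; apply: contrapT; exact: hr0.
have eg1 : cnear 0 (fun w => w != 0 -> g w = w ^ order_at g 0 * g0 w).
  by apply: cnearS eg0 => w h w0; rewrite h // subr0.
have [s [us hs E]] := jensen_local rp rr0 dB' rg (fun w _ => hord_ord w mg) hg0 g00 eg1.
rewrite E -addrA; congr (_ + _).
have F m : (forall z, m z != 0%N -> bad g z) -> int_counting m r = \sum_(a <- s) (m a)%:R * radial r a.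
  move=> hm; apply: int_countingE => //; first by move=> z zr /hm bz; apply/hs.
  by move=> a /hs[].
rewrite /N_point /N_pole !F; [|exact: pole_mult_bad|exact: zero_mult_bad].
rewrite -sumrB; apply: eq_bigr => a _; rewrite -mulrBl; congr (_ * _).
by rewrite order_mult rmorphB /= -!pmulrn.
Qed.

Lemma first_fundamental g : merNZ g -> exists c, forall r, good g r ->
  nevanlinna_T r g = nevanlinna_T r (fun w => (g w)^-1) + c.
Proof.
move=> mg; have [c hc] := jensen mg; exists c => r gr; have := hc r gr.
rewrite (rmean_ln gr).1 /nevanlinna_T N_poleV // => /eqP; rewrite subr_eq => /eqP ->; ring.
Qed.

End Nevanlinna.

(** * Monotonicity of the characteristic *)

Section RiemannSums.
Context {R : realType}.
Implicit Types (phi : R -> R) (a b c e t : R).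

Lemma unif_cts phi a b : a <= b -> (forall t, {for t, continuous phi}) -> forall e, 0 < e ->
  exists2 d, 0 < d & forall s t, a <= s <= b -> `|t - s| < d -> `|phi t - phi s| <= e.
Proof.
move=> ab cp e e0.
pose P a b := exists2 d : R, 0 < d & forall s t, a <= s <= b -> `|t - s| < d -> `|phi t - phi s| <= e.
apply: (@itv_bisection _ P) => // [x y z _ xy yz _ [d1 d10 h1] [d2 d20 h2]|t0 _].
  exists (Num.min d1 d2) => [|s t]; first by rewrite lt_min d10.
  move=> /andP[s1 s2]; rewrite lt_min => /andP[l1 l2].
  have [sy|ys] := lerP s y; first by apply: h1; rewrite ?s1.
  by apply: h2; rewrite ?s2 ?ltW.
have e2 : 0 < e / 2 by rewrite divr_gt0.
have /cvgrPdist_lt /(_ _ e2) /near_dist [d d0 hd] := cp t0.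
have d2 : 0 < d / 2 by rewrite divr_gt0.
exists (d / 2) => // x1 x2 [_ h1 h2 _] h3; exists (d / 2) => // s t /andP[s1 s2] st.
have st0 : `|s - t0| < d / 2 by rewrite ltr_norml; apply/andP; split; lra.
have tt0 : `|t - t0| < d.
  by rewrite -(subrKA s) (le_lt_trans (ler_normD _ _)) // [d]splitr ltrD.
have k1 := hd _ tt0; have k2 : `|phi t0 - phi s| < e / 2 by apply: hd; lra.
rewrite -(subrKA (phi t0)) (le_trans (ler_normD _ _)) // [e]splitr lerD //.
  by rewrite distrC ltW.
exact: ltW.
Qed.

Lemma rint_shift phi a b c : a <= b -> (forall t, {for t, continuous phi}) ->
  rint a b (fun t => phi (t + c)) = rint (a + c) (b + c) phi.
Proof.
(* Starting the primitive one unit earlier, and working up to [b + c + 1], makes every point of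
   [a + c, b + c] interior for the fundamental theorem of calculus. *)
move=> ab cp; pose a1 := a + c - 1; pose Phi x := rint a1 x phi.
have rc x y : rcts x y phi by move=> t _; exact: cp.
have dP x : a + c <= x <= b + c -> is_derive x 1 Phi (phi x).
  move=> /andP[x1 x2]; have xu : x < b + c + 1 by lra.
  have ax : a1 < x by rewrite /a1; lra.
  have [d1 d2] := continuous_FTC1_closed xu (rcts_integrable (rc a1 (b + c + 1))) ax (cp x).
  have E : Phi = (fun x => Rintegral (@lebesgue_measure R) [set` `[a1, x]] phi).
    by apply/funext => y; rewrite /Phi rintE.
  by rewrite E; apply: DeriveDef; [exact: d1|rewrite -derive1E; exact: d2].
have -> : rint (a + c) (b + c) phi = Phi (b + c) - Phi (a + c).
  by apply: rint_ftc => //; rewrite lerD2r.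
apply: (@rint_ftc R a b (fun t => phi (t + c)) (fun t => Phi (t + c))) => //.
  move=> t _; apply: (@continuous_comp _ _ _ (fun t => t + c) phi); last exact: cp.
  by apply: cvgD; [exact: cvg_id|exact: cvg_cst].
move=> t /andP[t1 t2]; apply/is_derive_eps => e e0.
have /is_derive_eps /(_ e e0) /near_dist [d d0 hd] : is_derive (t + c) 1 Phi (phi (t + c)).
  by apply: dP; rewrite !lerD2r t1.
apply/near_dist; exists d => // s st; have E : s + c - (t + c) = s - t by ring.
by have := hd (s + c); rewrite E; apply.
Qed.

Lemma rint_periodic phi p c : 0 <= c -> 0 <= p -> (forall t, {for t, continuous phi}) ->
  (forall t, phi (t + p) = phi t) -> rint 0 p (fun t => phi (t + c)) = rint 0 p phi.
Proof.
move=> c0 p0 cp per; have rc x y : rcts x y phi by move=> t _; exact: cp.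
have e1 : rint 0 (p + c) phi = rint 0 c phi + rint c (p + c) phi.
  by apply: rint_cat => //; rewrite lerDr.
have e2 : rint 0 (p + c) phi = rint 0 p phi + rint p (p + c) phi.
  by apply: rint_cat => //; rewrite lerDl.
have e3 : rint p (p + c) phi = rint 0 c phi.
  rewrite -{1}[p]add0r [p + c]addrC -rint_shift //; apply: rint_ext => t _; exact: per.
rewrite rint_shift // add0r; have := e2; rewrite e1 e3 [RHS]addrC.
by move/addrI.
Qed.

Lemma riemann_sum phi (n : nat) p e : (0 < n)%N -> 0 <= p -> (forall t, {for t, continuous phi}) ->
  (forall s t, 0 <= s <= p -> `|t - s| <= p / n%:R -> `|phi t - phi s| <= e) ->
  `|p / n%:R * \sum_(k < n) phi (k%:R * (p / n%:R)) - rint 0 p phi| <= p * e.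
Proof.
move=> n0 p0 cp hm; have nR : 0 < n%:R :> R by rewrite ltr0n.
set h := p / n%:R; have h0 : 0 <= h by rewrite divr_ge0 // ltW.
have rc x y : rcts x y phi by move=> t _; exact: cp.
have nh : n%:R * h = p by rewrite mulrC divfK // gt_eqF.
have key m : (m <= n)%N -> `|h * \sum_(k < m) phi (k%:R * h) - rint 0 (m%:R * h) phi| <= m%:R * h * e.
  elim: m => [_|m ih mn].
    by rewrite big_ord0 mulr0 !mul0r rintE set_itv1 Rintegral_set1 subrr normr0.
  have mh : m%:R * h <= m.+1%:R * h by rewrite ler_wpM2r // ler_nat.
  have mh0 : 0 <= m%:R * h by rewrite mulr_ge0.
  have sz : m.+1%:R * h - m%:R * h = h by rewrite -natr1; ring.
  rewrite big_ord_recr /= mulrDr (@rint_cat _ 0 (m.+1%:R * h) (m%:R * h)) //.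
  have -> : h * phi (m%:R * h) = rint (m%:R * h) (m.+1%:R * h) (fun _ => phi (m%:R * h)).
    by rewrite rint_cst // sz mulrC.
  rewrite opprD addrACA; apply: (le_trans (ler_normD _ _)).
  have -> : m.+1%:R * h * e = m%:R * h * e + h * e by rewrite -natr1; ring.
  apply: lerD; first by apply: ih; exact: ltnW.
  rewrite -mulN1r -rintZ // -rintD //; last 2 first.
  - exact: rcts_cst.
  - by apply: rctsM => //; exact: rcts_cst.
  have cD : rcts (m%:R * h) (m.+1%:R * h) (fun t => phi (m%:R * h) + -1 * phi t).
    by apply: rctsD; [exact: rcts_cst|apply: rctsM => //; exact: rcts_cst].
  apply: (le_trans (rint_norm cD)).
  have -> : h * e = rint (m%:R * h) (m.+1%:R * h) (fun _ => e) by rewrite rint_cst // sz mulrC.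
  apply: rint_le; first exact: rcts_norm.
    exact: rcts_cst.
  move=> t /andP[t1 t2]; rewrite mulN1r distrC; apply: hm.
    rewrite mh0 /= -nh ler_wpM2r // ler_nat ltnW //.
  by rewrite ger0_norm ?subr_ge0 // -/h; lra.
by have := key n (leqnn n); rewrite nh.
Qed.

End RiemannSums.

(** * Maximum principle and monotonicity *)

Section Monotone.
Context {R : realType}.
Notation C := R[i].
Implicit Types (u g : C -> C) (z w a : C) (r t : R).

(** Cauchy's estimate for the powers of [u] bounds (|u(z)|/M)^n by a constant independent of n,
    which Bernoulli's inequality forbids when |u(z)| > M. Powers thus remove the constant in the
    estimate. *)
Lemma max_principle u r0 r M z : (forall w, cmod w < r0 -> cdif u w) -> cmod z < r -> r < r0 -> 0 < M ->
  (forall t, 0 <= t <= 2 * pi -> cmod (u (circle_pt r t)) <= M) -> cmod (u z) <= M.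
Proof.
move=> du zr rr0 M0 hM; rewrite leNgt; apply/negP => Mu.
have rp : 0 < r := le_lt_trans (cmod_ge0 _) zr.
pose x := cmod (u z) / M - 1.
have x0 : 0 < x by rewrite subr_gt0 ltr_pdivlMr // mul1r.
have bern n : 1 + n%:R * x <= (1 + x) ^+ n.
  elim: n => [|n ih]; first by rewrite mul0r addr0 expr0.
  rewrite exprS -natr1; apply: le_trans (ler_wpM2l _ ih); last by lra.
  have : 0 <= n%:R * x * x by rewrite !mulr_ge0 // ltW.
  by rewrite !mulrDr !mulrDl !mul1r !mulr1; lra.
pose K := 2 * (r / (r - cmod z)).
have bound n : (1 + x) ^+ n <= K.
  have dn w : cmod w < r0 -> cdif (fun w => u w ^+ n) w by move=> wr; apply: cdifX; exact: du.
  have Mn : 0 < M ^+ n by rewrite exprn_gt0.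
  have := @cauchy_estimate R (fun w => u w ^+ n) r0 (fun w wr => cdif_cont (dn w wr))
    (fun w h => dn w (proj2 (andP h))) r (M ^+ n) z zr rr0 Mn.
  have hb t : 0 <= t <= 2 * pi -> cmod (u (circle_pt r t) ^+ n) <= M ^+ n.
    by move=> ht; rewrite cmodX lerXn2r ?nnegrE ?cmod_ge0 ?(ltW M0) ?hM.
  move=> /(_ hb); rewrite cmodX => H.
  have -> : 1 + x = cmod (u z) / M by rewrite /x addrC subrK.
  rewrite expr_div_n ler_pdivrMr //; apply: le_trans H _.
  by rewrite /K le_eqVlt; apply/orP; left; apply/eqP; ring.
have K0 : 0 <= K / x by rewrite divr_ge0 ?(ltW x0) // mulr_ge0 // divr_ge0 ?(ltW rp) // subr_ge0 ltW.
have := archi_boundP K0; rewrite ltr_pdivrMr // => H.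
have := le_trans (bern _) (bound (Num.bound (K / x))); lra.
Qed.

Lemma circle_add r s t : circle_pt r (t + s) = circle_pt 1 s * circle_pt r t.
Proof. by apply: ceq; rewrite ?(cReM, cImM) /= ?cosD ?sinD; ring. Qed.

Lemma cdif_prod (I : Type) (l : seq I) (F : I -> C -> C) z : (forall i, cdif (F i) z) ->
  cdif (fun w => \prod_(i <- l) F i w) z.
Proof.
move=> h; elim: l => [|i l ih].
  by apply: (cdif_eq (f := fun _ => 1)); [apply: cnearW => w; rewrite big_nil|exact: cdif_cst].
apply: (cdif_eq (f := fun w => F i w * \prod_(i <- l) F i w)).
  by apply: cnearW => w; rewrite big_cons.
exact: cdifM.
Qed.

Lemma expR_sum (I : Type) (l : seq I) (F : I -> R) : \prod_(i <- l) expR (F i) = expR (\sum_(i <- l) F i).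
Proof. by rewrite (big_morph expR (@expRD R) (@expR0 R)). Qed.

(* The average of log^+ |u| over n rotations is a maximum of logarithms of moduli of
   holomorphic functions (products of rotated copies of u), hence obeys the maximum
   principle; these averages are Riemann sums of the circular means. *)
Lemma rmean_log_plus_mono u r0 r1 r2 : 0 < r1 -> r1 < r2 -> r2 < r0 ->
  (forall w, cmod w < r0 -> cdif u w) ->
  rmean r1 (fun w => log_plus (cmod (u w))) <= rmean r2 (fun w => log_plus (cmod (u w))).
Proof.
move=> r10 r12 r20 du; have r2p := lt_trans r10 r12.
apply/ler_addgt0Pr => e e0; have e2 : 0 < e / 2 by rewrite divr_gt0.
have cc r : 0 < r -> r < r0 -> circts u r.
  by move=> rp rr0 t; apply: cdif_cont; apply: du; rewrite cmod_circle gtr0_norm.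
pose psi r t := log_plus (cmod (u (circle_pt r t))).
have c1 t : {for t, continuous (psi r1)} by exact: (circr_log_plus (cc r1 r10 (lt_trans r12 r20))).
have c2 t : {for t, continuous (psi r2)}  by exact: (circr_log_plus (cc r2 r2p r20)).
have p0 := ltW (@twopi_gt0 R); have pp := @twopi_gt0 R.
have [d1 d10 h1] := unif_cts p0 c1 e2.
(* The rotated sample points t + k h range over up to two periods. *)
have [d2 d20 h2] := @unif_cts R (psi r2) 0 (2 * pi + 2 * pi) (addr_ge0 p0 p0) c2 _ e2.
pose d := Num.min d1 d2; have d0 : 0 < d by rewrite lt_min d10.
pose n := (Num.bound (2 * pi / d)).+1; have nR : 0 < n%:R :> R by rewrite ltr0n.
have hd : 2 * pi / n%:R < d.
  rewrite ltr_pdivrMr // [d * _]mulrC -ltr_pdivrMr //.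
  apply: lt_trans (archi_boundP (divr_ge0 p0 (ltW d0))) _.
  by rewrite ltr_nat.
have [hd1 hd2] : 2 * pi / n%:R < d1 /\ 2 * pi / n%:R < d2.
  by move: hd; rewrite lt_min => /andP[].
set h := 2 * pi / n%:R in hd1 hd2.
have R1 := @riemann_sum R (psi r1) n (2 * pi) (e / 2) isT p0 c1
  (fun s t hs hst => h1 s t hs (le_lt_trans hst hd1)).
have R2 t : 0 <= t <= 2 * pi ->
    `|h * \sum_(k < n) psi r2 (t + k%:R * h) - rint 0 (2 * pi) (psi r2)| <= 2 * pi * (e / 2).
  move=> /andP[t0 t1].
  have per s : psi r2 (s + 2 * pi) = psi r2 s.
    by rewrite /psi /circle_pt mulr_natl cosD2pi sinD2pi.
  rewrite -(rint_periodic t0 p0 c2 per).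
  have cs s : {for s, continuous (fun s => psi r2 (s + t))}.
    apply: (@continuous_comp _ _ _ (fun s => s + t) (psi r2)); last exact: c2.
    by apply: cvgD; [exact: cvg_id|exact: cvg_cst].
  have := @riemann_sum R (fun s => psi r2 (s + t)) n (2 * pi) (e / 2) isT p0 cs _.
  under [X in _ -> is_true (`|_ * X - _| <= _)]eq_bigr do rewrite addrC.
  apply => s s' /andP[s0 s1] hs; apply: h2.
    by rewrite addr_ge0 //= lerD.
  have -> : s' + t - (s + t) = s' - s by ring.
  exact: le_lt_trans hs hd2.
(* A bound, uniform in the rotation, for the average of the n samples on the outer circle; e/2 is
   the error of the Riemann sum after normalization. *)
pose V := rmean r2 (fun w => log_plus (cmod (u w))) + e / 2.
have hV t : 0 <= t <= 2 * pi -> \sum_(k < n) psi r2 (t + k%:R * h) <= n%:R * V.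
  move=> /R2; rewrite ler_norml => /andP[_]; rewrite lerBlDr => H.
  have -> : n%:R * V = (2 * pi * (e / 2) + rint 0 (2 * pi) (psi r2)) / h.
    rewrite /V /rmean /h -/(psi r2); move: (rint 0 (2 * pi) (psi r2)) => I.
    by move: (2 * pi) pp => P P0; field; rewrite !gt_eqF.
  by rewrite ler_pdivlMr ?divr_gt0 // mulrC.
(* Whether log^+ is positive is decided once, at the sample points of the inner circle. The product
   of the [F k] then has modulus exactly the exponential of the inner sum there, and at most that of
   the outer sum on the outer circle. *)
pose F (k : 'I_n) w := if 1 <= cmod (u (circle_pt r1 (0 + k%:R * h))) then u (circle_pt 1 (k%:R * h) * w) else 1.
have dF (k : 'I_n) w : cmod w < r0 -> cdif (F k) w.
  move=> wr; rewrite /F; have [_|_] := boolP (1 <= cmod (u (circle_pt r1 (0 + k%:R * h)))); last exact: cdif_cst.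
  have [dd hdd] : cdif u (circle_pt 1 (k%:R * h) * w).
    by apply: du; rewrite cmodM cmod_circle normr1 mul1r.
  have := cderM (cder_cst (circle_pt 1 (k%:R * h)) w) (cder_id w).
  by move=> H; eexists; exact: (cder_comp H hdd).
have eF (k : 'I_n) t : cmod (F k (circle_pt r2 t)) <= expR (psi r2 (t + k%:R * h)).
  rewrite /F; case: ifP => _; last by rewrite cmod1 -expR0 ler_expR log_plus_ge0.
  by rewrite -circle_add; apply: expR_log_plus; exact: cmod_ge0.
have eF1 (k : 'I_n) : cmod (F k (circle_pt r1 0)) = expR (psi r1 (k%:R * h)).
  rewrite /F /psi add0r; case: (leP 1 (cmod (u (circle_pt r1 (k%:R * h))))) => hu.
    by rewrite -circle_add add0r log_plus_big // lnK // posrE (lt_le_trans _ hu).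
  by rewrite cmod1 log_plus_small ?expR0 // ltW.
have := @max_principle (fun w => \prod_(k <- enum 'I_n) F k w) r0 r2 (expR (n%:R * V)) (circle_pt r1 0).
rewrite cmod_circle gtr0_norm // => /(_ _ r12 r20 (expR_gt0 _)) H.
have {}H : cmod (\prod_(k <- enum 'I_n) F k (circle_pt r1 0)) <= expR (n%:R * V).
  apply: H => [w wr|t ht]; first by apply: cdif_prod => k; exact: dF.
  rewrite cmod_prod; apply: le_trans (_ : \prod_(k <- enum 'I_n) expR (psi r2 (t + k%:R * h)) <= _).
    by apply: ler_prod => k _; rewrite cmod_ge0 eF.
  by rewrite expR_sum ler_expR big_enum /= hV.
move: H; rewrite cmod_prod; under eq_bigr do rewrite eF1.
rewrite expR_sum ler_expR big_enum /= => H.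
move: R1; rewrite ler_norml => /andP[R1 _].
have : h * \sum_(k < n) psi r1 (k%:R * h) <= h * (n%:R * V) by rewrite ler_wpM2l // divr_ge0.
have -> : h * (n%:R * V) = 2 * pi * V by rewrite mulrA divfK // gt_eqF.
move=> H2; rewrite {1}/rmean -/(psi r1) mulrC ler_pdivrMr //.
have : rint 0 (2 * pi) (psi r1) <= 2 * pi * V + 2 * pi * (e / 2) by rewrite -/h in R1; lra.
have -> : 2 * pi * V + 2 * pi * (e / 2) = (rmean r2 (fun w => log_plus (cmod (u w))) + e) * (2 * pi).
  by rewrite /V -mulrDr -addrA -splitr mulrC.
by [].
Qed.

Lemma blaschke_le1 r a w : cmod a < r -> cmod w < r -> cmod (blaschke r a w) <= 1.
Proof.
move=> ar wr; apply: (@max_principle _ (2 * r - cmod a) r) => //; last first.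
- by move=> t _; rewrite blaschke_circle.
- lra.
- by move=> v; exact: blaschke_cdif.
Qed.

Lemma holo_hord0_regular u w : holo u w -> hord u w 0 -> regular u w.
Proof.
move=> hu /hord0_holo[k [k1 k2 k3]]; split => //.
by have -> : u w = k w by apply: ccont_lim_eq => //; exact: holo_cont.
Qed.

Lemma circr_ln g r : good g r -> circr (fun w => ln (cmod (g w))) r.
Proof.
move=> gr t; apply: (@continuous_comp _ _ _ (fun t => cmod (g (circle_pt r t))) (@ln R)).
  by apply: circr_cmod; exact: good_circts.
by apply: continuous_ln; rewrite cmod_gt0; case: (good_circle t gr).
Qed.

(** Multiplying by the Blaschke product of the poles in the disc of radius [r2] gives a holomorphic
    [u] with |u| = |g| on the outer circle. On the inner one m(r1, g) exceeds m(r1, u) by at most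
    the mean of ln|g/u|, which Jensen's formula evaluates as N(r2, g) - N(r1, g). Monotonicity of
    m(r, u) concludes. *)
Lemma T_mono g r1 r2 : merNZ g -> good g r1 -> good g r2 -> r1 < r2 ->
  nevanlinna_T r1 g <= nevanlinna_T r2 g.
Proof.
move=> mg g1 g2 r12; have [r1p _] := g1; have [r2p _] := g2; have dB := merNZ_discrete mg.
have [r0 r20 hr0] := free_gap dB g2.
have [s us hs] := discrete_finite r2 dB.
have hs2 a : a \in s -> cmod a < r2.
  move=> /hs[ar ba]; rewrite lt_neqAle ar andbT; apply/eqP => E; apply: ba.
  exact: good_regular g2 E.
have [r3 [r23 r30 hr3]] := ex_radius r20 hs2.
pose o a : int := pole_mult g a.
have hB w : cmod w < r3 -> hord (blprod r2 s o) w (if w \in s then o w else 0).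
  move=> wr; apply: blprod_hord => // a as_; split; first exact: hs2.
  exact: lt_le_trans wr (hr3 a as_).
have nbad w : cmod w < r3 -> w \notin s -> regular g w.
  move=> wr ws; apply: contrapT => bw; have [wr'|/ltW wr'] := leP (cmod w) r2.
    by move/negP: ws; apply; apply/hs.
  exact: hr0 wr' (lt_le_trans wr r30) bw.
have hk w : cmod w < r3 -> hord (fun x => g x * blprod r2 s o x) w (zero_mult g w).
  move=> wr; have := hordM (hord_ord w mg) (hB w wr).
  case: ifPn => [_|ws]; first by rewrite order_mult subrK.
  rewrite addr0 => H.
  by have := regular_order (nbad w wr ws); rewrite zero_multE => E; rewrite E in H *.
have [u hu] : exists u, forall w, cmod w < r3 -> holo u w /\
    cnear w (fun x => x != w -> g x * blprod r2 s o x = u x).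
  apply: (@regularize R (fun x => g x * blprod r2 s o x) (fun w => cmod w < r3)); first by move=> w; exact: cnear_lt.
  move=> w /hk[k [k1 k2 k3]]; exists (fun x => (x - w) ^+ zero_mult g w * k x); split.
    by apply: holoM => //; apply: holoX; exact: holo_subr.
  exact: k3.
have ou w : cmod w < r3 -> hord u w (zero_mult g w).
  by move=> wr; apply: hord_eq (hk w wr); case: (hu w wr).
have ru w : cmod w < r3 -> regular g w -> regular u w.
  move=> wr /regular_order E; apply: holo_hord0_regular; first by case: (hu w wr).
  by have := ou w wr; rewrite zero_multE E.
have eu w : cmod w < r3 -> regular g w -> w \notin s -> u w = blprod r2 s o w * g w.
  move=> wr rg ws; apply: (@factor_eq R u g r2 s o w) => //.
  - by move=> a as_; split; [exact: hs2|exact: lt_le_trans wr (hr3 a as_)].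
  - by apply: holo_cdif; case: rg.
  - exact: ru.
  - by case: (hu w wr) => _; apply: cnearS => x e xw; rewrite -e // mulrC.
have du w : cmod w < r3 -> cdif u w by move=> /hu[/holo_cdif].
have gu r : good g r -> r < r3 -> good u r.
  by move=> gr rr; split => [|z zr]; [case: gr|apply; apply: ru; rewrite ?zr //; exact: good_regular zr].
have r13 := lt_trans r12 r23.
have z3 : cmod (0 : C) < r3 by rewrite cmod0 (lt_trans r2p).
have [u0 [hu0 u00 eu0]] := ou 0 z3.
have eu0' : cnear 0 (fun w => w != 0 -> u w = w ^ (zero_mult g 0)%:Z * u0 w).
  by apply: cnearS eu0 => w e w0; rewrite e // subr0.
have du3 : discrete (fun z => cmod z < r3 /\ bad u z).
  apply: discreteS dB => z [zr bz] rg; exact/bz/ru.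
have JU r : good g r -> r < r3 -> rmean r (fun w => ln (cmod (u w))) = ln (cmod (u0 0)) + N_point r (fun _ => 0) g.
  move=> gr rr; have [rp _] := gr; have [r4 rr4 hr4] := free_gap dB gr.
  have rr5 : r < Num.min r3 r4 by rewrite lt_min rr.
  have l3 w : cmod w < Num.min r3 r4 -> cmod w < r3 by rewrite lt_min => /andP[].
  have dB5 : discrete (fun z => cmod z < Num.min r3 r4 /\ bad u z).
    by apply: discreteS du3 => z [/l3].
  have rg5 z : r <= cmod z -> cmod z < Num.min r3 r4 -> regular u z.
    move=> z1 z2; apply: ru; first exact: l3.
    by apply: contrapT; apply: hr4 => //; move: z2; rewrite lt_min => /andP[].
  have [s' [us' hs' ->]] := jensen_local rp rr5 dB5 rg5 (fun w h => ou w (l3 w h)) hu0 u00 eu0'.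
  congr (_ + _); symmetry; apply: int_countingE => //.
  - move=> z zr mz; apply/hs'; split => // rz; move: mz.
    have := hord_uniq (ou z (le_lt_trans zr rr)) (regular_hord rz) => -[].
    by rewrite /zero_mult => ->.
  - by move=> a /hs'[].
have [c Jg] := jensen mg.
have D r : good g r -> r < r3 -> rmean r (fun w => ln (cmod (g w))) - rmean r (fun w => ln (cmod (u w))) = c - ln (cmod (u0 0)) - N_pole r g.
  by move=> gr rr; rewrite Jg // JU //; ring.
have E2 t : cmod (u (circle_pt r2 t)) = cmod (g (circle_pt r2 t)).
  have cr : cmod (circle_pt r2 t) = r2 by rewrite cmod_circle gtr0_norm.
  rewrite eu ?cr //; last by apply/negP => /hs2; rewrite cr ltxx.
    by rewrite cmodM blprod_circle // mul1r.
  exact: good_circle.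
have D2 := D r2 g2 r23.
rewrite (@rmean_ext R r2 (fun w => ln (cmod (u w))) (fun w => ln (cmod (g w)))) ?subrr in D2; last by move=> t; rewrite E2.
have D1 := D r1 g1 r13.
have M12 := rmean_log_plus_mono r1p r12 r23 du.
have P2 : rmean r2 (fun w => log_plus (cmod (u w))) = proximity r2 g.
  by rewrite proximityE; apply: rmean_ext => t; rewrite E2.
have gu1 := gu r1 g1 r13.
have P1 : proximity r1 g <= rmean r1 (fun w => log_plus (cmod (u w))) +
    (rmean r1 (fun w => ln (cmod (g w))) - rmean r1 (fun w => ln (cmod (u w)))).
  have cl1 := circr_ln g1; have cl2 := circr_ln gu1.
  have clp := circr_log_plus (good_circts gu1); have clg := circr_log_plus (good_circts g1).
  have cl3 : circr (fun w => -1 * ln (cmod (u w))) r1 by apply: circrZ; exact: cl2.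
  have cl4 : circr (fun w => ln (cmod (g w)) + -1 * ln (cmod (u w))) r1.
    by apply: circrD; [exact: cl1|exact: cl3].
  rewrite -[X in _ - X]mul1r -mulNr -(rmeanZ (-1) cl2) -(rmeanD cl1 cl3) -(rmeanD clp cl4).
  rewrite proximityE; apply: rmean_le => //; first by apply: circrD; [exact: clp|exact: cl4].
  move=> t; set w := circle_pt r1 t; have cw : cmod w = r1 by rewrite cmod_circle gtr0_norm.
  have rg : regular g w by exact: good_circle.
  have ruw : regular u w by apply: ru; rewrite ?cw.
  have ws : w \notin s by apply/negP => /hs[_]; apply.
  have ew := eu w _ rg ws; rewrite cw in ew; have {}ew := ew r13.
  have bp : 0 < cmod (blprod r2 s o w).
    by rewrite cmod_gt0; apply: contraTneq (proj2 ruw) => b0; rewrite ew b0 mul0r eqxx.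
  have gp : 0 < cmod (g w) by rewrite cmod_gt0; case: rg.
  have bl1 : cmod (blprod r2 s o w) <= 1.
    rewrite /blprod cmod_prod; apply: (@le_trans _ _ (\prod_(a <- s) 1)); last by rewrite big1_eq.
    rewrite !big_seq; apply: ler_prod => a as_; rewrite cmodXz exprz_ge0 ?cmod_ge0 //=.
    change (cmod (blaschke r2 a w) ^+ pole_mult g a <= 1).
    apply: exprn_ile1; first exact: cmod_ge0.
    by apply: blaschke_le1; [exact: hs2|rewrite cw].
  have -> : ln (cmod (g w)) + -1 * ln (cmod (u w)) = ln (cmod (blprod r2 s o w))^-1.
    by rewrite ew cmodM lnM ?posrE // lnV ?posrE //; ring.
  have {1}-> : cmod (g w) = cmod (u w) * (cmod (blprod r2 s o w))^-1.
    by rewrite ew cmodM mulrC mulrA mulVf ?mul1r // gt_eqF.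
  apply: le_trans (log_plusM (cmod_ge0 _) _) _; first by rewrite invr_ge0 ltW.
  by rewrite lerD2l log_plus_big // invf_ge1.
rewrite /nevanlinna_T; move: M12 P1; rewrite P2; lra.
Qed.

End Monotone.

(** * The lemma on the logarithmic derivative *)

Section ExceptionalSets.
Context {R : realType}.
Notation mu := (@lebesgue_measure R).
Implicit Types (E : set R) (r : R).

Definition fin_meas E := [/\ measurable E, E `<=` [set r | 0 < r] & (mu E < +oo)%E].

Lemma fin_measU E1 E2 : fin_meas E1 -> fin_meas E2 -> fin_meas (E1 `|` E2).
Proof.
move=> [m1 p1 f1] [m2 p2 f2]; split; first exact: measurableU.
  by move=> r [/p1|/p2].
by apply: (le_lt_trans (@measureU2 _ _ _ mu _ _ m1 m2)); exact: lte_add_pinfty.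
Qed.

Lemma measurable_pos : measurable [set r : R | 0 < r].
Proof.
rewrite (_ : [set r | 0 < r] = `]0, +oo[%classic) //; apply/seteqP; split => r /=;
  by rewrite in_itv /= andbT.
Qed.

Lemma fin_meas_countable E : countable E -> fin_meas (E `&` [set r | 0 < r]).
Proof.
move=> cE; have cE' : countable (E `&` [set r | 0 < r]).
  by apply: sub_countable cE; apply: subset_card_le => r [].
split; last by rewrite countable_lebesgue_measure0.
  by apply: countable_measurable => // t; exact: measurable_set1.
by move=> r [].
Qed.

Definition near_list (l : seq (R * R)) : set R := [set r | exists2 x, x \in l & `|r - x.1| <= x.2].

Lemma near_list_measure l : (forall x, x \in l -> 0 <= x.2) ->
  measurable (near_list l) /\ (mu (near_list l) <= (\sum_(x <- l) 2 * x.2)%:E)%E.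
Proof.
have itvm (c d : R) : 0 <= d -> (mu `[(c - d)%R, (c + d)%R]%classic <= (2 * d)%:E)%E.
  move=> d0; rewrite lebesgue_measure_itv /=; case: ifP => _; last by rewrite lee_fin mulr_ge0.
  by rewrite -EFinB lee_fin; lra.
elim: l => [_|x l ih hl].
  rewrite (_ : near_list [::] = set0); last by apply/seteqP; split => r // [x].
  by rewrite measure0 big_nil; split => //; exact: measurable0.
have x0 : 0 <= x.2 by apply: hl; rewrite inE eqxx.
have [m1 m2] : measurable (near_list l) /\ (mu (near_list l) <= (\sum_(x <- l) 2 * x.2)%:E)%E.
  by apply: ih => y yl; apply: hl; rewrite inE yl orbT.
have -> : near_list (x :: l) = `[x.1 - x.2, x.1 + x.2]%classic `|` near_list l.
  apply/seteqP; split => r /=.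
    move=> [y]; rewrite inE => /orP[/eqP -> h|yl h]; last by right; exists y.
    by left; rewrite in_itv /=; move: h; rewrite ler_distlC /=; lra.
  move=> [|[y yl h]]; last by exists y => //; rewrite inE yl orbT.
  by rewrite in_itv /= => h; exists x; [rewrite inE eqxx|rewrite ler_distlC; lra].
have mI : measurable `[x.1 - x.2, x.1 + x.2]%classic by exact: measurable_itv.
split; first exact: measurableU.
apply: (le_trans (@measureU2 _ _ _ mu _ _ mI m1)); rewrite big_cons EFinD; apply: leeD => //.
exact: itvm.
Qed.

(** The finite unions of intervals increase, so the measure of the whole is the limit of theirs,
    each at most twice the sum of the radii. *)
Lemma fin_meas_lists (l : nat -> seq (R * R)) K :
  (forall n x, x \in l n -> 0 <= x.2) -> (forall n, {subset l n <= l n.+1}) ->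
  (forall n, \sum_(x <- l n) x.2 <= K) ->
  fin_meas ((\bigcup_n near_list (l n)) `&` [set r | 0 < r]).
Proof.
move=> h0 hs hK; have hm n := near_list_measure (h0 n).
have mU : measurable (\bigcup_n near_list (l n)) by apply: bigcup_measurable => n _; case: (hm n).
have mUp : measurable ((\bigcup_n near_list (l n)) `&` [set r | 0 < r]).
  by apply: measurableI => //; exact: measurable_pos.
split; [by []|by move=> r []|].
apply: (@le_lt_trans _ _ ((2 * K)%:E)); last exact: ltry.
apply: (@le_trans _ _ (mu (\bigcup_n near_list (l n)))).
  by apply: le_measure; rewrite ?inE // => r [].
have nd : nondecreasing_seq (fun n => near_list (l n)).
  by apply/nondecreasing_seqP => n; apply/subsetPset => r [x /hs xl hx]; exists x.
have cv := @nondecreasing_cvg_mu _ _ _ mu _ (fun n => proj1 (hm n)) mU nd.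
rewrite -(cvg_lim _ cv) //; apply: lime_le; first by apply/cvg_ex; eexists; exact: cv.
apply: nearW => n /=; apply: (le_trans (proj2 (hm n))).
by rewrite lee_fin -mulr_sumr ler_pM2l.
Qed.

(* If T doubles on [r, r + 1/T r], then r lies within 2^-j of the last point where T < 2^(j+1),
   for the j with 2^j <= T r < 2^(j+1). *)
Lemma borel (T : R -> R) (G : R -> Prop) :
  (forall r1 r2, G r1 -> G r2 -> r1 < r2 -> T r1 <= T r2) ->
  exists2 E, fin_meas E & forall r r', 0 < r -> ~ E r -> G r -> G r' -> 1 <= T r ->
    r < r' -> r' <= r + (T r)^-1 -> T r' <= 2 * T r.
Proof.
move=> mT; pose A j : set R := [set r | G r /\ T r < 2 ^+ j.+1].
pose l n := [seq (sup (A j), (2 ^+ j)^-1 : R) | j <- iota 0 n].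
exists ((\bigcup_n near_list (l n)) `&` [set r | 0 < r]).
  apply: (@fin_meas_lists l 2) => [n x /mapP[j _ ->]|n x /mapP[j jn ->]|n] /=.
  - by rewrite invr_ge0 exprn_ge0.
  - by apply: map_f; move: jn; rewrite !mem_iota !add0n /= => /ltnW.
  - suff -> : \sum_(x <- l n) x.2 = 2 - 2 * (2 ^+ n)^-1.
      by rewrite gerBl mulr_ge0 // invr_ge0 exprn_ge0.
    rewrite big_map; elim: n => [|n ih]; first by rewrite big_nil expr0 invr1 mulr1 subrr.
    rewrite -addn1 iotaD big_cat ih /= big_cons big_nil add0n addn1 exprS invfM.
    rewrite mulrA mulfV //; move: (_^-1) => y; ring.
move=> r r' r0 nE Gr Gr' T1 rr' r'T; rewrite leNgt; apply/negP => TT; apply: nE.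
have ex : exists j, T r < 2 ^+ j.+1.
  exists (Num.bound (T r)); apply: lt_trans (archi_boundP (le_trans ler01 T1)) _.
  by rewrite -natrX ltr_nat (ltn_trans (ltn_expl _ (ltnSn 1))) // ltn_exp2l.
have [j [j1 j2]] : exists j, 2 ^+ j <= T r /\ T r < 2 ^+ j.+1.
  case: (ex_minnP ex) => -[|j] hj hm; first by exists 0%N; rewrite expr0.
  by exists j.+1; split => //; rewrite leNgt; apply/negP => /hm; rewrite ltnn.
have Ar : A j r by [].
(* A good point x beyond r' would satisfy T x >= T r' > 2 T r >= 2^(j+1), contrary to membership in
   [A j]. *)
have ub : ubound (A j) r'.
  move=> x [Gx Tx]; rewrite leNgt; apply/negP => r'x.
  have := mT _ _ Gr' Gx r'x; rewrite exprS in Tx; have : 2 * 2 ^+ j <= 2 * T r by rewrite ler_pM2l.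
  lra.
have hs : has_sup (A j) by split; [exists r|exists r'].
have s1 : r <= sup (A j) by apply: ub_le_sup => //; exists r'.
have s2 : sup (A j) <= r' by apply: ge_sup => //; exists r.
have iT : (T r)^-1 <= (2 ^+ j)^-1 by rewrite lef_pV2 // posrE ?exprn_gt0 // (lt_le_trans _ T1).
split => //; exists j.+1 => //; exists (sup (A j), (2 ^+ j)^-1).
  by apply: map_f; rewrite mem_iota add0n /=.
rewrite /= ler_norml; apply/andP; split; lra.
Qed.

(** Around |a| an interval of radius 1/n^2 is excluded, n being the number of points of modulus at
    most |a|. The radii are summable because the j-th point in the order of moduli has n >= j. *)
Lemma points_separation (B : R[i] -> Prop) : discrete B ->
  exists2 E, fin_meas E & forall r a (s : seq R[i]), 0 < r -> ~ E r -> uniq s -> B a ->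
    (forall b, B b -> cmod b <= cmod a -> b \in s) -> `|r - cmod a|^-1 <= (size s)%:R ^+ 2.
Proof.
move=> dB; pose S x := s2val (cid2 (@discrete_finite R B x dB)).
have uS x : uniq (S x) by exact: (s2valP (cid2 (@discrete_finite R B x dB))).
have hS x z : z \in S x <-> cmod z <= x /\ B z by exact: (s2valP' (cid2 (@discrete_finite R B x dB))).
pose w (a : R[i]) : R := ((size (S (cmod a)))%:R ^+ 2)^-1.
pose l n := [seq (cmod a, w a) | a <- S n%:R].
have key n (s : seq R[i]) : size s = n -> uniq s -> (forall a, a \in s -> B a) ->
    \sum_(a <- s) w a <= 2 - 2 / n.+1%:R.
  elim: n s => [|n ih] s ss us hs.
    by rewrite (size0nil ss) big_nil invr1; lra.
  (* A point of largest modulus is removed: all n + 1 points are counted in its weight, which is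
     thus at most 1/(n+1)^2 <= 2/(n+1) - 2/(n+2), and the sum telescopes. *)
  have [a as_ am] : exists2 a, a \in s & forall b, b \in s -> cmod b <= cmod a.
    have : s != [::] by rewrite -size_eq0 ss.
    elim: (s) => // b t iht _; case: (eqVneq t [::]) => [->|t0].
      by exists b => [|c]; rewrite inE // => /eqP ->.
    have [a at_ ha] := iht t0; have [ab|/ltW ba] := leP (cmod b) (cmod a).
      exists a; first by rewrite inE at_ orbT.
      by move=> c; rewrite inE => /orP[/eqP ->|/ha].
    exists b; first by rewrite inE eqxx.
    by move=> c; rewrite inE => /orP[/eqP ->|/ha h] //; exact: le_trans h ba.
  rewrite (big_rem a) //=.
  have := ih (rem a s); rewrite size_rem // ss /= => /(_ erefl (rem_uniq _ us)) H.
  have {}H : \sum_(a <- rem a s) w a <= 2 - 2 / n.+1%:R by apply: H => b /mem_rem; exact: hs.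
  have sz : (n.+1 <= size (S (cmod a)))%N.
    by rewrite -ss; apply: uniq_leq_size => // b bs; apply/hS; split; [exact: am|exact: hs].
  have wa : w a <= (n.+1%:R ^+ 2)^-1.
    rewrite /w lef_pV2 ?posrE ?exprn_gt0 ?ltr0n //; last exact: leq_trans sz.
    by rewrite lerXn2r ?nnegrE ?ler_nat.
  have nn : (n.+1%:R ^+ 2)^-1 <= 2 / n.+1%:R - 2 / n.+2%:R :> R.
    rewrite -[n.+2%:R]natr1 -[n.+1%:R]natr1; have : 0 <= n%:R :> R by [].
    move: (n%:R : R) => y y0; rewrite -subr_ge0.
    have -> : 2 / (y + 1) - 2 / (y + 1 + 1) - (y + 1) ^- 2 = y / ((y + 1) ^+ 2 * (y + 2)).
      by field; rewrite !gt_eqF //; lra.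
    by rewrite divr_ge0 // mulr_ge0 ?sqr_ge0 //; lra.
  apply: le_trans (lerD (le_trans wa nn) H) _.
  by move: (2 / n.+1%:R) (2 / n.+2%:R) => x y; lra.
exists ((\bigcup_n near_list (l n)) `&` [set r | 0 < r]).
  apply: (@fin_meas_lists l 2) => [n x /mapP[j _ ->]|n x /mapP[j jn ->]|n] /=.
  - by rewrite /w invr_ge0 exprn_ge0.
  - apply: (map_f (fun a => (cmod a, w a))); move/hS: jn => [j1 j2]; apply/hS; split => //.
    by apply: le_trans j1 _; rewrite ler_nat.
  - rewrite big_map; apply: le_trans (key _ _ erefl (uS _) _) _; first by move=> a /hS[].
    by rewrite gerBl divr_ge0.
move=> r a s r0 nE us Ba hs; rewrite leNgt; apply/negP => H; apply: nE; split => //.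
exists (Num.bound (cmod a)) => //; exists (cmod a, w a).
  by apply: (map_f (fun a => (cmod a, w a))); apply/hS; split => //; exact: ltW (archi_boundP (cmod_ge0 _)).
have sS : (size (S (cmod a)) <= size s)%N by apply: uniq_leq_size => // b /hS[b1 b2]; exact: hs.
have S0 : (0 < size (S (cmod a)))%N.
  have : a \in S (cmod a) by apply/hS.
  by case: (S (cmod a)).
have H2 : (size (S (cmod a)))%:R ^+ 2 < `|r - cmod a|^-1.
  by apply: le_lt_trans H; rewrite lerXn2r ?nnegrE ?ler_nat.
have p2 : 0 < (size (S (cmod a)))%:R ^+ 2 :> R by rewrite exprn_gt0 // ltr0n.
have := lt_trans p2 H2; rewrite invr_gt0 => p3.
by rewrite /= /w -[leLHS]invrK lef_pV2 ?posrE ?invr_gt0 // ltW.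
Qed.

End ExceptionalSets.

(** * Estimates of g'/g off an exceptional set *)

Section LogDerivative.
Context {R : realType}.
Notation C := R[i].
Implicit Types (g : C -> C) (z a : C) (r : R).

Lemma T_inv_bound g : merNZ g -> exists2 c, 0 <= c &
  forall r, good g r -> nevanlinna_T r (fun w => (g w)^-1) <= nevanlinna_T r g + c.
Proof.
move=> mg; have [c hc] := first_fundamental mg; exists `|c| => [|r gr]; first exact: normr_ge0.
by rewrite (hc r gr); have := ler_norm (- c); rewrite normrN; lra.
Qed.

Lemma ler_sum_subset (s s' : seq C) (F : C -> R) : uniq s -> uniq s' -> {subset s <= s'} ->
  (forall a, a \in s' -> 0 <= F a) -> \sum_(a <- s) F a <= \sum_(a <- s') F a.
Proof.
move=> us us' ss F0.
have p : perm_eq s [seq a <- s' | a \in s].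
  apply: uniq_perm => //; first exact: filter_uniq.
  by move=> a; rewrite mem_filter; case: (boolP (a \in s)) => //= /ss ->.
rewrite (perm_big _ p) big_filter [leRHS](bigID (fun a => a \in s)) /= lerDl big_seq_cond.
by apply: sumr_ge0 => a /andP[/F0].
Qed.

Lemma size_order_sum f (s : seq C) : (forall a, a \in s -> order_at f a != 0) ->
  (size s)%:R <= \sum_(a <- s) `|order_at f a|%:~R :> R.
Proof.
elim: s => [_|b l ih h]; first by rewrite big_nil.
rewrite big_cons /= -natr1 addrC lerD //; last by apply: ih => a al; apply: h; rewrite inE al orbT.
by rewrite -[1]/(1%:~R) ler_int -gtz0_ge1 normr_gt0 h // inE eqxx.
Qed.

(** Each zero or pole of modulus at most x has weight at least ln(y/x) in N(y, 1/g) + N(y, g), which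
    is at most T(y, g) + T(y, 1/g). *)
Lemma order_sum_bound g x y (s : seq C) : merNZ g -> 1 <= x -> x < y -> good g y -> uniq s ->
  (forall a, a \in s -> cmod a <= x /\ bad g a) ->
  (\sum_(a <- s) `|order_at g a|%:~R) * ln (y / x) <= nevanlinna_T y g + nevanlinna_T y (fun w => (g w)^-1).
Proof.
move=> mg x1 xy gy us hs; have x0 : 0 < x by lra.
have y0 : 0 < y by lra.
have [s' [us' hs' hc]] := int_counting_list y0 (merNZ_discrete mg).
apply: (@le_trans _ _ (N_point y (fun _ => 0) g + N_pole y g)); last first.
  rewrite -N_poleV // /nevanlinna_T.
  have := @proximity_ge0 R y g; have := @proximity_ge0 R y (fun w => (g w)^-1); lra.
rewrite /N_point /N_pole !hc; [|exact: pole_mult_bad|exact: zero_mult_bad].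
rewrite -big_split /= mulr_suml.
have yx : 1 <= y / x by rewrite ler_pdivlMr // mul1r ltW.
have yy : 1 <= y by lra.
have E a : (zero_mult g a)%:R * radial y a + (pole_mult g a)%:R * radial y a = `|order_at g a|%:~R * radial y a.
  by rewrite -mulrDl -natrD -abs_order_mult -abszE -pmulrn.
under [leRHS]eq_bigr do rewrite -/(zero_mult g) E.
apply: (@le_trans _ _ (\sum_(a <- s) `|order_at g a|%:~R * radial y a)).
  rewrite !big_seq; apply: ler_sum => a /hs[ax _].
  rewrite ler_wpM2l ?ler0z ?normr_ge0 // /radial; case: eqVneq => [_|a0].
    by rewrite ler_ln ?posrE ?divr_gt0 // ler_pdivrMr // ler_peMr // ltW.
  have a1 : 0 < cmod a by rewrite cmod_gt0.
  by rewrite ler_ln ?posrE ?divr_gt0 // ler_pM2l // lef_pV2.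
apply: ler_sum_subset => //.
  by move=> a /hs[h1 h2]; apply/hs'; split => //; lra.
move=> a /hs'[ay _]; apply: mulr_ge0; first by rewrite ler0z.
exact: radial_ge0.
Qed.

Lemma ln_ratio (x y : R) : 0 < x -> 0 < y -> (y - x) / y <= ln (y / x).
Proof.
move=> x0 y0; have -> : ln (y / x) = - ln (x / y) by rewrite -lnV ?posrE ?divr_gt0 // invf_div.
have := @le_ln1Dx R (x / y - 1); rewrite addrCA subrr addr0.
have xy : 0 < x / y by rewrite divr_gt0.
have -> : (y - x) / y = 1 - x / y by rewrite mulrBl mulfV // gt_eqF.
by move=> H; have := H _; lra.
Qed.

(** Shifted so as to be at least 1 for r >= 1: Borel's lemma requires this, and the logarithm
    becomes nonnegative. *)
Definition T1 g r := nevanlinna_T r g + 1.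

(** [logder_bound] is used on a circle of radius x at distance about 1/T from r, where Borel's lemma
    keeps T below twice its value at r. A further radius y bounds the number n of zeros and poles by
    a multiple of r T^2, and [points_separation] bounds each 1/|z - a| by n^2. The dominant term n^3
    produces the exponent 6. *)
Lemma logder_pointwise g : merNZ g -> exists E K, [/\ fin_meas E, 0 <= K &
  forall r, 1 <= r -> ~ E r -> good g r /\
    forall z, cmod z = r -> cmod (cd g z / g z) <= K * (r * T1 g r) ^+ 6].
Proof.
move=> mg; have dB := merNZ_discrete mg; have [c c0 hc] := T_inv_bound mg.
have mono r1 r2 : good g r1 -> good g r2 -> r1 < r2 -> T1 g r1 <= T1 g r2.
  by move=> g1 g2 r12; rewrite lerD2r; exact: T_mono.
have [E1 fE1 hE1] := borel mono.
have dO : discrete (fun z => order_at g z != 0).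
  by apply: discreteS dB => z o0 /regular_order o1; rewrite o1 in o0.
have [E2 fE2 hE2] := points_separation dO.
have fE3 := fin_meas_countable (nonfree_countable dB).
set E3 := _ `&` _ in fE3.
(* 4 + c bounds T(p, g) + T(p, 1/g) in units of t at the auxiliary radii p, and 12 comes from
   ln(y/x) >= (y - x)/y >= 1/(12 r t), so n <= A r t^2. In the final constant 6 A belongs to the
   mean term, and 3 A + A^3 to the sum over zeros and poles. *)
pose A := 12 * (4 + c); exists (E1 `|` E2 `|` E3), (9 * A + A ^+ 3).
have A0 : 0 <= A by rewrite mulr_ge0 ?addr_ge0.
split; [by apply: fin_measU => //; exact: fin_measU|exact: addr_ge0 (mulr_ge0 _ A0) (exprn_ge0 _ A0)|].
move=> r r1 nE; have r0 : 0 < r by lra.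
have [nE1 nE2 nE3] : [/\ ~ E1 r, ~ E2 r & ~ E3 r].
  by split => h; apply: nE; [left; left|left; right|right].
have gr : good g r.
  by split => // z zr bz; apply: nE3; split => //; exists z.
split => // z zr; set t := T1 g r.
have t1 : 1 <= t by rewrite /t /T1 lerDr T_ge0.
have t0 : 0 < t by lra.
have d0 : 0 < t^-1 by rewrite invr_gt0.
have d1 : t^-1 <= 1 by rewrite invf_le1.
(* The windows for x and y leave both x - r and y - x of order 1/t while y stays below r + 1/t, the
   range of Borel's lemma. *)
have [x /andP[x1 x2] gx] : exists2 x, r + t^-1 / 3 < x < r + t^-1 * 2 / 3 & good g x.
  by apply: free_between => //; lra.
have [y /andP[y1 y2] gy] : exists2 y, x + t^-1 / 6 < y < x + t^-1 / 3 & good g y.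
  by apply: free_between => //; lra.
have Tx : T1 g x <= 2 * t by apply: hE1 => //; rewrite -/t; lra.
have Ty : T1 g y <= 2 * t by apply: hE1 => //; rewrite -/t; lra.
pose Q := (4 + c) * t.
have QE p : good g p -> T1 g p <= 2 * t -> nevanlinna_T p g + nevanlinna_T p (fun w => (g w)^-1) <= Q.
  move=> gp; rewrite /T1 => hp; have := hc p gp.
  have : c <= c * t by rewrite ler_peMr.
  rewrite /Q mulrDl; lra.
have x1' : 1 <= x by lra.
have [s us hs] := discrete_finite x dB; have [r0' xr0 hr0] := free_gap dB gx.
pose n : R := \sum_(a <- s) `|order_at g a|%:~R.
have n0 : 0 <= n by apply: sumr_ge0 => a _; rewrite ler0z.
have nA : n <= A * (r * t ^+ 2).
  have xy : x < y by lra.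
  have := le_trans (order_sum_bound mg x1' xy gy us (fun a h => (hs a).1 h)) (QE y gy Ty).
  rewrite -/n => H.
  have L : (12 * r * t)^-1 <= ln (y / x).
    apply: le_trans (ln_ratio (lt_le_trans ltr01 x1') (lt_trans (lt_le_trans ltr01 x1') xy)).
    have -> : (12 * r * t)^-1 = (t^-1 / 6) / (2 * r) by field; rewrite !gt_eqF.
    apply: ler_pM.
    - by rewrite divr_ge0 // ltW.
    - by rewrite invr_ge0 mulr_ge0 // ltW.
    - lra.
    - by rewrite lef_pV2 ?posrE ?mulr_gt0 //; lra.
  have p : 0 < 12 * r * t by rewrite !mulr_gt0.
  have : n * (12 * r * t)^-1 <= Q by apply: le_trans H; rewrite ler_wpM2l.
  rewrite ler_pdivrMr // /Q /A => H2; apply: le_trans H2 _.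
  by rewrite le_eqVlt; apply/orP; left; apply/eqP; ring.
have zs : z \notin s.
  by apply/negP => /hs[_]; apply; exact: good_regular gr zr.
have hs2 a : a \in s -> cmod a < x.
  move=> /hs[ax ba]; rewrite lt_neqAle ax andbT; apply/eqP => e; apply: ba.
  exact: good_regular gx e.
have ho w : cmod w < r0' -> w \notin s -> order_at g w = 0.
  move=> wr ws; apply: regular_order; apply: contrapT => bw.
  have [wx|/ltW wx] := leP (cmod w) x; first by move/negP: ws; apply; apply/hs.
  exact: hr0 wx wr bw.
have zx : cmod z < x by rewrite zr; lra.
apply: le_trans (logder_bound xr0 us hs2 (fun w _ => hord_ord w mg) ho (fun t => good_circle t gx) zx zs (good_regular gr zr)) _.
rewrite zr (rmean_ln gx).2.
have P1 : proximity x g + proximity x (fun w => (g w)^-1) <= Q.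
  apply: le_trans (QE x gx Tx); rewrite /nevanlinna_T.
  have := N_pole_ge0 mg x1'; have := N_pole_ge0 (merNZV mg) x1'; lra.
have P0 : 0 <= proximity x g + proximity x (fun w => (g w)^-1) by rewrite addr_ge0 ?proximity_ge0.
have xr : 0 < x - r by lra.
have ixr : (x - r)^-1 <= 3 * t.
  rewrite -[leRHS]invrK lef_pV2 ?posrE ?invr_gt0 ?mulr_gt0 //.
  by rewrite invfM; lra.
have rt1 : 1 <= r * t by rewrite (le_trans r1) // ler_peMr // ltW.
have pw (m : nat) : (m <= 6)%N -> (r * t) ^+ m <= (r * t) ^+ 6.
  by move=> m6; apply: ler_weXn2l.
have B1 : 4 * x / (x - r) ^+ 2 * (proximity x g + proximity x (fun w => (g w)^-1)) <= 6 * A * (r * t) ^+ 6.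
  apply: (@le_trans _ _ (6 * A * (r * t) ^+ 3)); last by rewrite ler_wpM2l ?pw // mulr_ge0.
  apply: (@le_trans _ _ (4 * (2 * r) * (3 * t) ^+ 2 * Q)).
    apply: ler_pM => //.
      by rewrite divr_ge0 ?sqr_ge0 //; lra.
    apply: ler_pM.
    - lra.
    - by rewrite invr_ge0 sqr_ge0.
    - lra.
    - by rewrite -exprVn lerXn2r ?nnegrE ?invr_ge0 ?mulr_ge0 // ltW.
  have -> : 4 * (2 * r) * (3 * t) ^+ 2 * Q = 6 * A * (r * t ^+ 3) by rewrite /Q /A; ring.
  apply: ler_wpM2l; first exact: (mulr_ge0 _ A0).
  rewrite exprMn; apply: ler_wpM2r; first exact: exprn_ge0 _ (ltW t0).
  by rewrite -{1}[r]expr1 ler_weXn2l.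
have B2 : \sum_(a <- s) `|order_at g a|%:~R * ((cmod (z - a))^-1 + (x - r)^-1) <= n * (n ^+ 2 + 3 * t).
  rewrite /n mulr_suml !big_seq; apply: ler_sum => a as_; rewrite -big_seq -/n.
  rewrite -/n; have [->|oa] := eqVneq (order_at g a) 0; first by rewrite normr0 !mul0r.
  rewrite ler_wpM2l ?ler0z // lerD //.
  have [ax ba] := (hs a).1 as_.
  have ra : r != cmod a by apply/eqP => e; apply: ba; exact: good_regular gr (esym e).
  have ra0 : 0 < `|r - cmod a| by rewrite normr_gt0 subr_eq0.
  have raz : `|r - cmod a| <= cmod (z - a).
    have h1 := cmod_leB z a; have := cmod_leB a z; rewrite -(opprB z a) cmodN => h2.
    by rewrite -zr ler_norml; lra.
  apply: (@le_trans _ _ `|r - cmod a|^-1).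
    by rewrite lef_pV2 ?posrE // (lt_le_trans ra0).
  pose s1 := [seq b <- s | order_at g b != 0].
  apply: (@le_trans _ _ ((size s1)%:R ^+ 2)).
    apply: hE2 => //; first exact: filter_uniq.
    move=> b ob ba'; rewrite mem_filter ob; apply/hs; split; first exact: le_trans ba' ax.
    by move/regular_order => ob0; rewrite ob0 eqxx in ob.
  rewrite lerXn2r ?nnegrE //; apply: (@le_trans _ _ (\sum_(b <- s1) `|order_at g b|%:~R)).
    by apply: size_order_sum => b; rewrite mem_filter => /andP[].
  apply: ler_sum_subset => //; first exact: filter_uniq.
    by move=> b; rewrite mem_filter => /andP[].
have B3 : n * (n ^+ 2 + 3 * t) <= A ^+ 3 * (r * t) ^+ 6 + 3 * A * (r * t) ^+ 6.
  have n3 : n ^+ 3 <= (A * (r * t ^+ 2)) ^+ 3.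
    by rewrite lerXn2r ?nnegrE // mulr_ge0 // mulr_ge0 ?exprn_ge0 // ltW.
  have -> : n * (n ^+ 2 + 3 * t) = n ^+ 3 + 3 * (n * t) by ring.
  apply: lerD.
    apply: le_trans n3 _; rewrite [leLHS]exprMn ler_wpM2l ?exprn_ge0 //.
    have -> : (r * t ^+ 2) ^+ 3 = r ^+ 3 * t ^+ 6 by ring.
    by rewrite exprMn ler_wpM2r ?exprn_ge0 ?(ltW t0) // ler_weXn2l.
  rewrite -mulrA ler_wpM2l //; apply: (@le_trans _ _ (A * (r * t ^+ 2) * t)).
    by rewrite ler_wpM2r // ltW.
  rewrite -mulrA ler_wpM2l //; apply: le_trans (pw 3 isT).
  have -> : r * t ^+ 2 * t = r * t ^+ 3 by ring.
  rewrite exprMn ler_wpM2r ?exprn_ge0 ?(ltW t0) //.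
  by rewrite -{1}[r]expr1 ler_weXn2l.
apply: (le_trans (lerD B1 (le_trans B2 B3))).
by rewrite le_eqVlt; apply/orP; left; apply/eqP; ring.
Qed.

Lemma logder_proximity g : merNZ g -> exists E K, fin_meas E /\
  forall r, 1 <= r -> ~ E r -> good g r /\
    proximity r (fun z => cd g z / g z) <= K + 6 * ln r + 6 * ln (T1 g r).
Proof.
move=> mg; have [E [K [fE K0 h]]] := logder_pointwise mg.
exists E, (log_plus K); split => // r r1 nE; have [gr hr] := h r r1 nE; split => //.
have r0 : 0 < r by lra.
have t1 : 1 <= T1 g r by rewrite /T1 lerDr T_ge0.
have t0 : 0 < T1 g r by lra.
have cts : circts (fun z => cd g z / g z) r.
  move=> t; have [hg g0] := good_circle t gr.
  by apply: ccontM; [apply: holo_cont; exact: holo_cd|apply: ccontV => //; exact: holo_cont].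
rewrite proximityE -[leRHS](rmean_cst r); apply: rmean_le.
- exact: circr_log_plus.
- exact: circr_cst.
move=> t; apply: le_trans (log_plus_le (hr _ _)) _; first by rewrite cmod_circle gtr0_norm.
apply: le_trans (log_plusM K0 _) _; first exact: exprn_ge0 _ (mulr_ge0 (ltW r0) (ltW t0)).
rewrite -addrA lerD2l -mulrDr -lnM ?posrE // -log_plus_big; first exact: log_plusX (mulr_ge0 (ltW r0) (ltW t0)).
by rewrite (le_trans r1) // ler_peMr // ltW.
Qed.

End LogDerivative.

(** * Growth of transcendental functions *)

Section Transcendence.
Context {R : realType}.
Notation C := R[i].
Implicit Types (f g u : C -> C) (z a : C) (r : R).

Lemma holo_hord_ge0 u z n : holo u z -> hord u z n -> 0 <= n.
Proof.
move=> hu hn; have [[j hj]|hv] := vanish_dichotomy hu; first by rewrite (hord_uniq hn hj).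
by exfalso; apply: (hord_nvanish hn); apply: cnearS hv => w h _.
Qed.

Lemma meromorphic_holo f z n : meromorphic f -> hord f z n -> 0 <= n -> holo f z.
Proof.
move=> mf hn n0; have [/holo_holomorphic_at //|/pole_hord[j hj]] := mf z.
by have := hord_uniq hn hj => e; rewrite e in n0.
Qed.

Lemma entire_const u : (forall z, holo u z) -> (forall z, cd u z = 0) -> forall z, u z = u 0.
Proof.
move=> hu du z; apply: (@cder0_const _ u (cmod z + 1)); last by rewrite ltrDl.
by move=> w _; rewrite -(du w); apply: cder_cd; exact: holo_cdif.
Qed.

Lemma cder_poly (P : {poly C}) z : cder (fun w => P.[w]) z P^`().[z].
Proof.
elim/poly_ind: P => [|P c ihP].
  by apply: (cder_eq (f := fun _ => 0)); [apply: cnearW => w; rewrite horner0|rewrite deriv0 horner0; exact: cder_cst].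
apply: (cder_eq (f := fun w => P.[w] * w + c)); first by apply: cnearW => w; rewrite hornerMXaddC.
rewrite derivD derivM derivX derivC addr0 mulr1 hornerD hornerMX addrC -[X in cder _ _ X]addr0.
apply: cderD; last exact: cder_cst.
by rewrite addrC -[X in _ + X]mulr1; apply: cderM => //; exact: cder_id.
Qed.

Lemma holo_poly (P : {poly C}) z : holo (fun w => P.[w]) z.
Proof. by apply: cnearW => w; eexists; exact: cder_poly. Qed.

Lemma mer_cdif g z : mer_at g z -> cnear z (fun w => w != z -> cdif g w).
Proof.
move=> /mer_atP[[n /hord_regular]|/cnear_near].
  by apply: cnearS => w h /h[/holo_cdif].
apply: cnearS => w h wz; apply: (cdif_eq (f := fun _ => 0)); last exact: cdif_cst.
by apply: cnearS (cnearI h (cnear_neq wz)) => x [h1 h2]; rewrite h1.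
Qed.

(** The polynomial found for g' is integrated to q. The difference g - q has derivative 0 off a
    discrete set, so its order is 0 everywhere unless it vanishes, and after regularization it is an
    entire constant. *)
Lemma iter_cd_vanish i : forall g, mer g -> (forall z, vanish_at (iter i (@cd R) g) z) ->
  exists p : {poly C}, forall z, cnear z (fun w => w != z -> g w = p.[w]).
Proof.
elim: i => [|i ih] g mg hg; first by exists 0 => z; apply: cnearS (hg z) => w h wz; rewrite [LHS]h // horner0.
have [|z|p hp] := ih (cd g); first by move=> z; exact: mer_at_cd.
  by have := hg z; rewrite iterSr.
pose q : {poly C} := \poly_(j < (size p).+1) (p`_j.-1 / j%:R).
have qp : q^`() = p.
  apply/polyP => j; rewrite coef_deriv coef_poly ltnS; case: ltnP => [js|js] /=.
    by rewrite -[LHS]mulr_natr divfK // pnatr_eq0.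
  by rewrite mul0rn nth_default.
pose k w := g w - q.[w].
have mk : mer k by move=> z; apply: mer_atD; [exact: mg|apply: mer_atN; apply: holo_mer; exact: holo_poly].
have vk z : vanish_at (cd k) z.
  apply: cnearS (cnearI (mer_cdif (mg z)) (hp z)) => w [h1 h2] wz.
  have := cderD (cder_cd (h1 wz)) (cderM (cder_cst (-1) w) (cder_poly q w)).
  rewrite mul0r add0r mulN1r qp h2 // subrr => H; apply: cd_cder; apply: cder_eq H.
  by apply: cnearW => x; rewrite mulN1r.
have [nk|hk] := mer_alt mk; last first.
  by exists q => z; apply: cnearS (hk z) => w h wz; apply/eqP; rewrite -subr_eq0; apply/eqP; exact: h.
have ok z : hord k z 0.
  have [n hn] := nk z; have [n0|n0] := eqVneq n 0; first by rewrite -n0.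
  by exfalso; exact: (hord_nvanish (hord_cd n0 hn) (vk z)).
have [v hv] : exists v, forall w, True -> holo v w /\ cnear w (fun x => x != w -> k x = v x).
  by apply: (@regularize R k (fun _ => True)) => w _; [exact: cnearW|case: (hord0_holo (ok w)) => v [? ? ?]; exists v].
have dv z : cd v z = 0.
  have [hz ez] := hv z I.
  apply: (@ccont_lim_eq R (cd v) (fun _ => 0)); [by apply: holo_cont; exact: holo_cd|exact: ccont_cst|].
  by apply: cnearS (cnearI (vk z) (cd_punctured ez hz)) => w [h1 h2] wz; rewrite -h2 ?h1.
have vc := entire_const (fun z => proj1 (hv z I)) dv.
exists (q + (v 0)%:P) => z; have [_ ez] := hv z I.
by apply: cnearS ez => w h wz; rewrite hornerD hornerC -(vc w) -h // /k addrC subrK.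
Qed.

(** A derivative vanishing identically would make f agree with a polynomial off a discrete set. Then
    f has no pole, and continuity gives equality everywhere, so f would be rational with denominator
    1. *)
Lemma transcendental_derivatives f i : transcendental_meromorphic f -> merNZ (iter i (@cd R) f).
Proof.
move=> [mf nf]; have mi j : mer (iter j (@cd R) f).
  by elim: j => [|j ih]; [exact: meromorphic_mer|move=> z; exact: mer_at_cd].
have [//|hv] := mer_alt (mi i); exfalso; apply: nf.
have [p hp] := iter_cd_vanish (meromorphic_mer mf) hv.
exists p, 1; rewrite oner_neq0; split=> // z _; rewrite hornerE divr1.
apply: (@ccont_lim_eq R f (fun w => p.[w])) => //; last by apply: holo_cont; exact: holo_poly.
case: (mf z) => [/holo_holomorphic_at/holo_cont //|/pole_hord[j hj]].
by have := holo_hord_ge0 (holo_poly p z) (hord_eq (hp z) hj).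
Qed.

Lemma order_support_finite f n : merNZ f ->
  (forall r (s : seq C), 1 <= r -> uniq s -> (forall a, a \in s -> cmod a <= r /\ order_at f a != 0) -> (size s <= n)%N) ->
  exists2 s, uniq s & forall a, a \in s <-> order_at f a != 0.
Proof.
move=> mf hn; have dO : discrete (fun z => order_at f z != 0).
  by apply: discreteS (merNZ_discrete mf) => z o0 /regular_order o1; rewrite o1 in o0.
pose S j := s2val (cid2 (@discrete_finite R _ j.+1%:R dO)).
have uS j : uniq (S j) by exact: (s2valP (cid2 (@discrete_finite R _ j.+1%:R dO))).
have hS j z : z \in S j <-> cmod z <= j.+1%:R /\ order_at f z != 0 by exact: (s2valP' (cid2 (@discrete_finite R _ j.+1%:R dO))).
have bS j : (size (S j) <= n)%N.
  by apply: (hn j.+1%:R) => //; [rewrite ler1n|move=> a /hS].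
(* The bounded sizes attain a maximum; every later list contains the corresponding one, hence has
   the same elements. *)
have [m [j ej] mx] : exists2 m, (exists j, size (S j) == m) & forall j, (size (S j) <= m)%N.
  have ex : exists m, `[< exists j, size (S j) = m >] by exists (size (S 0%N)); apply/asboolP; exists 0%N.
  have ub m : `[< exists j, size (S j) = m >] -> (m <= n)%N by move=> /asboolP[j <-].
  case: (ex_maxnP ex ub) => m /asboolP[j ej] h; exists m; first by exists j; apply/eqP.
  by move=> l; apply: h; apply/asboolP; exists l.
exists (S j) => // a; split=> [/hS[] //|oa].
pose l := maxn j (Num.bound (cmod a)).
have sub : {subset S j <= S l}.
  by move=> b /hS[b1 b2]; apply/hS; split => //; apply: le_trans b1 _; rewrite ler_nat ltnS leq_maxl.
have [|_ ->] := uniq_min_size (uS j) sub; first by rewrite (eqP ej) mx.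
apply/hS; split => //; apply: (le_trans (ltW (archi_boundP (cmod_ge0 a)))).
by rewrite ler_nat ltnW // ltnS leq_maxr.
Qed.

(** M zeros and poles of modulus at most x force M (ln y - ln x) <= 2 K ln y + c for arbitrarily
    large y, which fails as soon as M >= 2 K + 1. *)
Lemma log_growth_order f (K : R) : merNZ f -> 0 <= K ->
  (forall r0, exists2 r, r0 <= r & good f r /\ nevanlinna_T r f <= K * ln r) ->
  exists2 s, uniq s & forall a, a \in s <-> order_at f a != 0.
Proof.
move=> mf K0 H; have [c c0 hc] := T_inv_bound mf; pose M := 2 * K + 1.
apply: (@order_support_finite f (Num.bound M)) => // x s x1 us hs.
suff : (size s)%:R <= M.
  move=> h; have M0 : 0 <= M by rewrite /M; lra.
  by have := le_lt_trans h (archi_boundP M0); rewrite ltr_nat => /ltnW.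
rewrite leNgt; apply/negP => nM.
(* The lower bound makes ln y at least M ln x + c + 1, the amount by which M ln y exceeds the right
   side once M = 2 K + 1. *)
have [y y1 [gy Ty]] := H (Num.max (x + 1) (expR (M * ln x + c + 1))).
move: y1; rewrite ge_max => /andP[xy y1].
have xy' : x < y by lra.
have y0 : 0 < y by lra.
have x0 : 0 < x by lra.
have hs' a : a \in s -> cmod a <= x /\ bad f a.
  by move=> /hs[h1 h2]; split => // /regular_order h3; rewrite h3 in h2.
have B := order_sum_bound mf x1 xy' gy us hs'.
have L : M * ln x + c + 1 <= ln y by rewrite -[leLHS]expRK ler_ln ?posrE ?expR_gt0.
have lnxy : ln x <= ln y by rewrite ler_ln ?posrE // ltW.
have B2 : M * ln (y / x) <= (\sum_(a <- s) `|order_at f a|%:~R) * ln (y / x).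
  rewrite ler_wpM2r //; first by rewrite ln_div ?posrE // subr_ge0.
  by apply: le_trans (ltW nM) (size_order_sum _) => a /hs[].
have hTy := hc y gy; rewrite ln_div ?posrE // in B B2.
have : M * ln y = 2 * (K * ln y) + ln y by rewrite /M; ring.
have : M * (ln y - ln x) = M * ln y - M * ln x by ring.
move: (M * ln x) (M * ln y) (M * (ln y - ln x)) (K * ln y) L B B2 Ty hTy => *; lra.
Qed.

Lemma ln_small (b e : R) : 0 <= b -> 0 < e -> exists x0, 1 <= x0 /\ forall x, x0 <= x -> b * (ln x + 1) / x <= e.
Proof.
move=> b0 e0; exists (expR (4 * b / e)); have k0 : 0 <= 4 * b / e by rewrite divr_ge0 ?mulr_ge0 // ltW.
split => [|x hx]; first by rewrite -{1}(@expR0 R) ler_expR.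
have xp : 0 < x by rewrite (lt_le_trans _ hx) // expR_gt0.
set l := ln x; have lx : 4 * b / e <= l by rewrite /l -[leLHS]expRK ler_ln ?posrE ?expR_gt0.
have ex : x = expR (l / 2) ^+ 2 by rewrite -expRM_natl mulrC divfK ?lnK.
have e1 : 1 + l / 2 <= expR (l / 2) by exact: expR_ge1Dx.
have l0 : 0 <= l by exact: le_trans lx.
rewrite ler_pdivrMr // ex.
apply: (@le_trans _ _ (e * (1 + l / 2) ^+ 2)); last first.
  by rewrite ler_wpM2l ?(ltW e0) // lerXn2r ?nnegrE ?expR_ge0 //; lra.
have : 4 * b <= l * e by rewrite -ler_pdivrMr.
have el : 0 <= e * l by rewrite mulr_ge0 // ltW.
have -> : e * (1 + l / 2) ^+ 2 = e + e * l + (e * l) * l / 4 by field.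
move=> h; have : 4 * b * l <= l * e * l by rewrite ler_wpM2r.
lra.
Qed.

(* Dividing out the finitely many zeros and poles leaves an entire nonvanishing function v
   with m(r, v) + m(r, 1/v) = O(ln r) along a sequence, so that v' = 0. *)
Lemma log_growth f : transcendental_meromorphic f -> merNZ f -> forall K : R,
  exists r0, forall r, r0 <= r -> good f r -> K * ln r <= nevanlinna_T r f.
Proof.
move=> [merf nrat] mf K0; apply: contrapT => nH.
pose K := Num.max K0 0; have Kp : 0 <= K by rewrite /K le_max lexx orbT.
have H r0 : exists2 r, r0 <= r & good f r /\ nevanlinna_T r f <= K * ln r.
  apply: contrapT => nr; apply: nH; exists (Num.max r0 1) => r; rewrite ge_max => /andP[r1 r2] gr.
  rewrite leNgt; apply/negP => h; apply: nr; exists r => //; split => //.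
  by apply: le_trans (ltW h) _; rewrite ler_wpM2r ?ln_ge0 // /K le_max lexx.
have [s us hs] := log_growth_order mf Kp H.
apply: nrat; pose o a := order_at f a.
pose P w : C := \prod_(a <- s) (w - a) ^ (- o a).
have hu z : hord (fun w => f w * P w) z 0.
  have hP : hord P z (\sum_(a <- s) (z == a)%:Z * - o a).
    apply: (@hord_prod R _ s (fun a w => (w - a) ^ (- o a)) (fun a => (z == a)%:Z * - o a)) => a _.
    apply: hordXz; have [<-|za] := eqVneq z a; first exact: hord_subr.
    by apply: hord0; [exact: holo_subr|rewrite subr_eq0].
  have := hordM (hord_ord z mf) hP; rewrite (sum_at z (fun a => - o a) us).
  case: ifPn => [_|zs]; first by rewrite subrr.
  by have -> : order_at f z = 0; [apply/eqP; apply: contraNT zs => oz; apply/hs|rewrite addr0].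
have [v hv] : exists v, forall w, True -> holo v w /\ cnear w (fun x => x != w -> f x * P x = v x).
  apply: (@regularize R (fun w => f w * P w) (fun _ => True)) => w _; first exact: cnearW.
  by case: (hord0_holo (hu w)) => u [? ? ?]; exists u.
have dv w : cdif v w by apply: holo_cdif; case: (hv w I).
have v0 w : v w != 0.
  have [hw ew] := hv w I; have hord0w := hord_eq ew (hu w).
  by case: (holo_hord0_regular hw hord0w).
have [c c0 hc] := T_inv_bound mf.
pose n : R := \sum_(a <- s) `|o a|%:~R.
have n0 : 0 <= n by apply: sumr_ge0 => a _; rewrite ler0z.
pose m : R := \sum_(a <- s) cmod a.
have ms a : a \in s -> cmod a <= m.
  by move=> as_; rewrite /m (big_rem a) //= lerDl sumr_ge0 // => b _; exact: cmod_ge0.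
have m0 : 0 <= m by apply: sumr_ge0 => a _; exact: cmod_ge0.
have bound r : m + 1 <= r -> good f r -> nevanlinna_T r f <= K * ln r ->
    rmean r (fun w => `|ln (cmod (v w))|) <= (2 * K + c + n * 2) * (ln r + 1).
  move=> mr gr Tr; have r0 : 0 < r by lra.
  have r1 : 1 <= r by lra.
  have lr : 0 <= ln r by exact: ln_ge0.
  have gt1 a t : a \in s -> 1 <= cmod (circle_pt r t - a) /\ cmod (circle_pt r t - a) <= 2 * r.
    move=> /ms am; have := cmod_leB (circle_pt r t) a; have := cmodB_le (circle_pt r t) a.
    by rewrite cmod_circle gtr0_norm //; lra.
  have ns t : circle_pt r t \notin s.
    by apply/negP => /ms; rewrite cmod_circle gtr0_norm //; lra.
  have ve t : v (circle_pt r t) = f (circle_pt r t) * P (circle_pt r t).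
    set w := circle_pt r t; have [hw ew] := hv w I.
    apply: (@ccont_lim_eq R v (fun w => f w * P w)); first exact: holo_cont.
      apply: ccontM; first by apply: holo_cont; case: (good_circle t gr).
      apply: holo_cont; apply: (holo_prod (F := fun a w => (w - a) ^ (- o a))) => a as_.
      by apply: holo_exprz; apply: contraNneq (ns t) => e; rewrite -/w e.
    by apply: cnearS ew => x h xw; rewrite h.
  have gv : good v r by split => // z _; apply; split => //; case: (hv z I).
  have l2 : ln 2 <= 1 :> R.
    by have := @le_ln1Dx R 1; rewrite (_ : 1 + 1 = 2 :> R) //; apply; lra.
  have pt t : `|ln (cmod (v (circle_pt r t)))| <= `|ln (cmod (f (circle_pt r t)))| + n * (ln r + 1).
    set w := circle_pt r t.
    have fp : 0 < cmod (f w) by rewrite cmod_gt0; case: (good_circle t gr).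
    have pw a : a \in s -> 0 < cmod ((w - a) ^ (- o a)).
      by move=> as_; rewrite cmodXz exprz_gt0 // (lt_le_trans ltr01 (gt1 a t as_).1).
    have [lnP Pp] := @ln_prod R _ s (fun a => cmod ((w - a) ^ (- o a))) pw.
    rewrite ve -/w cmodM cmod_prod lnM ?posrE // lnP.
    apply: (le_trans (ler_normD _ _)); rewrite lerD2l.
    apply: (le_trans (ler_norm_sum _ _ _)); rewrite /n mulr_suml !big_seq; apply: ler_sum => a as_.
    have [h1 h2] := gt1 a t as_.
    rewrite cmodXz lnXz; last exact: lt_le_trans ltr01 h1.
    rewrite normrM (_ : `|(- o a)%:~R| = `|o a|%:~R :> R); last by rewrite mulrNz normrN intr_norm.
    rewrite ler_wpM2l ?ler0z //.
    rewrite ger0_norm ?ln_ge0 //.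
    apply: (@le_trans _ _ (ln (2 * r))); first by rewrite ler_ln ?posrE ?(lt_le_trans ltr01 h1) // mulr_gt0.
    by rewrite lnM ?posrE // addrC lerD2l.
  apply: (@le_trans _ _ (rmean r (fun w => `|ln (cmod (f w))| + n * (ln r + 1)))).
    apply: rmean_le.
    - by apply: circr_norm; exact: circr_ln.
    - by apply: circrD; [apply: circr_norm; exact: circr_ln|exact: circr_cst].
    - exact: pt.
  rewrite rmeanD; [|by apply: circr_norm; exact: circr_ln|exact: circr_cst].
  rewrite rmean_cst (rmean_ln gr).2.
  have := hc r gr; have := N_pole_ge0 mf r1; have := N_pole_ge0 (merNZV mf) r1.
  rewrite /nevanlinna_T in Tr *.
  have : 0 <= n * (ln r + 1) by rewrite mulr_ge0 //; lra.
  have : 0 <= c * ln r by rewrite mulr_ge0.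
  have -> : (2 * K + c + n * 2) * (ln r + 1) = 2 * (K * ln r) + 2 * K + c * ln r + c + 2 * (n * (ln r + 1)) by ring.
  move: (n * (ln r + 1)) (c * ln r) (K * ln r) Tr => *; lra.
have B0 : 0 <= 16 * (2 * K + c + n * 2) by rewrite mulr_ge0 // !addr_ge0 ?mulr_ge0.
have cdv z : cd v z = 0.
  suff : cmod (cd v z / v z) <= 0.
    by rewrite le_eqVlt ltNge cmod_ge0 orbF cmod_eq0 mulf_eq0 invr_eq0 (negbTE (v0 z)) orbF => /eqP.
  apply/ler_addgt0Pr => e e0; rewrite add0r.
  have [x0 [x01 hx0]] := ln_small B0 e0.
  have [r r1 [gr Tr]] := H (Num.max x0 (Num.max (m + 1) (2 * cmod z + 1))).
  move: r1; rewrite !ge_max => /and3P[r1 r2 r3].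
  have zr : cmod z < r by have := cmod_ge0 z; lra.
  have rp : 0 < r by lra.
  apply: le_trans (logder_nonvanish (r0 := r + 1) (fun w _ => conj (dv w) (v0 w)) zr _) _; first by lra.
  apply: le_trans (hx0 r r1).
  have -> : 16 * (2 * K + c + n * 2) * (ln r + 1) / r = 16 / r * ((2 * K + c + n * 2) * (ln r + 1)) by ring.
  apply: ler_pM.
  - by rewrite divr_ge0 ?sqr_ge0 // mulr_ge0 // ltW.
  - by apply: rmean_ge0 => t.
  - have q : 0 < (r - cmod z) ^+ 2 by rewrite exprn_gt0 // subr_gt0.
    rewrite ler_pdivrMr // mulrAC ler_pdivlMr // -mulrA.
    have : (r / 2) ^+ 2 <= (r - cmod z) ^+ 2 by rewrite lerXn2r ?nnegrE; lra.
    rewrite !expr2; lra.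
  - exact: bound.
have vc := entire_const (fun z => proj1 (hv z I)) cdv.
(* As [v] is constant, f d = p off [s]. Where d does not vanish, f is holomorphic, so equality holds
   there by continuity. *)
pose p : {poly C} := (v 0)%:P * \prod_(a <- s) ('X - a%:P) ^+ zero_mult f a.
pose d : {poly C} := \prod_(a <- s) ('X - a%:P) ^+ pole_mult f a.
have dE w : d.[w] = \prod_(a <- s) (w - a) ^+ pole_mult f a.
  by rewrite horner_prod; apply: eq_bigr => a _; rewrite horner_exp hornerXsubC.
have pE w : p.[w] = v 0 * \prod_(a <- s) (w - a) ^+ zero_mult f a.
  by rewrite hornerM hornerC horner_prod; congr (_ * _); apply: eq_bigr => a _; rewrite horner_exp hornerXsubC.
exists p, d; split.
  by apply: monic_neq0; apply: monic_prod => a _; apply: monic_exp; exact: monicXsubC.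
move=> z dz.
have oz : 0 <= order_at f z.
  rewrite leNgt; apply/negP => oz.
  have zs : z \in s by apply/hs; rewrite lt_eqF.
  move/negP: dz; apply; rewrite dE (big_rem z) //= subrr expr0n /pole_mult.
  by move: oz; case: (order_at f z) => // j _; rewrite mul0r.
have hf := meromorphic_holo merf (hord_ord z mf) oz.
apply: (canRL (mulfK dz)).
apply: (@ccont_lim_eq R (fun w => f w * d.[w]) (fun w => p.[w])).
- by apply: ccontM; apply: holo_cont => //; exact: holo_poly.
- by apply: holo_cont; exact: holo_poly.
have nz : cnear z (fun w => w != z -> w \notin s).
  have := merNZ_discrete mf z; apply: cnearS => w h wz; apply/negP => /hs ow.
  by apply: (h wz) => /regular_order e; rewrite e in ow.
have [_ ez] := hv z I; apply: cnearS (cnearI nz ez) => w [h1 h2] wz.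
have {h1} ws := h1 wz; rewrite pE -(vc w) -h2 // dE -mulrA; congr (_ * _).
rewrite /P -big_split /= !big_seq; apply: eq_bigr => a as_.
have wa : w - a != 0 by rewrite subr_eq0; apply: contraNneq ws => ->.
by rewrite !exprnP -expfzDr // /o order_mult opprB subrK.
Qed.

End Transcendence.

(** * Orders of sums, products and derivatives *)

Section Orders.
Context {R : realType}.
Notation C := R[i].
Implicit Types (f g h : C -> C) (z : C) (r : R) (n m l : int).

(** Taking out (w - z)^k, with k the smaller order, leaves a holomorphic difference, whose order is
    nonnegative. *)
Lemma hordB_ge g h z n m l : hord g z n -> hord h z m -> hord (fun w => g w - h w) z l -> Num.min n m <= l.
Proof.
move=> [g1 [hg g0 eg]] [h1 [hh h0 eh]] hl; set k := Num.min n m.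
have [i ni] : exists i : nat, n = k + i%:Z by exists `|n - k|%N; rewrite /k; lia.
have [j mj] : exists j : nat, m = k + j%:Z by exists `|m - k|%N; rewrite /k; lia.
pose u w := (w - z) ^+ i * g1 w - (w - z) ^+ j * h1 w.
have hu : holo u z.
  apply: holoD; first by apply: holoM => //; apply: holoX; exact: holo_subr.
  by apply: holoN; apply: holoM => //; apply: holoX; exact: holo_subr.
have hlk : hord (fun w => (g w - h w) * (w - z) ^ (- k)) z (l - k).
  by apply: hordM => //; have := hordXz (- k) (hord_subr z); rewrite mul1r.
have : 0 <= l - k; last by rewrite subr_ge0.
apply: holo_hord_ge0 hu _; apply: hord_eq hlk.
apply: cnearS (cnearI eg eh) => w [e1 e2] wz.
have wz0 : w - z != 0 by rewrite subr_eq0.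
rewrite e1 // e2 // ni mj !expfzDr // /u !exprnP; set x := (w - z) ^ k.
have x0 : x != 0 by rewrite expfz_neq0.
rewrite -invr_expz -/x; move: ((w - z) ^ i%:Z) ((w - z) ^ j%:Z) => p q.
by field.
Qed.

Lemma order_atM g h z : merNZ g -> merNZ h -> order_at (fun w => g w * h w) z = order_at g z + order_at h z.
Proof. by move=> mg mh; apply: hord_order_at; apply: hordM; exact: hord_ord. Qed.

Lemma order_cd_ge g z : merNZ g -> merNZ (cd g) -> 0 <= order_at g z -> 0 <= order_at (cd g) z.
Proof.
move=> mg mg' og; have [h0|h0] := eqVneq (order_at g z) 0; last first.
  by rewrite (hord_order_at (hord_cd h0 (hord_ord z mg))); lia.
have := hord_ord z mg; rewrite h0 => /hord0_holo[u [hu _ eu]].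
apply: (holo_hord_ge0 (holo_cd hu)); apply: hord_eq (hord_ord z mg').
exact: cd_punctured.
Qed.

Lemma order_iter_cd_ge g z i : (forall j, merNZ (iter j (@cd R) g)) -> 0 <= order_at g z ->
  0 <= order_at (iter i (@cd R) g) z.
Proof. move=> mg g0; elim: i => //= i ih.
by apply: order_cd_ge ih; [exact: (mg i)|exact: (mg i.+1)]. Qed.

Lemma merNZM g h : merNZ g -> merNZ h -> merNZ (fun w => g w * h w).
Proof. by move=> mg mh z; have [n hn] := mg z; have [m hm] := mh z; exists (n + m); exact: hordM. Qed.

Lemma merNZ_cst (c : C) : c != 0 -> merNZ (fun _ => c).
Proof. by move=> c0 z; exists 0; apply: hord0 => //; exact: holo_cst. Qed.

Lemma pole_multM g h z : merNZ g -> merNZ h ->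
  (pole_mult (fun w => (g w * h w)%R) z <= pole_mult g z + pole_mult h z)%N.
Proof.
by move=> mg mh; rewrite /pole_mult order_atM //; case: (order_at g z) => n; case: (order_at h z) => m; case E: (_ + _)%R => [l|l]; lia.
Qed.

Lemma pole_multB g h z : merNZ g -> merNZ h -> merNZ (fun w => g w - h w) ->
  (pole_mult (fun w => (g w - h w)%R) z <= pole_mult g z + pole_mult h z)%N.
Proof.
move=> mg mh md; have := hordB_ge (hord_ord z mg) (hord_ord z mh) (hord_ord z md).
rewrite /pole_mult; case: (order_at g z) => n; case: (order_at h z) => m; case: (order_at _ z) => l; lia.
Qed.

(** A pole of order p >= 1 becomes one of order p + 1 <= 2 p. The cruder form bounds N(r, g') by a
    multiple of N(r, g) alone, enough for a bound O(T). *)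
Lemma pole_mult_cd g z : merNZ g -> merNZ (cd g) -> (pole_mult (cd g) z <= 2 * pole_mult g z)%N.
Proof.
move=> mg mg'; have [hg|hg] := leP 0 (order_at g z).
  by have := order_cd_ge mg mg' hg; rewrite /pole_mult; case: (order_at (cd g) z).
rewrite /pole_mult (hord_order_at (hord_cd _ (hord_ord z mg))); last by rewrite lt_eqF.
by move: hg; case: (order_at g z) => n // _; rewrite NegzE; case E: (_ - 1) => [l|l]; lia.
Qed.

(** If [g] vanishes identically its order takes the default value 0 everywhere and no zero is
    counted. This case is included because M - phi may be identically 0. *)
Lemma mer_discrete_zero g : mer g -> discrete_mult (zero_mult g).
Proof.
move=> /mer_alt[|vg]; first exact: discrete_zero.
apply: discreteS discrete0 => z; rewrite zero_multE.
suff -> : order_at g z = 0 by [].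
rewrite /order_at; case: xgetP => [n _ /has_order_hord/hord_nvanish|//].
by move=> /(_ (vg z)).
Qed.

Lemma meromorphic_merNZ g : meromorphic g -> (exists z, g z != 0) -> merNZ g.
Proof.
move=> mg [z gz]; case: (mer_alt (meromorphic_mer mg)) => // vg.
case: (mg z) => [/holo_holomorphic_at hz|/pole_hord[j hj]]; last by case: (hord_nvanish hj).
exfalso; move/negP: gz; apply; apply/eqP.
by apply: (@ccont_lim_eq R g (fun _ => 0)); [exact: holo_cont|exact: ccont_cst|exact: vg].
Qed.

End Orders.

(** * Functions that are small or moderate with respect to f *)

Section Proximity.
Context {R : realType}.
Notation C := R[i].
Implicit Types (f g h : C -> C) (z : C) (r : R).

Lemma proximity_ext g h r : (forall t, g (circle_pt r t) = h (circle_pt r t)) -> proximity r g = proximity r h.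
Proof. by move=> e; rewrite !proximityE; apply: rmean_ext => t; rewrite e. Qed.

Lemma circtsM g h r : circts g r -> circts h r -> circts (fun w => g w * h w) r.
Proof. by move=> cg ch t; exact: ccontM. Qed.

Lemma circts_div g h r : good g r -> good h r -> circts (fun w => g w / h w) r.
Proof. by move=> gr hr; apply: circtsM; [exact: good_circts|exact: circtsV]. Qed.

Lemma proximityM g h r : circts g r -> circts h r ->
  proximity r (fun w => g w * h w) <= proximity r g + proximity r h.
Proof.
move=> cg ch; have c1 := circr_log_plus cg; have c2 := circr_log_plus ch.
rewrite !proximityE -rmeanD //; apply: rmean_le; [exact: circr_log_plus (circtsM cg ch)|exact: circrD|].
by move=> t; rewrite cmodM; apply: log_plusM; exact: cmod_ge0.
Qed.

Lemma proximityB g h r : circts g r -> circts h r ->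
  proximity r (fun w => g w - h w) <= proximity r g + proximity r h + ln 2.
Proof.
move=> cg ch; have c1 := circr_log_plus cg; have c2 := circr_log_plus ch.
have c3 := @circr_cst R (ln 2) r; have c4 := circrD c1 c2.
rewrite !proximityE -(rmean_cst r (ln 2)) -rmeanD // -rmeanD //; apply: rmean_le; [|exact: circrD|].
  by apply: circr_log_plus => t; apply: ccontD; [exact: cg|apply: ccontN; exact: ch].
move=> t; apply: le_trans (log_plus_le (cmodB_le _ _)) _; apply: log_plusD; exact: cmod_ge0.
Qed.

Lemma log_plusX_eq (x : R) n : 0 <= x -> log_plus (x ^+ n) = n%:R * log_plus x.
Proof.
move=> x0; have [x1|/ltW x1] := leP x 1.
  by rewrite !log_plus_small ?mulr0 // exprn_ile1.
rewrite !log_plus_big ?exprn_ege1 // lnXn ?mulr_natl //; exact: lt_le_trans x1.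
Qed.

Lemma proximityX g n r : circts g r -> proximity r (fun w => g w ^+ n) = n%:R * proximity r g.
Proof.
move=> cg; rewrite !proximityE -rmeanZ; last exact: circr_log_plus.
by apply: rmean_ext => t; rewrite cmodX log_plusX_eq ?cmod_ge0.
Qed.

Lemma circtsX g n r : circts g r -> circts (fun w => g w ^+ n) r.
Proof.
move=> cg; elim: n => [|n ih] t.
  by apply: (ccont_eq (f := fun _ => 1)); [exact: cnearW|exact: ccont_cst].
apply: (ccont_eq (f := fun w => g w * g w ^+ n)); first by apply: cnearW => w; rewrite exprS.
exact: ccontM.
Qed.

Lemma proximity1 r : proximity r (fun _ : C => 1) = 0.
Proof. by rewrite proximityE rmean_cst cmod1 log_plus_small. Qed.

Lemma proximity_prod (I : Type) (s : seq I) (F : I -> C -> C) r : (forall i, circts (F i) r) ->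
  circts (fun w => \prod_(i <- s) F i w) r /\
  proximity r (fun w => \prod_(i <- s) F i w) <= \sum_(i <- s) proximity r (F i).
Proof.
move=> cF; elim: s => [|i s [c ih]].
  split; first by move=> t; apply: (ccont_eq (f := fun _ => 1)); [apply: cnearW => w; rewrite big_nil|exact: ccont_cst].
  by rewrite big_nil (@proximity_ext _ (fun _ => 1)) ?proximity1 // => t; rewrite big_nil.
split.
  move=> t; apply: (ccont_eq (f := fun w => F i w * \prod_(j <- s) F j w)); first by apply: cnearW => w; rewrite big_cons.
  by apply: ccontM; [exact: cF|exact: c].
rewrite big_cons (@proximity_ext _ (fun w => F i w * \prod_(j <- s) F j w)); last by move=> t; rewrite big_cons.
by apply: le_trans (proximityM (cF i) c) _; rewrite lerD2l.
Qed.

Lemma N_pole_cst (c : C) r : 0 < r -> c != 0 -> N_pole r (fun _ => c) = 0.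
Proof.
move=> r0 c0; have [s [_ hs]] := int_counting_list r0 (@discrete0 R); rewrite /N_pole => ->.
  by case: s hs => [|a s] hs; [rewrite big_nil|case: ((hs a).1 (mem_head a s))].
move=> z /pole_mult_bad; apply; split => //; exact: holo_cst.
Qed.

Lemma N_zero_le_T g r : merNZ g -> N_point r (fun _ => 0) g <= nevanlinna_T r (fun w => (g w)^-1).
Proof. by move=> mg; rewrite -N_poleV // lerDr proximity_ge0. Qed.

End Proximity.

(** * Error terms and functions of growth O(T(r, f)) *)

Section Asymptotics.
Context {R : realType}.
Notation C := R[i].
Notation T := (fun g r => nevanlinna_T r g).
Implicit Types (f g h : C -> C) (S : R -> R) (P Q : R -> Prop) (r e : R).

(** Validity for all large r outside a set of finite measure; finitely many such statements can be
    used simultaneously. *)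
Definition off P := exists E, fin_meas E /\ exists r0 : R, forall r, r0 <= r -> ~ E r -> P r.

Lemma offI P Q : off P -> off Q -> off (fun r => P r /\ Q r).
Proof.
move=> [E [fE [x hx]]] [E' [fE' [x' hx']]]; exists (E `|` E'); split; first exact: fin_measU.
exists (Num.max x x') => r; rewrite ge_max => /andP[h1 h2] nE; split.
  by apply: hx => // h; apply: nE; left.
by apply: hx' => // h; apply: nE; right.
Qed.

Lemma offS P Q : (forall r, P r -> Q r) -> off P -> off Q.
Proof. by move=> h [E [fE [x hx]]]; exists E; split => //; exists x => r h1 h2; apply: h; exact: hx. Qed.

Lemma fin_meas0 : fin_meas (@set0 R).
Proof. by split => //; rewrite measure0. Qed.

Lemma off_ge (x : R) : off (fun r => x <= r).
Proof. by exists set0; split; [exact: fin_meas0|exists x]. Qed.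

Lemma off_good g : merNZ g -> off (good g).
Proof.
move=> mg; have fE := fin_meas_countable (nonfree_countable (merNZ_discrete mg)).
eexists; split; [exact: fE|exists 1 => r r1 nE]; have r0 : 0 < r by lra.
by split => // z zr bz; apply: nE; split => //; exists z.
Qed.

Definition small f S := exists E, fin_meas E /\ forall e, 0 < e ->
  exists r0 : R, forall r, r0 <= r -> ~ E r -> `|S r| <= e * T f r.

Lemma small_is_S f S : small f S <-> is_S f S.
Proof.
split=> [[E [[mE pE fE] h]]|[E [mE pE fE h]]].
  exists E; split => // e e0; have [r0 hr] := h e e0.
  by exists r0; split; [exact: num_real|move=> r /ltW rr; exact: hr].
exists E; split; first by split.
move=> e e0; have [r0 [_ hr]] := h e e0; exists (r0 + 1) => r rr; apply: hr.
by rewrite (lt_le_trans _ rr) // ltrDl.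
Qed.

Lemma smallD f S1 S2 : small f S1 -> small f S2 -> small f (fun r => S1 r + S2 r).
Proof.
move=> [E [fE h]] [E' [fE' h']]; exists (E `|` E'); split; first exact: fin_measU.
move=> e e0; have e2 : 0 < e / 2 by rewrite divr_gt0.
have [x hx] := h _ e2; have [x' hx'] := h' _ e2; exists (Num.max x x') => r; rewrite ge_max => /andP[h1 h2] nE.
have k1 := hx r h1 (fun p => nE (or_introl p)); have k2 := hx' r h2 (fun p => nE (or_intror p)).
apply: le_trans (ler_normD _ _) _; rewrite [e]splitr mulrDl; exact: lerD.
Qed.

Lemma small_le f S1 S2 : off (fun r => `|S1 r| <= `|S2 r|) -> small f S2 -> small f S1.
Proof.
move=> [E [fE [x hx]]] [E' [fE' h']]; exists (E `|` E'); split; first exact: fin_measU.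
move=> e e0; have [x' hx'] := h' _ e0; exists (Num.max x x') => r; rewrite ge_max => /andP[h1 h2] nE.
apply: le_trans (hx r h1 (fun p => nE (or_introl p))) _; exact: hx' r h2 (fun p => nE (or_intror p)).
Qed.

Lemma smallZ f k S : small f S -> small f (fun r => k * S r).
Proof.
move=> [E [fE h]]; exists E; split => // e e0.
have k1 : 0 < `|k| + 1 by rewrite ltr_wpDl.
have [x hx] := h _ (divr_gt0 e0 k1); exists x => r h1 nE; have := hx r h1 nE.
rewrite mulrAC ler_pdivlMr // normrM => H; apply: le_trans _ H.
by rewrite mulrC ler_wpM2l // lerDl.
Qed.

Lemma small_sum f (I : Type) (s : seq I) (S : I -> R -> R) : small f (fun _ => 0) ->
  (forall i, small f (S i)) -> small f (fun r => \sum_(i <- s) S i r).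
Proof.
move=> h0 h; elim: s => [|i s ih]; first by under [X in small f X]funext do rewrite big_nil.
by under [X in small f X]funext do rewrite big_cons; exact: smallD.
Qed.

Section Fixed.
Variable f : C -> C.
Hypothesis tf : transcendental_meromorphic f.

Lemma merNZf : merNZ f.
Proof. exact: transcendental_derivatives 0%N tf. Qed.

Lemma off_log (k : R) : off (fun r => k * ln r <= T f r).
Proof.
have [r0 h] := log_growth tf merNZf k.
apply: offS (offI (off_ge r0) (off_good merNZf)) => r [h1 h2]; exact: h.
Qed.

Lemma ln_ge (x : R) : exists r0, forall r : R, r0 <= r -> x <= ln r.
Proof.
by exists (expR x) => r h; rewrite -[leLHS]expRK ler_ln ?posrE ?expR_gt0 // (lt_le_trans (expR_gt0 _) h).
Qed.

(** Here transcendence becomes an asymptotic statement: [log_growth] with constant 1/e gives ln r <=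
    e T(r, f) at large good radii. Constants are then small as well. *)
Lemma small_ln : small f (@ln R).
Proof.
have [E [fE _]] := off_good merNZf.
have fE1 := fin_meas_countable (nonfree_countable (merNZ_discrete merNZf)).
eexists; split; [exact: fE1|move=> e e0]; have [r0 h] := log_growth tf merNZf e^-1.
exists (Num.max r0 1) => r; rewrite ge_max => /andP[h1 r1] nE; have rp : 0 < r by lra.
have gr : good f r by split => // z zr bz; apply: nE; split => //; exists z.
by rewrite ger0_norm ?ln_ge0 // -ler_pdivrMl //; exact: h.
Qed.

Lemma small_cst (c : R) : small f (fun _ => c).
Proof.
apply: small_le (smallZ c small_ln); have [r0 h] := ln_ge 1.
apply: offS (off_ge r0) => r /h r1; rewrite normrM ler_peMr // ger0_norm //; lra.
Qed.

Lemma off_T_ge (x : R) : off (fun r => x <= T f r).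
Proof.
have [r0 h] := ln_ge x; apply: offS (offI (off_ge r0) (off_log 1)) => r [/h h1].
by rewrite mul1r; exact: le_trans.
Qed.

Lemma small_lnT : small f (fun r => ln (T f r)).
Proof.
have fE1 := fin_meas_countable (nonfree_countable (merNZ_discrete merNZf)).
eexists; split; [exact: fE1|move=> e e0]; have [r0 h] := log_growth tf merNZf 1.
have [x0 [x01 hx0]] := ln_small ler01 e0; have [r2 hr2] := ln_ge x0.
exists (Num.max r0 (Num.max 1 r2)) => r; rewrite !ge_max => /and3P[h1 r1 hr] nE; have rp : 0 < r by lra.
have gr : good f r by split => // z zr bz; apply: nE; split => //; exists z.
have := h r h1 gr; rewrite mul1r => hT.
have xT : x0 <= T f r by apply: le_trans hT; exact: hr2.
have := hx0 _ xT; rewrite mul1r ler_pdivrMr; last by lra.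
rewrite ger0_norm; last by rewrite ln_ge0 // (le_trans x01).
lra.
Qed.

(** Growth O(T(r, f)) is what makes ln T(r, g), and hence m(r, g'/g), an error term for f. The class
    is closed under the operations that build M, G and G - 1 from f, a and phi. *)
Definition moderate g := merNZ g /\ exists c : R, off (fun r => T g r <= c * T f r).

Lemma moderate_log g : moderate g -> small f (fun r => ln (T1 g r)).
Proof.
move=> [mg [c hc]]; pose k := `|c| + 1.
apply: small_le (smallD (small_cst (ln k)) small_lnT).
apply: offS (offI hc (offI (off_ge 1) (off_T_ge 1))) => r [h1 [r1 h2]].
have k1 : 1 <= k by rewrite lerDr normr_ge0.
have t1 : 1 <= T1 g r by rewrite /T1 lerDr T_ge0.
have t2 : T1 g r <= k * T f r.
  by rewrite /T1 mulrDl mul1r lerD // (le_trans h1) // ler_wpM2r ?ler_norm //; lra.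
rewrite ger0_norm ?ln_ge0 // ger0_norm; last by rewrite addr_ge0 ?ln_ge0.
by rewrite -lnM ?posrE ?ler_ln ?posrE ?mulr_gt0 //; lra.
Qed.

Lemma moderate_logder g : moderate g -> small f (fun r => proximity r (fun z => cd g z / g z)).
Proof.
move=> hg; have [mg _] := hg; have [E [K [fE h]]] := logder_proximity mg.
apply: small_le (smallD (smallD (small_cst K) (smallZ 6 small_ln)) (smallZ 6 (moderate_log hg))).
exists E; split => //; exists 1 => r r1 nE; have [_ h2] := h r r1 nE.
by rewrite ger0_norm ?proximity_ge0 // (le_trans h2) // ler_norm.
Qed.

Lemma small_squeeze S1 S2 : off (fun r => 0 <= S1 r <= S2 r) -> small f S2 -> small f S1.
Proof.
move=> h; apply: small_le; apply: offS h => r /andP[h1 h2].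
by rewrite ger0_norm // (le_trans h2) // ler_norm.
Qed.

Lemma moderate_of_small g S : merNZ g -> small f S -> off (fun r => T g r <= S r) -> moderate g.
Proof.
move=> mg [E [fE h]] hT; split => //; exists 1; have [r0 hr] := h 1 ltr01.
have hS : off (fun r => S r <= 1 * T f r).
  by exists E; split => //; exists r0 => r rr nE; apply: le_trans (hr r rr nE); exact: ler_norm.
by apply: offS (offI hT hS) => r [h1 h2]; exact: le_trans h1 h2.
Qed.

Lemma moderate_f : moderate f.
Proof. by split; [exact: merNZf|exists 1; apply: offS (off_ge 0) => r _; rewrite mul1r]. Qed.

Lemma moderate_cst (c : C) : c != 0 -> moderate (fun _ => c).
Proof.
move=> c0; apply: (moderate_of_small (merNZ_cst c0) (small_cst (log_plus (cmod c)))).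
by apply: offS (off_ge 1) => r r1; rewrite /nevanlinna_T N_pole_cst ?addr0 ?proximityE ?rmean_cst //; lra.
Qed.

Lemma moderateM g h : moderate g -> moderate h -> moderate (fun w => g w * h w).
Proof.
move=> [mg [c hc]] [mh [d hd]]; split; first exact: merNZM.
exists (c + d); apply: offS (offI (offI hc hd) (offI (off_ge 1) (offI (off_good mg) (off_good mh)))).
move=> r [[h1 h2] [r1 [gr hr]]]; rewrite mulrDl; apply: le_trans (lerD h1 h2); rewrite /nevanlinna_T.
have := proximityM (good_circts gr) (good_circts hr).
have : N_pole r (fun w => g w * h w) <= N_pole r g + N_pole r h.
  rewrite /N_pole -int_countingD ?(lt_le_trans ltr01 r1) //; try exact: discrete_pole.
  apply: int_counting_le => //; last by move=> z; exact: pole_multM.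
  by apply: discrete_multD; exact: discrete_pole.
lra.
Qed.

Lemma moderateV g : moderate g -> moderate (fun w => (g w)^-1).
Proof.
move=> [mg [c hc]]; split; first exact: merNZV.
have [d d0 hd] := T_inv_bound mg; exists (c + 1).
apply: offS (offI hc (offI (off_good mg) (off_T_ge d))) => r [h1 [gr h2]].
by have := hd r gr; rewrite mulrDl mul1r; lra.
Qed.

Lemma moderateB g h : moderate g -> moderate h -> merNZ (fun w => g w - h w) -> moderate (fun w => g w - h w).
Proof.
move=> [mg [c hc]] [mh [d hd]] md; split => //; exists (c + d + 1).
apply: offS (offI (offI hc hd) (offI (off_ge 1) (offI (off_T_ge (ln 2)) (offI (off_good mg) (off_good mh))))).
move=> r [[h1 h2] [r1 [h3 [gr hr]]]]; rewrite 2!mulrDl mul1r; apply: le_trans (lerD (lerD h1 h2) h3); rewrite /nevanlinna_T.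
have := proximityB (good_circts gr) (good_circts hr).
have : N_pole r (fun w => g w - h w) <= N_pole r g + N_pole r h.
  rewrite /N_pole -int_countingD ?(lt_le_trans ltr01 r1) //; try exact: discrete_pole.
  apply: int_counting_le => //; last by move=> z; exact: pole_multB.
  by apply: discrete_multD; exact: discrete_pole.
lra.
Qed.

Lemma moderateX g n : moderate g -> moderate (fun w => g w ^+ n).
Proof.
move=> hg; elim: n => [|n ih].
  have -> : (fun w => g w ^+ 0) = (fun _ => 1) by apply/funext.
  exact: (moderate_cst (oner_neq0 _)).
have -> : (fun w => g w ^+ n.+1) = (fun w => g w * g w ^+ n) by apply/funext => w; rewrite exprS.
exact: moderateM.
Qed.

Lemma moderate_prod (I : Type) (s : seq I) (F : I -> C -> C) : (forall i, moderate (F i)) ->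
  moderate (fun w => \prod_(i <- s) F i w).
Proof.
move=> hF; elim: s => [|i s ih].
  have -> : (fun w => \prod_(i <- [::]) F i w) = (fun _ => 1) by apply/funext => w; rewrite big_nil.
  exact: (moderate_cst (oner_neq0 _)).
have -> : (fun w => \prod_(i <- i :: s) F i w) = (fun w => F i w * \prod_(j <- s) F j w).
  by apply/funext => w; rewrite big_cons.
exact: moderateM.
Qed.

Lemma moderate_cd g : moderate g -> merNZ (cd g) -> moderate (cd g).
Proof.
move=> hg mg'; have [mg [c hc]] := hg; have [E [fE h]] := moderate_logder hg.
have [r0 hr0] := h 1 ltr01; split => //; exists (1 + c * 2).
have hL : off (fun r => proximity r (fun z => cd g z / g z) <= T f r).
  exists E; split => //; exists r0 => r rr nE; have := hr0 r rr nE; rewrite mul1r.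
  by apply: le_trans; exact: ler_norm.
apply: offS (offI (offI hc hL) (offI (off_ge 1) (offI (off_good mg) (off_good mg')))).
move=> r [[h1 h2] [r1 [gr gr']]].
have cq : circts (fun z => cd g z / g z) r by exact: circts_div.
have P1 : proximity r (cd g) <= proximity r (fun z => cd g z / g z) + proximity r g.
  rewrite (@proximity_ext _ (cd g) (fun z => cd g z / g z * g z)).
    by apply: proximityM => //; exact: good_circts.
  by move=> t; rewrite divfK //; case: (good_circle t gr).
have N1 : N_pole r (cd g) <= 2 * N_pole r g.
  rewrite /N_pole -int_countingZ ?(lt_le_trans ltr01 r1) //; last exact: discrete_pole.
  apply: int_counting_le => //; last by move=> z; exact: pole_mult_cd.
  by apply: discrete_multZ; exact: discrete_pole.
rewrite mulrDl mul1r mulrAC; move: h1; rewrite /nevanlinna_T in h2 *.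
have := proximity_ge0 r g; lra.
Qed.

Lemma merNZ_D i : merNZ (iter i (@cd R) f).
Proof. exact: transcendental_derivatives. Qed.

Lemma moderate_D i : moderate (iter i (@cd R) f).
Proof. by elim: i => [|i ih]; [exact: moderate_f|apply: moderate_cd ih _; exact: merNZ_D i.+1]. Qed.

(** The quotient f^(i+1)/f is the logarithmic derivative of f^(i) times f^(i)/f, and each f^(i) is
    moderate. *)
Lemma small_ratio i : small f (fun r => proximity r (fun z => iter i (@cd R) f z / f z)).
Proof.
elim: i => [|i ih].
  apply: small_squeeze (small_cst 0); apply: offS (off_good merNZf) => r gr.
  rewrite (@proximity_ext _ _ (fun _ => 1)) ?proximity1 ?lexx // => t.
  by rewrite divff //; case: (good_circle t gr).
apply: small_squeeze (smallD (moderate_logder (moderate_D i)) ih).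
apply: offS (offI (off_good merNZf) (offI (off_good (merNZ_D i)) (off_good (merNZ_D i.+1)))) => r [gr [gi gi']].
rewrite proximity_ge0 /=.
rewrite (@proximity_ext _ _ (fun z => cd (iter i (@cd R) f) z / iter i (@cd R) f z * (iter i (@cd R) f z / f z))).
  by apply: proximityM; exact: circts_div.
by move=> t; rewrite mulrA divfK //; case: (good_circle t gi).
Qed.

Lemma small_function_T b : small_function f b -> [/\ merNZ b, moderate b, small f (fun r => T b r) &
  small f (fun r => T (fun w => (b w)^-1) r)].
Proof.
move=> [mb nb /small_is_S sb]; have mz := meromorphic_merNZ mb nb; split => //.
  by apply: (moderate_of_small mz sb); apply: offS (off_ge 0).
have [c c0 hc] := T_inv_bound mz.
apply: small_squeeze (smallD sb (small_cst c)); apply: offS (offI (off_ge 1) (off_good mz)) => r [r1 gr].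
by rewrite T_ge0 ?hc //; exact: merNZV.
Qed.

End Fixed.
End Asymptotics.

(** * The differential monomial *)

Section Monomial.
Context {R : realType}.
Notation C := R[i].
Notation T := (fun g r => nevanlinna_T r g).
Variables (f phi a : C -> C) (k : nat) (q : nat -> nat).
Hypothesis tf : transcendental_meromorphic f.
Hypothesis sphi : small_function f phi.
Hypothesis sa : small_function f a.

Let D i := iter i (@cd R) f.
Let mu := (\sum_(i < k.+1) q i)%N.
Let M w := a w * \prod_(i < k.+1) D i w ^+ q i.
Let G w := M w / phi w.
Let G1 w := G w - 1.
Let h w := cd G1 w / G1 w.
(** This is G/f^mu, written with the quotients f^(i)/f so that m(r, Q) = S(r, f) can be read off. *)
Let Q w := a w / phi w * \prod_(i < k.+1) (D i w / f w) ^+ q i.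
Let mf : merNZ f := merNZf tf.
Let mD i : merNZ (D i) := merNZ_D tf i.

Let ma : merNZ a. Proof. by case: (small_function_T tf sa). Qed.
Let mphi : merNZ phi. Proof. by case: (small_function_T tf sphi). Qed.

Let moderate_M : moderate f M.
Proof.
apply: moderateM; first by case: (small_function_T tf sa).
by apply: (moderate_prod tf) => i; apply: (moderateX tf); exact: moderate_D.
Qed.

Let moderate_G : moderate f G.
Proof.
by apply: moderateM => //; apply: (moderateV tf); case: (small_function_T tf sphi).
Qed.

Let mG : merNZ G. Proof. by case: moderate_G. Qed.
Let mM : merNZ M. Proof. by case: moderate_M. Qed.

Let merG1 : mer G1.
Proof. by move=> z; apply: mer_atD; [exact: merNZ_mer|apply: mer_atN; exact: mer_at_cst]. Qed.

Lemma cd_G1 w : cdif G w -> cd G1 w = cd G w.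
Proof.
move=> dG; apply: cd_cder; rewrite -[cd G w]addr0.
have := cderD (cder_cd dG) (cder_cst (-1) w).
by [].
Qed.

Lemma cd_G1_near z : cnear z (fun w => w != z -> cd G1 w = cd G w).
Proof. by apply: cnearS (mer_cdif (merNZ_mer mG z)) => w h1 /h1; exact: cd_G1. Qed.

Lemma order_G z : order_at G z = order_at a z + \sum_(i < k.+1) order_at (D i) z * (q i)%:Z - order_at phi z.
Proof.
apply: hord_order_at; apply: hordM; last by apply: hordV; exact: hord_ord.
apply: hordM; first exact: hord_ord.
apply: (@hord_prod R 'I_k.+1 (index_enum _) (fun i w => D i w ^+ q i) (fun i => order_at (D i) z * (q i)%:Z)) => i _.
by  apply: hordX; exact: hord_ord.
Qed.

Lemma order_D_sum z : 0 <= order_at f z -> order_at f z * (q 0)%:Z <= \sum_(i < k.+1) order_at (D i) z * (q i)%:Z.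
Proof.
move=> f0; rewrite big_ord_recl lerDl sumr_ge0 // => i _.
by rewrite mulr_ge0 //; apply: order_iter_cd_ge => // j; exact: mD.
Qed.

Lemma leq_q0 : (q 0 <= mu)%N.
Proof. by rewrite /mu big_ord_recl leq_addr. Qed.

(* When G has a zero of order n >= 1 at a zero of f, the function h = G'/(G - 1) vanishes there to the order n - 1. *)
Lemma mult_inequality z : merNZ G1 -> merNZ (cd G1) ->
  (pole_mult h z + mu * zero_mult f z <= zero_mult h z + reduced_mult (pole_mult f) z
   + (mu - q 0) * zero_mult f z + reduced_mult (zero_mult f) z + reduced_mult (zero_mult (fun w => (M w - phi w)%R)) z
   + (zero_mult a z + pole_mult a z + zero_mult phi z + pole_mult phi z))%N.
Proof.
move=> mG1 mG1'.
(* At a zero of G the function G - 1 takes a nonzero value, and both have the same derivative. *)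
have oG1 : 1 <= order_at G z -> order_at G1 z = 0 /\ order_at (cd G1) z = order_at G z - 1.
  move=> n1; split; last first.
    apply: hord_order_at; apply: hord_eq (hord_cd _ (hord_ord z mG)); last by rewrite gt_eqF.
    by apply: cnearS (cd_G1_near z) => w e wz; symmetry; exact: e.
  have b1 := hordB_ge (hord_ord z mG) (hord0 (holo_cst 1 z) (oner_neq0 _)) (hord_ord z mG1).
  have b2 : Num.min (order_at G z) (order_at G1 z) <= 0.
    apply: hordB_ge (hord_ord z mG) (hord_ord z mG1) _.
    apply: (hord_eq (f := fun _ => 1)); last exact: hord0 (holo_cst 1 z) (oner_neq0 _).
    by apply: cnearW => w _; rewrite /G1 opprB addrCA subrr addr0.
  lia.
have oG1' : 0 <= order_at G z -> 0 <= order_at G1 z.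
  have := hordB_ge (hord_ord z mG) (hord0 (holo_cst 1 z) (oner_neq0 _)) (hord_ord z mG1); lia.
have oc1 : order_at G1 z <> 0 -> order_at (cd G1) z = order_at G1 z - 1.
  by move=> /eqP n0; apply: hord_order_at; apply: hord_cd => //; exact: hord_ord.
have oc0 : order_at G1 z = 0 -> 0 <= order_at (cd G1) z.
  by move=> e; apply: order_cd_ge => //; rewrite e.
have oh : order_at h z = order_at (cd G1) z - order_at G1 z.
  by apply: hord_order_at; apply: hordM; [|apply: hordV]; exact: hord_ord.
have om : order_at (fun w => M w - phi w) z = order_at phi z + order_at G1 z.
  apply: hord_order_at; apply: hord_eq (hordM (hord_ord z mphi) (hord_ord z mG1)).
  apply: cnearS (hord_regular (hord_ord z mphi)) => w hw /hw[_ p0].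
  by rewrite /G1 /G mulrBr mulr1 mulrC divfK.
have := order_G z; have := @order_D_sum z; set s := \sum_(i < _) _.
have -> : (mu * zero_mult f z = (mu - q 0) * zero_mult f z + q 0 * zero_mult f z)%N.
  by rewrite -mulnDl subnK // leq_q0.
rewrite /reduced_mult /pole_mult !zero_multE om oh.
move: (mu - q 0)%N => m.
move: (order_at G z) (order_at G1 z) (order_at (cd G1) z) (order_at f z) (order_at a z) (order_at phi z) oG1 oG1' oc1 oc0.
move=> n n1 c1 p oa op h1 h2 h3 h4 h5 h6.
(* At a zero of f with n >= 1, the zero of h of order n - 1 and the reduced zero of f together give
   n, which covers q_0 p up to the orders of a and phi. With n <= 0, those orders cover q_0 p and
   the reduced zero covers a simple pole of h. If f has order 0, a pole of h comes from a zero of M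
   - phi or from the coefficients; at a pole of f, the reduced pole suffices. *)
have [p1|p1] := leP 1 p.
  case: p p1 h5 => // p p1 /(_ isT); rewrite -PoszM [(p * q 0)%N]mulnC.
  move: (q 0 * p)%N (m * p)%N => y x h5.
  have -> : (0 < p)%N by lia.
  case: oa h6 => oa h6; case: op h6 => op h6; case E: (c1 - n1) => [l|l]; case E2: (_ + n1) => [l2|l2]; lia.
have [p0|p0] := eqVneq p 0.
  rewrite p0 mul0r !muln0 in h5 *; have {}h5 := h5 isT.
  case: oa h6 => oa h6; case: op h6 => op h6; case E: (c1 - n1) => [l|l]; case E2: (_ + n1) => [l2|l2]; lia.
case: p p1 p0 {h5} => // p p1 p0; rewrite ?muln0; first lia.
case E: (c1 - n1) => [l|l]; lia.
Qed.

Lemma off_all n (P : nat -> R -> Prop) : (forall i, off (P i)) -> off (fun r => forall i, (i < n)%N -> P i r).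
Proof.
move=> hP; elim: n => [|n ih]; first by apply: offS (off_ge 0) => r _ [].
apply: offS (offI ih (hP n)) => r [h1 h2] i; rewrite ltnS leq_eqVlt => /orP[/eqP -> //|].
exact: h1.
Qed.

Lemma Q_eq w : f w != 0 -> Q w = G w / f w ^+ mu.
Proof.
move=> f0; rewrite /Q /G /M /mu -prodrXr.
rewrite (eq_bigr (fun i : 'I_k.+1 => D i w ^+ q i / f w ^+ q i)); last by move=> i _; rewrite expr_div_n.
rewrite prodf_div !mulrA; congr (_ / _).
by rewrite mulrAC.
Qed.

Lemma off_circts_Q : off (fun r => circts Q r).
Proof.
apply: offS (offI (offI (off_good ma) (off_good mphi)) (offI (off_good mf) (off_all k.+1 (fun i => off_good (mD i))))).
move=> r [[ga gp] [gf gD]]; apply: circtsM; first exact: circts_div.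
apply: (proximity_prod (F := fun (i : 'I_k.+1) w => (D i w / f w) ^+ q i) _ _).1 => i.
by apply: circtsX; apply: circts_div => //; exact: gD.
Qed.

Lemma small_Q : small f (fun r => proximity r Q).
Proof.
have [_ _ sTa _] := small_function_T tf sa; have [_ _ _ sTp] := small_function_T tf sphi.
have sS : small f (fun r => \sum_(i < k.+1) (q i)%:R * proximity r (fun w => D i w / f w)).
  apply: small_sum; first exact: small_cst.
  by move=> i; apply: smallZ; exact: small_ratio.
apply: small_squeeze (smallD (smallD sTa sTp) sS).
apply: offS (offI (offI (off_good ma) (off_good mphi)) (offI (off_ge 1) (offI (off_good mf) (off_all k.+1 (fun i => off_good (mD i)))))).
move=> r [[ga gp] [r1 [gf gD]]]; rewrite proximity_ge0 /=.
have cF (i : 'I_k.+1) : circts (fun w => D i w / f w) r by apply: circts_div => //; exact: gD.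
have [c1 c2] := @proximity_prod R 'I_k.+1 (index_enum _) (fun i w => (D i w / f w) ^+ q i) r (fun i => circtsX (q i) (cF i)).
apply: le_trans (proximityM (circts_div ga gp) c1) _.
apply: lerD.
  apply: le_trans (proximityM (good_circts ga) (circtsV gp)) _.
  by apply: lerD; rewrite /nevanlinna_T lerDl; apply: N_pole_ge0 => //; exact: merNZV.
apply: le_trans c2 _; rewrite le_eqVlt; apply/orP; left; apply/eqP; apply: eq_bigr => i _.
by rewrite proximityX.
Qed.

Definition coef_mult z := (zero_mult a z + pole_mult a z + zero_mult phi z + pole_mult phi z)%N.

Lemma discrete_coef : discrete_mult coef_mult.
Proof. by rewrite /coef_mult; repeat first [exact: discrete_zero | exact: discrete_pole | apply: discrete_multD]. Qed.

Lemma small_coef : small f (int_counting coef_mult).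
Proof.
have [_ _ s1 s2] := small_function_T tf sa; have [_ _ s3 s4] := small_function_T tf sphi.
apply: small_squeeze (smallD (smallD (smallD s2 s1) s4) s3).
apply: offS (off_ge 1) => r r1; rewrite int_counting_ge0 //=; last exact: discrete_coef.
have r0 : 0 < r by lra.
rewrite /coef_mult !int_countingD //; try exact: discrete_zero; try exact: discrete_pole; last 2 first.
- by repeat first [exact: discrete_zero | exact: discrete_pole | apply: discrete_multD].
- by repeat first [exact: discrete_zero | exact: discrete_pole | apply: discrete_multD].
have h1 := @N_zero_le_T R a r ma; have h2 := @N_zero_le_T R phi r mphi.
have h3 := proximity_ge0 r a; have h4 := proximity_ge0 r phi.
have E g : int_counting (zero_mult g) r = N_point r (fun _ => 0) g by [].
have E' g : int_counting (pole_mult g) r = N_pole r g by [].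
by rewrite !E !E'; move: h1 h2; rewrite /nevanlinna_T; lra.
Qed.

Let mu_inv_f r : good f r -> mu%:R * proximity r (fun w => (f w)^-1) = proximity r (fun w => (f w)^-1 ^+ mu).
Proof. by move=> gr; rewrite proximityX //; exact: circtsV. Qed.

Let rest r := Nbar_pole r f + (mu - q 0%N)%N%:R * N_point r (fun _ => 0) f + Nbar_point r (fun _ => 0) f + Nbar_point r phi M.

Lemma point_multE (b g : C -> C) : point_mult b g = zero_mult (fun w => g w - b w).
Proof. by apply/funext => z; rewrite zero_multE. Qed.

Let discrete_M : discrete_mult (zero_mult (fun w => M w - phi w)).
Proof. by apply: mer_discrete_zero => z; apply: mer_atD; [exact: merNZ_mer|apply: mer_atN; exact: merNZ_mer]. Qed.

Lemma main_nonconst : merNZ (cd G1) -> exists2 S, small f S & off (fun r => mu%:R * T f r <= rest r + S r).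
Proof.
move=> mG1'; have mG1 : merNZ G1.
  have [//|v1] := mer_alt merG1; have [n hn] := mG1' 0; case: (hord_nvanish hn).
  apply: cnearS (cd_punctured (v1 0) (holo_cst 0 0)) => w e wz.
  by rewrite e //; apply: cd_cder; exact: cder_cst.
have mh : merNZ h by apply: merNZM => //; exact: merNZV.
have modG1 : moderate f G1 by apply: (moderateB tf) => //; exact: (moderate_cst tf (oner_neq0 _)).
have [c1 hc1] := first_fundamental mf; have [c2 hc2] := first_fundamental mh.
(* [c1] and [c2] are the constants of the first fundamental theorem for f and h, and ln 2 comes from
   log^+ of a difference. [Q] occurs once in each term of the identity for 1/f^mu, the second time
   with G'/G. The term m(r, h) appears when 1/h is exchanged for h, and is small because h is the
   logarithmic derivative of G - 1. *)
exists (fun r => mu%:R * c1 + 2 * proximity r Q + proximity r (fun z => cd G z / G z) +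
   proximity r h + (ln 2 - c2) + int_counting coef_mult r).
  have s1 := smallD (small_cst tf (mu%:R * c1)) (smallZ 2 small_Q).
  have s2 := smallD (smallD s1 (moderate_logder tf moderate_G)) (moderate_logder tf modG1).
  exact: smallD (smallD s2 (small_cst tf _)) small_coef.
apply: offS (offI (offI (off_ge 1) off_circts_Q) (offI (offI (off_good mf) (off_good mG)) (offI (off_good mh) (offI (off_good mG1) (off_good mG1'))))).
move=> r [[r1 cQ] [[gf gG] [gh [gG1 gG1']]]]; have r0 : 0 < r by lra.
have cGG : circts (fun z => cd G z / G z) r.
  apply: circtsM; last exact: circtsV.
  by move=> t; apply: holo_cont; apply: holo_cd; case: (good_circle t gG).
have P1 : proximity r (fun w => (f w)^-1 ^+ mu) <=
    proximity r Q + (proximity r (fun z => cd G z / G z) + proximity r Q + proximity r (fun w => (h w)^-1)) + ln 2.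
  rewrite (@proximity_ext _ _ (fun w => Q w - (cd G w / G w * Q w) * (h w)^-1)).
    apply: le_trans (proximityB cQ _) _; first by apply: circtsM; [exact: circtsM|exact: circtsV].
    rewrite lerD2r lerD2l; apply: le_trans (proximityM _ (circtsV gh)) _; first exact: circtsM.
    by rewrite lerD2r; exact: proximityM.
  move=> t; set w := circle_pt r t.
  have [_ fw] := good_circle t gf; have [/holo_cdif dGw Gw] := good_circle t gG.
  have [_ G1w] := good_circle t gG1; have [_ G1w'] := good_circle t gG1'.
  rewrite -/w in fw dGw Gw G1w G1w'; rewrite (Q_eq fw) /h -(cd_G1 dGw) exprVn.
  have e1 : G1 w = G w - 1 by [].
  rewrite e1 in G1w *; move: G1w; move: (cd G1 w) (f w ^+ mu) (expf_neq0 mu fw) (G w) G1w' Gw => x y y0 g x0 g0 g1.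
  by field; rewrite x0 y0 g0 g1.
have N1 : N_pole r h + mu%:R * N_point r (fun _ => 0) f <=
    N_point r (fun _ => 0) h + Nbar_pole r f + (mu - q 0%N)%N%:R * N_point r (fun _ => 0) f +
    Nbar_point r (fun _ => 0) f + Nbar_point r phi M + int_counting coef_mult r.
  rewrite /Nbar_pole /Nbar_point /N_point /N_pole (point_multE phi) -!/(zero_mult _).
  have d1 := discrete_zero mf; have d2 := discrete_zero mh; have d3 := discrete_pole mh.
  have d4 := discrete_reduced (discrete_pole mf); have d5 := discrete_reduced d1.
  have d6 := discrete_reduced discrete_M; have d7 := discrete_coef.
  have d8 m := discrete_multZ m d1.
  have e1 := discrete_multD d2 d4; have e2 := discrete_multD e1 (d8 (mu - q 0)%N).
  have e3 := discrete_multD e2 d5; have e4 := discrete_multD e3 d6; have e5 := discrete_multD e4 d7.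
  rewrite -!int_countingZ //.
  rewrite -(int_countingD d3 (d8 mu)) // -(int_countingD d2 d4) // -(int_countingD e1) // -(int_countingD e2) //.
  rewrite -(int_countingD e3) // -(int_countingD e4) //.
  by apply: int_counting_le => // z; exact: mult_inequality.
have := hc2 r gh; rewrite (hc1 r gf) mulrDr /nevanlinna_T (N_poleV r mh) (N_poleV r mf) mulrDr (mu_inv_f gf).
rewrite /rest; move: P1 N1; move: (mu%:R * N_point r (fun _ => 0) f) (mu%:R * c1) (proximity r (fun w => (f w)^-1 ^+ mu)).
by move: ((mu - q 0%N)%N%:R * N_point r (fun _ => 0) f) => x1 x2 x3 x4; lra.
Qed.

(* If G is constant, every zero of f has a multiplicity bounded by the orders of a and phi. *)
Lemma main_const : (forall z, vanish_at (cd G1) z) -> exists2 S, small f S & off (fun r => mu%:R * T f r <= rest r + S r).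
Proof.
move=> vG.
have vG' z : vanish_at (cd G) z.
  by apply: cnearS (cnearI (vG z) (cd_G1_near z)) => w [e1 e2] wz; rewrite -e2 ?e1.
have o0 z : order_at G z = 0.
  apply/eqP; apply: contraT => n0; by case: (hord_nvanish (hord_cd n0 (hord_ord z mG)) (vG' z)).
have [v hv] : exists v, forall w, True -> holo v w /\ cnear w (fun x => x != w -> G x = v x).
  apply: (@regularize R G (fun _ => True)) => w _; first exact: cnearW.
  by have := hord_ord w mG; rewrite o0 => /hord0_holo[u [? _ ?]]; exists u.
have dv z : cd v z = 0.
  have [hz ez] := hv z I.
  apply: (@ccont_lim_eq R (cd v) (fun _ => 0)); [by apply: holo_cont; exact: holo_cd|exact: ccont_cst|].
  by apply: cnearS (cnearI (vG' z) (cd_punctured ez hz)) => w [h1 h2] wz; rewrite -h2 ?h1.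
have vc := entire_const (fun z => proj1 (hv z I)) dv.
have Gc w : regular G w -> G w = v 0.
  move=> [hG _]; have [hw ew] := hv w I; rewrite -(vc w).
  by apply: (@ccont_lim_eq R G v) => //; exact: holo_cont.
have [c1 hc1] := first_fundamental mf.
exists (fun r => mu%:R * c1 + proximity r Q + log_plus (cmod (v 0)^-1) + int_counting coef_mult r).
  exact: smallD (smallD (smallD (small_cst tf _) small_Q) (small_cst tf _)) small_coef.
apply: offS (offI (offI (off_ge 1) off_circts_Q) (offI (off_good mf) (off_good mG))).
move=> r [[r1 cQ] [gf gG]]; have r0 : 0 < r by lra.
have P1 : proximity r (fun w => (f w)^-1 ^+ mu) <= proximity r Q + log_plus (cmod (v 0)^-1).
  have -> : log_plus (cmod (v 0)^-1) = proximity r (fun _ => (v 0)^-1) by rewrite proximityE rmean_cst.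
  rewrite (@proximity_ext _ _ (fun w => Q w * (v 0)^-1)).
    by apply: proximityM => // t; exact: ccont_cst.
  move=> t; set w := circle_pt r t.
  have [_ fw] := good_circle t gf; have [_ Gw] := good_circle t gG.
  rewrite -/w in fw Gw; rewrite (Q_eq fw) -(Gc w (good_circle t gG)) exprVn mulrAC mulfV // mul1r.
  by [].
have N1 : mu%:R * N_point r (fun _ => 0) f <= (mu - q 0%N)%N%:R * N_point r (fun _ => 0) f + int_counting coef_mult r.
  rewrite /N_point -!/(zero_mult _); have d1 := discrete_zero mf.
  have d8 m := discrete_multZ m d1; have d7 := discrete_coef.
  rewrite -!int_countingZ // -(int_countingD (d8 (mu - q 0)%N) d7) //.
  apply: int_counting_le => //; first exact: discrete_multD.
  move=> z; have := order_G z; rewrite o0; have := @order_D_sum z; set s := \sum_(i < _) _.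
  have -> : (mu * zero_mult f z = (mu - q 0) * zero_mult f z + q 0 * zero_mult f z)%N.
    by rewrite -mulnDl subnK // leq_q0.
  rewrite /coef_mult /pole_mult !zero_multE leq_add2l.
  move: (order_at f z) (order_at a z) (order_at phi z) => p oa op h5 h6.
  case: p h5 => [p /(_ isT)|p _]; last by rewrite muln0.
  rewrite -PoszM [(p * q 0)%N]mulnC; move: (q 0 * p)%N => y h5.
  by case: oa h6 => oa h6; case: op h6 => op h6; lia.
have d1 := discrete_zero mf.
have B1 : 0 <= Nbar_pole r f by apply: int_counting_ge0 => //; apply: discrete_reduced; exact: discrete_pole.
have B2 : 0 <= Nbar_point r (fun _ => 0) f by apply: int_counting_ge0 => //; apply: discrete_reduced; exact: d1.
have B3 : 0 <= Nbar_point r phi M.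
  by rewrite /Nbar_point point_multE; apply: int_counting_ge0 => //; exact: discrete_reduced.
rewrite (hc1 r gf) mulrDr /nevanlinna_T (N_poleV r mf) mulrDr (mu_inv_f gf) /rest.
move: P1 N1 B1 B2 B3; move: (mu%:R * N_point r (fun _ => 0) f) (mu%:R * c1) (proximity r (fun w => (f w)^-1 ^+ mu)).
by move: ((mu - q 0%N)%N%:R * N_point r (fun _ => 0) f) => x1 x2 x3 x4; lra.
Qed.

Lemma main_bound : exists2 S, small f S & off (fun r => mu%:R * T f r <= rest r + S r).
Proof.
have [|] := mer_alt (fun z => mer_at_cd (merG1 z)); [exact: main_nonconst|exact: main_const].
Qed.

(** The comparison of orders yields coefficient 1 at the reduced counting function of the zeros of
    f; the [m] additional copies are nonnegative for r >= 1. *)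
Lemma rest_le (m : nat) r : 1 <= r -> rest r <= Nbar_pole r f + (mu - q 0%N)%N%:R * N_point r (fun _ => 0) f
  + (1 + m)%:R * Nbar_point r (fun _ => 0) f + Nbar_point r phi M.
Proof.
move=> r1; rewrite /rest lerD2r lerD2l natrD mulrDl mul1r lerDl mulr_ge0 //.
by apply: int_counting_ge0 => //; apply: discrete_reduced; exact: discrete_zero.
Qed.

End Monomial.

Theorem theorem2p1 (R : realType) (f phi a : R[i] -> R[i]) (k : nat)
    (q : nat -> nat)
    (hf : transcendental_meromorphic f)
    (hphi : small_function f phi)
    (ha : small_function f a)
    (hk : (1 <= k)%N) (hq0 : (1 <= q 0)%N) (hqk : (1 <= q k)%N) :
  let mu := (\sum_(i < k.+1) q i)%N in
  let mu_star := (\sum_(i < k.+1) i * q i)%N in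
  exists S : R -> R, is_S f S /\
    forall r : R, 0 < r ->
      mu%:R * nevanlinna_T r f <=
        Nbar_pole r f
        + (mu - q 0%N)%N%:R * N_point r (fun _ => 0) f
        + (1 + mu_star)%N%:R * Nbar_point r (fun _ => 0) f
        + Nbar_point r phi (diff_monomial a k q f)
        + S r.
Proof.
move=> mu mu_star; pose rhs r := Nbar_pole r f + (mu - q 0%N)%N%:R * N_point r (fun _ => 0) f
  + (1 + mu_star)%N%:R * Nbar_point r (fun _ => 0) f + Nbar_point r phi (diff_monomial a k q f).
have [S sS hS] := main_bound k q hf hphi ha.
(* With this choice the inequality holds at every radius by construction. Off the exceptional set
   the positive part is dominated by the error term of [main_bound], hence is small. *)
exists (fun r => Num.max 0 (mu%:R * nevanlinna_T r f - rhs r)); split; last first.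
  by move=> r _; rewrite -/(rhs r) -lerBlDl le_max lexx orbT.
apply/small_is_S; apply: small_le sS; apply: offS (offI hS (off_ge 1)) => r [h r1].
have := rest_le phi a k q hf mu_star r1; rewrite -/mu => h2.
rewrite ger0_norm ?le_max ?lexx // ge_max normr_ge0 /=.
apply: le_trans (ler_norm _); rewrite lerBlDl; apply: le_trans h _.
by rewrite lerD2r.
Qed.
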